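(* Let $\mathcal{K}_0^+$ be the set of all $g\in\mathcal{S}$ such that $g(\ell+)=0$, $g$ is non-decreasing and $\frac{d^+g}{ds}\le 1$, and let $\mathcal{K}_0^-$ be the set of all $g\in\mathcal{S}$ such that $g(r-)=0$, $g$ is non-increasing and $\frac{d^-g}{ds}\ge -1$. Then the following hold. (1) The set of extremal elements of $\mathcal{K}_0^+$ is $$\{x\mapsto k(s(x)-s(y))^+ : k\in(0,1],\ y\in(\ell,r)\}\quad\text{if } s(\ell)=-\infty,$$ $$\{x\mapsto k(s(x)-s(y))^+ : k\in(0,1],\ y\in[\ell,r)\}\quad\text{if } s(\ell)>-\infty.$$ In particular, if $g\in\mathcal{S}$ is non-constant, non-decreasing and its right $s$-derivative $\frac{d^+g}{ds}$ is bounded on $(\ell,r)$, then there exist a constant $\kappa$ and a finite Borel measure $\mu$ with $\mu(\{\ell,r\})=0$ such that for all $x\in(\ell,r)$ $$g(x)=g(\ell)+\kappa\,(s(x)-s(\ell))+\int_\ell^r (s(x)-s(y))^+\,\mu(dy),$$ where $\kappa=0$ if $s(\ell)=-\infty$ (with the convention $0\times\infty=0$). (2) The set of extremal elements of $\mathcal{K}_0^-$ is $$\{x\mapsto k(s(y)-s(x))^+ : k\in(0,1],\ y\in(\ell,r)\}\quad\text{if } s(r)=\infty,$$ $$\{x\mapsto k(s(y)-s(x))^+ : k\in(0,1],\ y\in(\ell,r]\}\quad\text{if } s(r)<\infty.$$ In particular, if $g\in\mathcal{S}$ is non-constant, non-increasing and its left $s$-derivative $\frac{d^-g}{ds}$ is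 bounded on $(\ell,r)$, then there exist a constant $\kappa$ and a finite Borel measure $\mu$ with $\mu(\{\ell,r\})=0$ such that for all $x\in(\ell,r)$ $$g(x)=g(r)+\kappa\,(s(r)-s(x))+\int_\ell^r (s(y)-s(x))^+\,\mu(dy),$$ where $\kappa=0$ if $s(r)=\infty$ (with the convention $0\times\infty=0$).
   Context: Let $-\infty\le\ell<r\le\infty$ and let $X=(\Omega,\mathcal F,\mathcal F_t,X_t,\theta_t,P^x)$ be a regular one-dimensional diffusion on $(\ell,r)$ with no killing inside $(\ell,r)$ and absorbing boundaries; $P^x$ is the law of $X$ started at $x$. Its scale function $s$ is strictly increasing and continuous (no absolute continuity is assumed), extended to $\ell,r$ by limits. For $\ell<a<b<r$, $T_{ab}$ is the exit time from $(a,b)$ and $X^{T_{ab}}$ is $X$ stopped at $T_{ab}$. A Borel function $g:(\ell,r)\to\mathbb R$ is subharmonic if for every $x\in(\ell,r)$, $g(X^{T_{ab}})$ is a uniformly integrable $P^x$-submartingale whenever $\ell<a<b<r$. $\mathcal S$ is the class of non-negative subharmonic functions. Such functions are convex functions of $s$ ($s$-convex), so their right and left $s$-derivatives $\frac{d^+g}{ds},\frac{d^-g}{ds}$ exist, and they are extended to $\ell$ and $r$ by continuity: $g(\ell)=g(\ell+)$, $g(r)=g(r-)$. Extremal elements are understood in the following sense: $g\in\mathcal K_0^{\pm}$, not identically $0$, is extremal if whenever $g=g_1+g_2$ with $g_1,g_2\in\mathcal K_0^{\pm}$, there are constants $k_1,k_2$ with $g_i=k_ig$, $i=1,2$ (so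 $k_1+k_2=1$). *)

(* Defs.v *)
From HB Require Import structures.
From mathcomp Require Import all_boot all_order all_algebra.
From mathcomp Require Import all_classical all_reals all_analysis.
From mathcomp Require Import measurable_realfun.
Set Implicit Arguments.
Unset Strict Implicit.
Unset Printing Implicit Defensive.
Import Order.TTheory GRing.Theory Num.Theory.
Import numFieldNormedType.Exports.
Local Open Scope classical_set_scope.
Local Open Scope ring_scope.
Local Open Scope ereal_scope.

(* Time is [0, +oo[: processes and filtrations are indexed by R, and only the
   indices t >= 0 are constrained. *)

Definition sub_measurable (T : Type) d' (T' : measurableType d')
    (G : set (set T)) (f : T -> T') : Prop :=
  forall B, measurable B -> G (f @^-1` B).

(* Y is a version of the conditional expectation of Z given G. *)
Definition is_cond_exp (R : realType) d (Omega : measurableType d)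
    (P : probability Omega R) (G : set (set Omega)) (Z Y : Omega -> R) : Prop :=
  [/\ sub_measurable G Y,
      P.-integrable setT (EFin \o Y) &
      forall A, G A ->
        \int[P]_(w in A) (Y w)%:E = \int[P]_(w in A) (Z w)%:E].

Definition is_filtration (R : realType) d (Omega : measurableType d)
    (F : R -> set (set Omega)) : Prop :=
  [/\ forall t : R, (0 <= t)%R -> sigma_algebra setT (F t),
      forall t : R, (0 <= t)%R -> F t `<=` measurable &
      forall u t : R, (0 <= u <= t)%R -> F u `<=` F t].

Definition stopping_time (R : realType) d (Omega : measurableType d)
    (F : R -> set (set Omega)) (tau : Omega -> \bar R) : Prop :=
  (forall w, 0 <= tau w) /\
  (forall t : R, (0 <= t)%R -> F t [set w | tau w <= t%:E]).

(* The sigma-algebra F_tau of events prior to tau. *)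
Definition stopped_sigma (R : realType) d (Omega : measurableType d)
    (F : R -> set (set Omega)) (tau : Omega -> \bar R) : set (set Omega) :=
  [set A | measurable A /\
    forall t : R, (0 <= t)%R -> F t (A `&` [set w | tau w <= t%:E])].

Definition submartingale (R : realType) d (Omega : measurableType d)
    (P : probability Omega R) (F : R -> set (set Omega))
    (M : R -> Omega -> R) : Prop :=
  [/\ forall t : R, (0 <= t)%R -> sub_measurable (F t) (M t),
      forall t : R, (0 <= t)%R -> P.-integrable setT (EFin \o M t) &
      forall u t : R, (0 <= u <= t)%R ->
        exists Y, is_cond_exp P (F u) (M t) Y /\
                  {ae P, forall w, (M u w <= Y w)%R}].

Definition uniformly_integrable (R : realType) d (Omega : measurableType d)
    (P : probability Omega R) (M : R -> Omega -> R) : Prop :=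
  forall e : R, (0 < e)%R -> exists K : R, forall t : R, (0 <= t)%R ->
    \int[P]_(w in [set w | (K <= `|M t w|)%R]) (`|M t w|)%:E <= e%:E.

(* The sigma-algebra generated by all the X_t, t >= 0. *)
Definition natural_sigma (R : realType) (Omega : Type)
    (X : R -> Omega -> \bar R) : set (set Omega) :=
  <<s [set A | exists t : R, (0 <= t)%R /\
        exists B : set (\bar R), measurable B /\ A = X t @^-1` B] >>.

Definition hitting_time (R : realType) (Omega : Type)
    (X : R -> Omega -> \bar R) (y : \bar R) (w : Omega) : \bar R :=
  ereal_inf [set t%:E | t in [set t : R | (0 <= t)%R /\ X t w = y]].

Definition exit_time (R : realType) (Omega : Type)
    (X : R -> Omega -> \bar R) (a b : \bar R) (w : Omega) : \bar R :=
  ereal_inf [set t%:E | t in [set t : R | (0 <= t)%R /\ ~ (a < X t w < b)]].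

Definition stopped (R : realType) (Omega : Type) (X : R -> Omega -> \bar R)
    (tau : Omega -> \bar R) : R -> Omega -> \bar R :=
  fun t w => X (fine (mine t%:E (tau w))) w.

(* Regular one-dimensional diffusions on (l, r), with infinite lifetime (no
   killing) and absorbing boundaries: continuous strong Markov processes.  The
   state space is (l, r) together with some of the points l, r (those that
   may be reached), so the paths live in the extended reals; the values of
   [law] outside the state space are irrelevant. *)
Record diffusion (R : realType) (l r : \bar R) d (Omega : measurableType d) :=
  Diffusion {
  state : set (\bar R) ;
  filt : R -> set (set Omega) ;
  coord : R -> Omega -> \bar R ;
  theta : R -> Omega -> Omega ;
  law : \bar R -> probability Omega R ;

  state_inner : `]l, r[%classic `<=` state ;
  state_closure : state `<=` `[l, r]%classic ;
  coord_state : forall (t : R) w, (0 <= t)%R -> state (coord t w) ;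
  coord_continuous : forall w,
    {within `[0%R, +oo[%classic, continuous (fun t : R => coord t w)} ;
  filt_filtration : is_filtration filt ;
  coord_adapted : forall t : R, (0 <= t)%R -> sub_measurable (filt t) (coord t) ;
  coord_theta : forall (u t : R) w, (0 <= u)%R -> (0 <= t)%R ->
    coord u (theta t w) = coord (t + u)%R w ;
  law_start : forall x, state x -> {ae law x, forall w, coord 0%R w = x} ;
  law_measurable : forall B, natural_sigma coord B ->
    measurable_fun state (fun x => law x B) ;
  strong_markov : forall x, state x ->
    forall tau, stopping_time filt tau ->
    forall B, natural_sigma coord B ->
      is_cond_exp (law x) (stopped_sigma filt tau)
        (\1_[set w | tau w < +oo /\ B (theta (fine (tau w)) w)])
        (fun w => if tau w < +oo
                  then fine (law (coord (fine (tau w)) w) B) else 0%R) ;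
  boundary_absorbing : forall e, state e -> e = l \/ e = r ->
    {ae law e, forall w, forall t : R, (0 <= t)%R -> coord t w = e} ;
  regularity : forall x y, l < x < r -> l < y < r ->
    0 < law x [set w | hitting_time coord y w < +oo]
}.

(* The interval (l, r) as a set of real numbers. *)
Definition inner_set (R : realType) (l r : \bar R) : set R :=
  [set x : R | l < x%:E < r].

(* Scale functions and functions on (l, r) are functions R -> R whose values
   outside (l, r) are irrelevant. *)
Record is_scale_function (R : realType) (l r : \bar R) d
    (Omega : measurableType d) (X : diffusion l r Omega) (s : R -> R) : Prop := {
  scale_increasing : forall x y : R, inner_set l r x -> inner_set l r y ->
    (x < y)%R -> (s x < s y)%R ;
  scale_continuous : {within inner_set l r, continuous s} ;
  scale_exit_left : forall a x b : R, l < a%:E -> (a < x < b)%R -> b%:E < r ->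
    law X x%:E [set w | hitting_time (coord X) a%:E w
                        < hitting_time (coord X) b%:E w]
    = ((s b - s x) / (s b - s a))%:E ;
  scale_exit_right : forall a x b : R, l < a%:E -> (a < x < b)%R -> b%:E < r ->
    law X x%:E [set w | hitting_time (coord X) b%:E w
                        < hitting_time (coord X) a%:E w]
    = ((s x - s a) / (s b - s a))%:E
}.

(* The trace on (l, r) of the neighborhoods of an end-point e (possibly
   infinite). *)
Definition at_end (R : realType) (l r e : \bar R) : set_system (\bar R) :=
  within `]l, r[%classic (nbhs e).

(* Extension of f : (l, r) -> R to [l, r] by its limits at l and r. *)
Definition extend (R : realType) (l r : \bar R) (f : R -> R) (y : \bar R) :
    \bar R :=
  if (y == l) || (y == r) then lim ((fun z => (f (fine z))%:E) @ at_end l r y)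
  else (f (fine y))%:E.

(* g evaluated on the state space.  The value 0 off (l, r) only matters on
   P^x-null sets below, since X stopped at T_ab stays in (l, r) under P^x. *)
Definition on_inner (R : realType) (l r : \bar R) (g : R -> R) (y : \bar R) : R :=
  if l < y < r then g (fine y) else 0%R.

Definition subharmonic (R : realType) (l r : \bar R) d
    (Omega : measurableType d) (X : diffusion l r Omega) (g : R -> R) : Prop :=
  measurable_fun (inner_set l r) g /\
  forall x a b : R, inner_set l r x -> l < a%:E -> (a < b)%R -> b%:E < r ->
    let M := fun t w =>
      on_inner l r g (stopped (coord X) (exit_time (coord X) a%:E b%:E) t w) in
    submartingale (law X x%:E) (filt X) M /\
    uniformly_integrable (law X x%:E) M.

(* The class S. *)
Definition nneg_subharmonic (R : realType) (l r : \bar R) d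
    (Omega : measurableType d) (X : diffusion l r Omega) : set (R -> R) :=
  [set g | subharmonic X g /\ forall x, inner_set l r x -> (0 <= g x)%R].

Definition right_sderiv (R : realType) (s g : R -> R) (x : R) : R :=
  lim ((fun y : R => (g y - g x) / (s y - s x))%R @ x^'+).

Definition left_sderiv (R : realType) (s g : R -> R) (x : R) : R :=
  lim ((fun y : R => (g y - g x) / (s y - s x))%R @ x^'-).

Definition nondecreasing_on (R : realType) (I : set R) (g : R -> R) : Prop :=
  forall x y, I x -> I y -> (x <= y)%R -> (g x <= g y)%R.

Definition nonincreasing_on (R : realType) (I : set R) (g : R -> R) : Prop :=
  forall x y, I x -> I y -> (x <= y)%R -> (g y <= g x)%R.

Definition nonconstant_on (R : realType) (I : set R) (g : R -> R) : Prop :=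
  ~ exists c : R, forall x, I x -> g x = c.

Definition bounded_fun_on (R : realType) (I : set R) (f : R -> R) : Prop :=
  exists C : R, forall x, I x -> (`|f x| <= C)%R.

Definition K0plus (R : realType) (l r : \bar R) d (Omega : measurableType d)
    (X : diffusion l r Omega) (s : R -> R) : set (R -> R) :=
  [set g | [/\ nneg_subharmonic X g,
      (fun z => g (fine z)) @ at_end l r l --> (0 : R)%R,
      nondecreasing_on (inner_set l r) g &
      forall x, inner_set l r x -> (right_sderiv s g x <= 1)%R]].

Definition K0minus (R : realType) (l r : \bar R) d (Omega : measurableType d)
    (X : diffusion l r Omega) (s : R -> R) : set (R -> R) :=
  [set g | [/\ nneg_subharmonic X g,
      (fun z => g (fine z)) @ at_end l r r --> (0 : R)%R,
      nonincreasing_on (inner_set l r) g &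
      forall x, inner_set l r x -> (-1 <= left_sderiv s g x)%R]].

(* Extremal elements of a class K of functions on I. *)
Definition extremal (R : realType) (I : set R) (K : set (R -> R)) :
    set (R -> R) :=
  [set g | [/\ K g,
      exists x, I x /\ g x <> 0%R &
      forall g1 g2, K g1 -> K g2 ->
        (forall x, I x -> g x = (g1 x + g2 x)%R) ->
        exists k1 k2 : R, (forall x, I x -> g1 x = (k1 * g x)%R) /\
                          (forall x, I x -> g2 x = (k2 * g x)%R)]].

(* (s(x) - s(y))^+ and (s(y) - s(x))^+, for x in (l, r) and y in [l, r]. *)
Definition call (R : realType) (l r : \bar R) (s : R -> R) (x : R) (y : \bar R) :
  \bar R := maxe ((s x)%:E - extend l r s y) 0.

Definition put (R : realType) (l r : \bar R) (s : R -> R) (x : R) (y : \bar R) :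
  \bar R := maxe (extend l r s y - (s x)%:E) 0.

(* The functions equal on (l, r) to x |-> k (s(x) - s(y))^+, respectively
   x |-> k (s(y) - s(x))^+, for some k in (0, 1] and y in D. *)
Definition calls (R : realType) (l r : \bar R) (s : R -> R) (D : set (\bar R)) :
    set (R -> R) :=
  [set g | exists (k : R) (y : \bar R), [/\ (0 < k <= 1)%R, D y &
      forall x, inner_set l r x -> (g x)%:E = k%:E * call l r s x y]].

Definition puts (R : realType) (l r : \bar R) (s : R -> R) (D : set (\bar R)) :
    set (R -> R) :=
  [set g | exists (k : R) (y : \bar R), [/\ (0 < k <= 1)%R, D y &
      forall x, inner_set l r x -> (g x)%:E = k%:E * put l r s x y]].

(* Main.v *)
Require Import Defs.
From HB Require Import structures.
From mathcomp Require Import all_boot all_order all_algebra.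
From mathcomp Require Import all_classical all_reals all_analysis.
From mathcomp Require Import measurable_realfun.
From mathcomp Require Import ring lra.
Set Implicit Arguments.
Unset Strict Implicit.
Unset Printing Implicit Defensive.
Import Order.TTheory GRing.Theory Num.Theory.
Import numFieldNormedType.Exports.
Local Open Scope classical_set_scope.
Local Open Scope ring_scope.
Local Open Scope ereal_scope.

(** A nonnegative function g is subharmonic for the diffusion exactly when it is
convex as a function of s, at least for functions that are Lipschitz in s; after
this translation the theorem is one-dimensional convex analysis in the variable s.

From subharmonic to s-convex (subharmonic_sconvex): the mean of g at the process
stopped at T_ab increases with time and, by uniform integrability, tends to
g (a) (s b - s x) / (s b - s a) + g (b) (s x - s a) / (s b - s a). Conversely
(sconvex_subharmonic): by the Markov property s of the stopped process is a
martingale (left_weight_mean), Jensen's inequality is applied with a supporting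
line of g (clip_mean), and the conditional expectations are given explicitly by
the Markov property for functions of the path (markov_fun). Measurability of the
stopped process with respect to the given filtration, which need not be
right-continuous, is reduced to events decided by countably many times.

The first class of the theorem thus consists of the s-convex, nonnegative,
nondecreasing functions that are 1-Lipschitz in s and vanish at l (K0plusE).
A call function is extremal, since the summands of a linear function are linear if
they are convex (ramp_extremal). Conversely, any g in the class is the sum of the
function that continues g along its tangent to the right of y and of the excess
over that tangent. If g is extremal, then at each y it is zero to the left of y or
linear to the right of y, and this leaves only call functions (extremal_ramp).

For the integral representation, the right derivative of g in s is the distribution
function of a finite measure, and g satisfies the Taylor formula
g (x') = g (x) + (dg/ds) (x) (s x' - s x) + integral of s x' - s y over ]x, x']
(taylor_scale). No integration by parts is needed: the error is additive over
intervals and bounded by a product of two increments, hence zero. The formula of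
the theorem follows as x tends to l (nondecreasing_representation).

The second class is obtained by the reflection x -> -x, which acts on the analytic
description of the classes; the diffusion itself is not reflected. *)

Import HBNNSimple.
Local Notation coord := Defs.coord.

(** * The interval (l, r) *)

Local Close Scope ereal_scope.

Section inner.
Context {R : realType} {l r : \bar R}.
Local Notation I := (inner_set l r).

Lemma inner_between a b x : I a -> I b -> a <= x <= b -> I x.
Proof.
move=> /andP[la _] /andP[_ br] /andP[ax xb]; apply/andP; split.
  by apply: (lt_le_trans la); rewrite lee_fin.
by apply: le_lt_trans br; rewrite lee_fin.
Qed.

Lemma inner_fin (y : \bar R) : (l < y < r)%E -> exists2 x, y = x%:E & I x.
Proof.
case: y => [x| |] yD; [by exists x|move: yD..];
  by rewrite ?[(_ < -oo)%E]ltNge ?leNye ?[(+oo < _)%E]ltNge ?leey ?andbF.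
Qed.

Lemma inner_prev x : I x -> exists2 y, I y & y < x.
Proof.
move=> /andP[lx xr]; move: lx; case: l => [m||] lx.
- rewrite lte_fin in lx; exists ((m + x) / 2); last lra.
  by rewrite /inner_set/= lte_fin; apply/andP; split; [lra|
    apply: lt_trans xr; rewrite lte_fin; lra].
- by move: lx; rewrite ltNge leey.
- exists (x - 1); last lra.
  rewrite /inner_set/= ltNyr/=; apply: lt_trans xr; rewrite lte_fin; lra.
Qed.

Lemma inner_next x : I x -> exists2 y, I y & x < y.
Proof.
move=> /andP[lx xr]; move: xr; case: r => [m||] xr.
- rewrite lte_fin in xr; exists ((x + m) / 2); last lra.
  rewrite /inner_set/= lte_fin; apply/andP; split; last lra.
  apply: (lt_trans lx); rewrite lte_fin; lra.
- exists (x + 1); last lra.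
  rewrite /inner_set/= ltry andbT; apply: (lt_trans lx); rewrite lte_fin; lra.
- by move: xr; rewrite ltNge leNye.
Qed.

Lemma inner_nonempty : (l < r)%E -> exists x, I x.
Proof.
rewrite /inner_set/=.
case: l r => [m||] [n||]; rewrite ?ltxx ?lte_fin// => mn.
- by exists ((m + n) / 2); rewrite !lte_fin; apply/andP; split; lra.
- by exists (m + 1); rewrite ltry lte_fin andbT; lra.
- by exists (n - 1); rewrite ltNyr lte_fin; lra.
- by exists 0; rewrite ltNyr ltry.
Qed.

Lemma open_inner : open I.
Proof.
rewrite (_ : I = [set x : R | (l < x%:E)%E] `&` [set x : R | (x%:E < r)%E]).
  by apply: openI; [exact: open_ereal_gt|exact: open_ereal_lt].
by apply/seteqP; split => x /= /andP.
Qed.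

Lemma measurable_inner : measurable I.
Proof.
rewrite (_ : I = setT `&` EFin @^-1` `]l, r[%classic).
  by apply: EFin_measurable => //; exact: emeasurable_itv.
by rewrite setTI; apply/seteqP; split => x; rewrite /= in_itv.
Qed.

End inner.
Arguments measurable_inner {R} l r.

(** * Continuous paths: hitting, exit and stopping *)

Local Open Scope ereal_scope.

Section paths.
Context {R : realType} {T : Type}.
Implicit Types (X : R -> T -> \bar R) (a b c t u v : R) (w : T).

Definition cont_path X w :=
  {within `[0%R, +oo[%classic, continuous (fun t : R => X t w)}.

Definition alive X a b t : set T :=
  [set w | forall u : R, (0 <= u <= t)%R -> a%:E < X u w < b%:E].

Definition hit X c t : set T :=
  [set w | exists u : R, (0 <= u <= t)%R /\ X u w = c%:E].

(** The point a is visited, and before b: one time u witnesses both, so that the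
event is a countable union as soon as u can be taken in a countable set. *)
Definition hit_first X a b t : set T :=
  [set w | exists u : R, (0 <= u <= t)%R /\ (hit X a u `\` hit X b u) w].

Lemma hit_first_le X a b t u w : (t <= u)%R ->
  hit_first X a b t w -> hit_first X a b u w.
Proof.
move=> tu [v [/andP[v0 vt] hv]]; exists v; split => //.
by rewrite v0 (le_trans vt).
Qed.

Lemma contract_continuous : continuous (@contract R).
Proof.
move=> x; apply/cvgrPdist_lt => e e0.
by apply/(@nbhs_ballP R (\bar R)); exists e.
Qed.

Lemma extend_path_continuous X w : cont_path X w ->
  continuous (fun t => X (Num.max t 0%R) w).
Proof.
move=> /subspace_continuousP cX t.
have A0 : `[0%R, +oo[%classic (Num.max t 0%R).
  by rewrite /= in_itv/= andbT le_max lexx orbT.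
apply: cvg_trans (cX _ A0).
move=> B [e/= e0 eB]; exists e => //= s se.
apply: eB => /=.
- rewrite /ball/= in se *.
  rewrite !ltr_norml in se *.
  by case: (leP t 0%R) => t0; case: (leP s 0%R) => s0; lra.
- by rewrite /= in_itv/= andbT le_max lexx orbT.
Qed.

(** By continuity the times spent outside the open set U form a closed set, which
contains its infimum. *)
Lemma entry_attained X w (U : set (\bar R)) t : cont_path X w -> open U ->
  (0 <= t)%R -> ~ U (X t w) ->
  exists u, [/\ (0 <= u <= t)%R, ~ U (X u w) &
    forall v, (0 <= v < u)%R -> U (X v w)].
Proof.
move=> cX oU t0 nUt.
pose S := [set v : R | (0 <= v)%R /\ ~ U (X v w)].
have hS : has_inf S by split; [exists t|exists 0%R => v []].
have u0 : (0 <= inf S)%R by apply: lb_le_inf; [exists t|move=> v []].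
exists (inf S); split.
- by rewrite u0/=; apply: ge_inf => //; exact: hS.2.
- move=> Uu.
  have := extend_path_continuous cX (x := inf S) => /(_ U).
  rewrite (max_idPl u0) => /(_ (open_nbhs_nbhs (conj oU Uu))) [e/= e0 eU].
  have [v [v0 nUv] ve] := inf_adherent e0 hS.
  have uv : (inf S <= v)%R by apply: ge_inf => //; exact: hS.2.
  apply: nUv; have := eU v; rewrite /= (max_idPl v0); apply.
  by rewrite /ball/= distrC ger0_norm ?subr_ge0//; lra.
- move=> v /andP[v0 vu]; apply: contrapT => nUv.
  by move: vu; rewrite ltNge => /negP; apply; apply: ge_inf => //; exact: hS.2.
Qed.

Lemma entry_timeP X w (U : set (\bar R)) : cont_path X w -> open U ->
  let tau := ereal_inf [set t%:E | t in
                 [set t : R | (0 <= t)%R /\ ~ U (X t w)]] in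
  (tau = +oo /\ forall u, (0 <= u)%R -> U (X u w)) \/
  (exists u, [/\ (0 <= u)%R, tau = u%:E, ~ U (X u w) &
    forall v, (0 <= v < u)%R -> U (X v w)]).
Proof.
move=> cX oU tau.
have [[t [t0 nUt]]|nS] := pselect (exists t, (0 <= t)%R /\ ~ U (X t w)).
- right; have [u [/andP[u0 ut] nUu uU]] := entry_attained cX oU t0 nUt.
  exists u; split => //; apply/eqP; rewrite eq_le; apply/andP; split.
    by apply: ereal_inf_lbound; exists u.
  apply: le_ereal_inf_tmp => _ [v [v0 nUv] <-]; rewrite lee_fin leNgt.
  by apply/negP => vu; apply: nUv; apply: uU; rewrite v0.
- left; split.
    rewrite /tau (_ : [set t | _] = set0) ?image_set0 ?ereal_inf0//.
    by apply/seteqP; split => // t /= tS; apply: nS; exists t.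
  by move=> u u0; apply: contrapT => nUu; apply: nS; exists u.
Qed.

Lemma open_eitv a b : open [set z : \bar R | a%:E < z < b%:E].
Proof.
rewrite (_ : [set _ | _] = [set z | a%:E < z] `&` [set z | z < b%:E]).
  by apply: openI; [exact: open_ereal_gt_ereal|exact: open_ereal_lt_ereal].
by apply/seteqP; split => z /= /andP.
Qed.

Lemma open_eneq c : open [set z : \bar R | z <> c%:E].
Proof.
rewrite (_ : [set z | _] = ~` [set c%:E])//; apply: closed_openC.
exact: accessible_closed_set1 (hausdorff_accessible (@ereal_hausdorff R)) _.
Qed.

Lemma exit_timeP X a b w : cont_path X w ->
  (exit_time X a%:E b%:E w = +oo /\ forall u, (0 <= u)%R -> a%:E < X u w < b%:E) \/
  (exists u, [/\ (0 <= u)%R, exit_time X a%:E b%:E w = u%:E,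
    ~ (a%:E < X u w < b%:E) &
    forall v, (0 <= v < u)%R -> a%:E < X v w < b%:E]).
Proof.
move=> cX; have := entry_timeP cX (@open_eitv a b).
exact.
Qed.

Lemma hitting_timeP X c w : cont_path X w ->
  (hitting_time X c%:E w = +oo /\ forall u, (0 <= u)%R -> X u w <> c%:E) \/
  (exists u, [/\ (0 <= u)%R, hitting_time X c%:E w = u%:E,
    X u w = c%:E &
    forall v, (0 <= v < u)%R -> X v w <> c%:E]).
Proof.
move=> cX; have := entry_timeP cX (@open_eneq c).
rewrite /hitting_time (_ : [set t | (0 <= t)%R /\ ~ _] =
  [set t : R | (0 <= t)%R /\ X t w = c%:E]); last first.
  by apply/seteqP; split => t /= [t0]; [move/contrapT|move=> ->; split => //].
move=> [?|[u [u0 tau nX Xv]]]; [by left|right; exists u; split => //].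
exact: contrapT.
Qed.

Lemma alive_exit_time X a b t w : cont_path X w -> (0 <= t)%R ->
  alive X a b t w <-> t%:E < exit_time X a%:E b%:E w.
Proof.
move=> cX t0; have [[-> Xv]|[u [u0 -> nX Xv]]] := exit_timeP a b cX.
  by split => [_|_ v /andP[v0 _]]; [rewrite ltry|exact: Xv].
rewrite lte_fin; split.
  by move=> At; rewrite ltNge; apply/negP => ut; apply: nX; apply: At; rewrite u0.
by move=> tu v /andP[v0 vt]; apply: Xv; rewrite v0 (le_lt_trans vt).
Qed.

(** By continuity the path is still in the closed interval [a, b] at the time when
it leaves (a, b). *)
Lemma exit_endpoint X a b u w : cont_path X w -> (0 <= u)%R ->
  a%:E < X 0%R w < b%:E -> ~ (a%:E < X u w < b%:E) ->
  (forall v, (0 <= v < u)%R -> a%:E < X v w < b%:E) ->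
  X u w = a%:E \/ X u w = b%:E.
Proof.
move=> cX u0 X0 nXu Xv.
have cf := extend_path_continuous cX (x := u).
have u_gt0 : (0 < u)%R.
  by rewrite lt_neqAle u0 andbT; apply/eqP => u0'; move: nXu; rewrite -u0' X0.
have key (U : set (\bar R)) : open U -> U (X u w) ->
    exists v, (0 <= v < u)%R /\ U (X v w).
  move=> oU Uu; have := cf U; rewrite (max_idPl u0).
  move=> /(_ (open_nbhs_nbhs (conj oU Uu))) [e/= e0 eU].
  pose v := Num.max 0%R (u - e / 2)%R.
  have [v0 vu ve] : [/\ (0 <= v)%R, (v < u)%R & (u - v < e)%R].
    by rewrite /v; case: (leP 0%R (u - e / 2)%R) => h; split; lra.
  exists v; rewrite v0 vu; split=> //.
  have := eU v; rewrite /= (max_idPl v0); apply.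
  by rewrite ger0_norm ?subr_ge0// ltW.
have aXu : a%:E <= X u w.
  rewrite leNgt; apply/negP => Xa.
  have [v [/Xv + /= Xva]] := key _ (@open_ereal_lt_ereal _ a%:E) Xa.
  by move=> /andP[aX _]; have := lt_trans aX Xva; rewrite ltxx.
have Xub : X u w <= b%:E.
  rewrite leNgt; apply/negP => Xb.
  have [v [/Xv + /= Xvb]] := key _ (@open_ereal_gt_ereal _ b%:E) Xb.
  by move=> /andP[_ bX]; have := lt_trans bX Xvb; rewrite ltxx.
move: nXu; rewrite !lt_neqAle aXu Xub !andbT => /negP.
by rewrite negb_and !negbK => /orP[/eqP <-|/eqP ->]; [left|right].
Qed.

(** The end-point reached at the exit time comes first, since the path meets neither
of them before. *)
Lemma exited_hit_first X a b t w : cont_path X w -> (a < b)%R ->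
  a%:E < X 0%R w < b%:E -> ~ alive X a b t w ->
  hit_first X a b t w \/ hit_first X b a t w.
Proof.
move=> cX ab X0 nAt.
have [z [/andP[z0 zt] nXz]] : exists z, (0 <= z <= t)%R /\ ~ (a%:E < X z w < b%:E).
  by apply: contrapT => nz; apply: nAt => z zt; apply: contrapT => nXz; apply: nz; exists z.
have [u [/andP[u0 uz] nX Xv]] := entry_attained cX (@open_eitv a b) z0 nXz.
have ut := le_trans uz zt.
have nh c : (c = a \/ c = b) -> X u w <> c%:E -> ~ hit X c u w.
  move=> cab Xuc [v [/andP[v0]]]; rewrite le_eqVlt => /predU1P[->//|vu Xvc].
  have := Xv v; rewrite v0 vu => /(_ isT); rewrite /= Xvc.
  by case: cab => ->; rewrite ltxx ?andbF.
have [Xu|Xu] := exit_endpoint cX u0 X0 nX Xv; [left|right]; exists u; rewrite u0 ut;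
  (split => //; split; first by exists u; rewrite u0 lexx); apply: nh.
- by right.
- by rewrite Xu => -[] E; move: ab; rewrite E ltxx.
- by left.
- by rewrite Xu => -[] E; move: ab; rewrite E ltxx.
Qed.

Lemma hit_firstC X a b t w : hit_first X a b t w -> ~ hit_first X b a t w.
Proof.
move=> [u [/andP[u0 ut] [au nbu]]] [v [/andP[v0 vt] [bv nav]]].
have [uv|/ltW vu] := leP u v.
  apply: nav; case: au => z [/andP[z0 zu] Xz]; exists z; split => //.
  by rewrite z0 (le_trans zu).
apply: nbu; case: bv => z [/andP[z0 zv] Xz]; exists z; split => //.
by rewrite z0 (le_trans zv).
Qed.

(** The stopped process without the exit time: only events that are decided by
countably many coordinates are left, whence its measurability. *)
Lemma stoppedE X a b t w : cont_path X w -> (0 <= t)%R -> (a < b)%R ->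
  stopped X (exit_time X a%:E b%:E) t w =
  if ~~ (a%:E < X 0%R w < b%:E) then X 0%R w
  else if `[< alive X a b t w >] then X t w
  else if `[< hit_first X a b t w >] then a%:E else b%:E.
Proof.
move=> cX t0 ab; rewrite /stopped.
have := alive_exit_time a b cX t0.
have [[-> Xv]|[u [u0 -> nX Xv]]] := exit_timeP a b cX.
  move=> [_ /(_ (ltry _)) At]; rewrite (Xv _ (lexx _))/=.
  by case: asboolP => //= _; rewrite (min_idPl (leey _)).
rewrite lte_fin => At; case: ifPn => X0.
  have -> : u = 0%R.
    apply/eqP/negPn/negP => un0; apply/negP: X0; rewrite negbK.
    by apply: Xv; rewrite lexx lt_neqAle eq_sym un0.
  by rewrite (min_idPr _) ?lee_fin.
move: X0; rewrite negbK => X0.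
case: asboolP => [/At tu|nAt]; first by rewrite (min_idPl _)// lee_fin ltW.
have ut : (u <= t)%R by rewrite leNgt; apply/negP => /At.
rewrite (min_idPr _) ?lee_fin//=.
have hX c c' : hit_first X c c' t w -> X u w = c'%:E -> (c = a /\ c' = b) \/ (c = b /\ c' = a) -> False.
  move=> [z [/andP[z0 zt] [[v [/andP[v0 vz] Xvc]] nh]]] Xu cab.
  have [zu|uz] := ltP z u; last by apply: nh; exists u; rewrite u0.
  have := Xv v; rewrite v0 (le_lt_trans vz zu) => /(_ isT); rewrite Xvc.
  by move: cab => [[-> _]|[-> _]]; rewrite ltxx ?andbF.
have [Xu|Xu] := exit_endpoint cX u0 X0 nX Xv; case: asboolP => //.
- move=> nhab; have [//|hba] := exited_hit_first cX ab X0 nAt.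
  by exfalso; apply: hX hba Xu _; right.
- by move=> hab; exfalso; apply: hX hab Xu _; left.
Qed.

Lemma stopped_exited X a b v t w : cont_path X w -> (0 <= v <= t)%R ->
  ~ alive X a b v w ->
  stopped X (exit_time X a%:E b%:E) t w = stopped X (exit_time X a%:E b%:E) v w.
Proof.
move=> cX /andP[v0 vt]; rewrite alive_exit_time// => /negP; rewrite -leNgt => tv.
by rewrite /stopped !(min_idPr _)//; apply: le_trans tv _; rewrite lee_fin.
Qed.

(** The events whose probabilities define the scale function, as countable unions
of events decided at a fixed time. *)
Lemma hitting_time_lt X a b w : cont_path X w -> a <> b ->
  hitting_time X a%:E w < hitting_time X b%:E w <->
  exists n : nat, hit_first X a b n%:R w.
Proof.
move=> cX ab; split.
  have [[-> _]|[u [u0 -> Xu _]]] := hitting_timeP a cX; first by rewrite ltNge leey.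
  move=> uHb; exists (Num.truncn u).+1; exists u; split.
    by rewrite u0/= ltW// truncnS_gt.
  split; first by exists u; rewrite u0 lexx.
  move=> [v [/andP[v0 vu] Xv]].
  move: uHb; have [[_ /(_ _ v0)//]|[v' [v'0 -> Xv' nXv]]] := hitting_timeP b cX.
  rewrite lte_fin => uv'; apply: (nXv v) => //.
  by rewrite v0 (le_lt_trans vu).
move=> [n [u [/andP[u0 un] [[v [/andP[v0 vu] Xv] nb]]]]].
apply: (@le_lt_trans _ _ u%:E).
  apply: (@le_trans _ _ v%:E); last by rewrite lee_fin.
  by apply: ereal_inf_lbound; exists v.
have [[-> _]|[z [z0 -> Xz _]]] := hitting_timeP b cX; first by rewrite ltry.
rewrite lte_fin ltNge; apply/negP => zu; apply: nb.
by exists z; rewrite z0.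
Qed.

End paths.

(** * Measurability and shift of stopped paths *)

Section path_measurability.
Context {R : realType} {d : measure_display} {W : measurableType d}.
Variables (X : R -> W -> \bar R) (T : R).
Hypothesis cX : forall w, cont_path X w.
Hypothesis mX : forall t : R, (0 <= t <= T)%R -> measurable_fun setT (X t).

Lemma measurable_preX (B : set (\bar R)) (t : R) : (0 <= t <= T)%R -> measurable B ->
  measurable [set w | B (X t w)].
Proof. by move=> tT mB; have := mX tT measurableT mB; rewrite setTI. Qed.

(** The multiples of t by a rational number, clipped to [0, 1]: a countable dense
set of times in [0, t] that contains t itself. *)
Let gtime (t : R) (q : rat) : R := (t * Num.min (Num.max (ratr q) 0) 1)%R.

Let gtimeP (t : R) (q : rat) : (0 <= t)%R -> (0 <= gtime t q <= t)%R.
Proof.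
move=> t0; rewrite /gtime; set z := Num.min _ _.
have /andP[z0 z1] : (0 <= z <= 1)%R.
  by rewrite /z le_min le_max lexx orbT ler01/= ge_min lexx orbT.
by rewrite mulr_ge0//= ler_piMr.
Qed.

Let gtime_dense (t u e : R) : (0 <= u <= t)%R -> (0 < e)%R ->
  exists q, (`|u - gtime t q| < e)%R.
Proof.
move=> /andP[u0 ut] e0.
have [t0|t0] := ltP 0%R t; last first.
  exists 0%R; have -> : u = 0%R by apply/le_anti; rewrite u0 (le_trans ut).
  have -> : t = 0%R by apply/le_anti; rewrite t0 (le_trans u0).
  by rewrite /gtime mul0r subrr normr0.
have ue : ((u - e / 2) / t < (u + e / 2) / t)%R by rewrite ltr_pM2r ?invr_gt0//; lra.
have [q] := rat_in_itvoo ue; rewrite in_itv/= ltr_pdivrMr// ltr_pdivlMr// => /andP[q1 q2].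
exists q; rewrite /gtime ltr_norml.
case: (leP (ratr q : R) 0%R) => q0.
  rewrite (min_idPl _)// mulr0 subr0.
  have : (ratr q * t <= 0)%R by rewrite mulr_le0_ge0// ltW.
  lra.
case: (leP (ratr q : R) 1%R) => q3; first by rewrite mulrC; lra.
rewrite mulr1; have : (t <= ratr q * t)%R by rewrite ler_peMl// ltW.
lra.
Unshelve. all: by [].
Qed.

Let gtime_right (t u e : R) : (0 <= u <= t)%R -> (0 < e)%R ->
  exists q, (u <= gtime t q < u + e)%R.
Proof.
move=> /andP[u0]; rewrite le_eqVlt => /predU1P[->|ut] e0.
  by exists 1%R; rewrite /gtime rmorph1 (max_idPl _)// minxx mulr1 lexx/= ltrDl.
pose e' := (Num.min e (t - u) / 2)%R.
have [e'0 e'e e't] : [/\ (0 < e')%R, (e' < e / 2 + e / 2)%R & (e' < (t - u) / 2 + (t - u) / 2)%R].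
  by rewrite /e'; case: (leP e (t - u)%R) => h; split; lra.
have [||q qe] := @gtime_dense t (u + e' / 2)%R (e' / 2)%R.
- by apply/andP; split; lra.
- by lra.
- by exists q; move: qe; rewrite ltr_norml => /andP[? ?]; apply/andP; split; lra.
Qed.

(** By compactness of [0, t], it is enough that the path comes arbitrarily close to
c at the countably many times above. *)
Let hitE (c t : R) w : (0 <= t)%R -> hit X c t w <->
  forall n : nat, exists q : rat,
    (c - n.+1%:R^-1)%:E < X (gtime t q) w < (c + n.+1%:R^-1)%:E.
Proof.
move=> t0; have cf := extend_path_continuous (@cX w).
split=> [[u [/andP[u0 ut] Xu]] n|H].
  have := cf u [set z | (c - n.+1%:R^-1)%:E < z < (c + n.+1%:R^-1)%:E].
  rewrite (max_idPl u0) => /(_ _)[|e/= e0 eU].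
    apply: open_nbhs_nbhs; split; first exact: open_eitv.
    by rewrite /= Xu !lte_fin ltrBlDr ltrDl invr_gt0 ltr0Sn.
  have [|q qe] := @gtime_dense t u e _ e0; first by rewrite u0.
  exists q; have := eU _ qe; rewrite /= (max_idPl _)//.
  by have /andP[] := gtimeP q t0.
(* contract makes the distance to c a real continuous function of time, also for
   paths with infinite values; its minimum over [0, t] is then attained *)
pose h v := `|contract (X (Num.max v 0%R) w) - contract c%:E|%R.
have ch : continuous h.
  move=> v; apply: (@cvg_norm _ R^o); apply: (@cvgB _ R^o); last exact: cvg_cst.
  by apply: continuous_comp; [exact: cf|exact: contract_continuous].
have [|u + hu] := @EVT_min _ h 0%R t t0.
  exact: continuous_subspaceT.
rewrite in_itv/= => /andP[u0 ut]; exists u; rewrite u0; split => //.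
apply: contrapT => Xu.
have hu0 : (0 < h u)%R.
  rewrite /h normr_gt0 subr_eq0 (max_idPl u0); apply/eqP => /(can_inj (@contractK R)).
  exact: Xu.
have : \forall z \near (c%:E : \bar R), (`|contract z - contract c%:E| < h u)%R.
  have /cvgrPdist_lt/(_ _ hu0) := @contract_continuous R c%:E.
  by apply: filterS => z; rewrite distrC.
move=> -[e/= e0 eU].
have [n _ ne] := near_infty_natSinv_lt (PosNum e0).
have [q /andP[q1 q2]] := H n.
have /andP[g0 gt] := gtimeP q t0.
have := hu (gtime t q); rewrite in_itv/= g0 gt => /(_ isT); rewrite leNgt => /negP; apply.
rewrite {1}/h (max_idPl g0).
case: (X _ w) q1 q2 => //= x; rewrite !lte_fin => q1 q2.
apply: (eU x); rewrite /ball/= ltr_norml.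
have := ne n (leqnn n); rewrite /=; move: q1 q2; set k := (_^-1)%R => q1 q2 ke; lra.
Qed.

Lemma measurable_hit (c t : R) : (0 <= t <= T)%R -> measurable (hit X c t).
Proof.
move=> /andP[t0 tT].
rewrite (_ : hit X c t = \bigcap_n \bigcup_(q : rat)
  [set w | [set z | (c - n.+1%:R^-1)%:E < z < (c + n.+1%:R^-1)%:E] (X (gtime t q) w)]).
  apply: bigcapT_measurable => n; apply: bigcupT_measurable_rat => q.
  apply: measurable_preX.
    by have /andP[-> /le_trans->] := gtimeP q t0.
  rewrite (_ : [set _ | _] = `](c - n.+1%:R^-1)%:E, (c + n.+1%:R^-1)%:E[%classic).
    exact: emeasurable_itv.
  by apply/seteqP; split => z; rewrite /= in_itv.
apply/seteqP; split => w.
  by move=> /(hitE _ _ t0) H n _; have [q Hq] := H n; exists q.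
by move=> H; apply/(hitE _ _ t0) => n; have [q _ Hq] := H n I; exists q.
Qed.

(** A path that is at a keeps away from b for a while, so the witnessing time can be
pushed to the right, into the countable set of times. *)
Lemma measurable_hit_first (a b t : R) : a <> b -> (0 <= t <= T)%R ->
  measurable (hit_first X a b t).
Proof.
move=> ab /andP[t0 tT].
rewrite (_ : hit_first X a b t = \bigcup_(q : rat)
    (hit X a (gtime t q) `\` hit X b (gtime t q))).
  apply: bigcupT_measurable_rat => q; apply: measurableD;
  by apply: measurable_hit; have /andP[-> /le_trans->] := gtimeP q t0.
apply/seteqP; split => w; last first.
  by move=> [q _ Hq]; exists (gtime t q); split => //; exact: gtimeP.
move=> [u [/andP[u0 ut] [[v [/andP[v0 vu] Xv] nb]]]].
have vt := le_trans vu ut.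
have cf := extend_path_continuous (@cX w) (x := v).
have := cf [set z | z <> b%:E]; rewrite (max_idPl v0) => /(_ _)[|e/= e0 eU].
  apply: open_nbhs_nbhs; split; first exact: open_eneq.
  by rewrite /= Xv => -[].
have [|q /andP[q1 q2]] := @gtime_right t v e _ e0; first by rewrite v0.
exists q => //; split; first by exists v; rewrite v0 q1.
move=> [z [/andP[z0 zq] Xz]].
have [zu|uz] := leP z u; first by apply: nb; exists z; rewrite z0.
have := eU z; rewrite /= (max_idPl z0); apply => //.
by rewrite ltr_norml; lra.
Qed.

Lemma aliveE (a b t : R) w : (0 <= t)%R -> alive X a b t w <->
  (a%:E < X 0%R w < b%:E) /\ ~ (hit X a t `|` hit X b t) w.
Proof.
move=> t0; split.
  move=> At; split; first by apply: At; rewrite lexx.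
  move=> [|] [u [ut Xu]]; have := At _ ut; rewrite Xu ltxx ?andbF//.
move=> [X0 nh] u /andP[u0 ut]; apply: contrapT => nXu.
have [v [/andP[v0 vu] nXv Xz]] :=
  entry_attained (@cX w) (@open_eitv _ a b) u0 nXu.
have vt := le_trans vu ut.
apply: nh; have [E|E] := exit_endpoint (@cX w) v0 X0 nXv Xz; [left|right];
by exists v; rewrite v0.
Qed.

Lemma measurable_alive (a b t : R) : (0 <= t <= T)%R -> measurable (alive X a b t).
Proof.
move=> /andP[t0 tT].
rewrite (_ : alive X a b t =
  [set w | `]a%:E, b%:E[%classic (X 0%R w)] `&` ~` (hit X a t `|` hit X b t)).
  apply: measurableI.
    apply: measurable_preX; first by rewrite lexx (le_trans t0).
    exact: emeasurable_itv.
  by apply: measurableC; apply: measurableU; apply: measurable_hit; rewrite t0.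
by apply/seteqP; split => w; rewrite aliveE//= in_itv.
Qed.

Lemma measurable_stopped (a b t : R) : (a < b)%R -> (0 <= t <= T)%R ->
  measurable_fun setT (stopped X (exit_time X a%:E b%:E) t).
Proof.
move=> ab /andP[t0 tT].
rewrite (_ : stopped _ _ _ = (fun w =>
  if ~~ (a%:E < X 0%R w < b%:E) then X 0%R w
  else if `[< alive X a b t w >] then X t w
  else if `[< hit_first X a b t w >] then a%:E else b%:E)); last first.
  by apply/funext => w; rewrite stoppedE.
have T0 : (0 <= T)%R := le_trans t0 tT.
have mb (A : set W) : measurable A -> measurable_fun setT (fun w => `[< A w >]).
  move=> mA; apply: (@measurable_fun_bool _ _ _ _ true).
  rewrite setTI (_ : _ @^-1` _ = A)//.
  by apply/seteqP; split => w /=; [move/asboolP|move=> ?; apply/asboolP].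
apply: measurable_fun_ifT.
- rewrite (_ : (fun w => _) =
    (fun w => `[< [set w | `]a%:E, b%:E[%classic (X 0%R w)] w >] == false)); last first.
    by apply/funext => w; rewrite /= in_itv/= asboolb; case: (_ < _ < _).
  apply: (@measurable_fun_bool _ _ _ _ true); rewrite setTI.
  rewrite (_ : _ @^-1` _ = ~` [set w | `]a%:E, b%:E[%classic (X 0%R w)]).
    apply: measurableC; apply: measurable_preX; first by rewrite lexx.
    exact: emeasurable_itv.
  by apply/seteqP; split => w /=; case: asboolP.
- by apply: mX; rewrite lexx.
- apply: measurable_fun_ifT; first by apply: mb; apply: measurable_alive; rewrite t0.
  + by apply: mX; rewrite t0.
  + apply: measurable_fun_ifT; [|exact: measurable_cst..].
    apply: mb; apply: measurable_hit_first; rewrite ?t0//.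
    by move=> E; move: ab; rewrite E ltxx.
Qed.

End path_measurability.

(** As long as the path has not left (a, b), what happens after time v is a function
of the shifted path: this is what the Markov property at time v is applied to. *)
Section shift.
Context {R : realType} {T : Type}.
Variables (X : R -> T -> \bar R) (th : R -> T -> T) (a b v : R) (w : T).
Hypothesis Xth : forall u t : R, (0 <= u)%R -> (0 <= t)%R ->
  X u (th t w) = X (t + u)%R w.
Hypothesis v0 : (0 <= v)%R.
Hypothesis Av : alive X a b v w.

Lemma hit_shift (c u : R) : c = a \/ c = b -> (0 <= u)%R ->
  hit X c (v + u)%R w <-> hit X c u (th v w).
Proof.
move=> cab u0; split=> [[z [/andP[z0 zu] Xz]]|[z [/andP[z0 zu] Xz]]]; last first.
  by exists (v + z)%R; rewrite -Xth// addr_ge0// lerD2l.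
have [zv|/ltW vz] := leP z v.
  have := Av; move=> /(_ z); rewrite z0 zv Xz => /(_ isT).
  by case: cab => ->; rewrite ltxx ?andbF.
exists (z - v)%R; rewrite subr_ge0 vz lerBlDl Xth ?subr_ge0// subrKC.
by rewrite zu.
Qed.

Lemma hit_first_shift (c c' u : R) : c = a \/ c = b -> c' = a \/ c' = b ->
  (0 <= u)%R -> hit_first X c c' (v + u)%R w <-> hit_first X c c' u (th v w).
Proof.
move=> cab c'ab u0; split=> [[z [/andP[z0 zu] [h nh]]]|[z [/andP[z0 zu] [h nh]]]]; last first.
  exists (v + z)%R; rewrite addr_ge0// lerD2l; split => //.
  by split; rewrite hit_shift.
have [zv|/ltW vz] := leP z v.
  case: h => y [/andP[y0 yz] Xy].
  have := Av; move=> /(_ y); rewrite y0 (le_trans yz) // Xy => /(_ isT).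
  by case: cab => ->; rewrite ltxx ?andbF.
exists (z - v)%R; rewrite subr_ge0 vz lerBlDl zu; split => //.
by split; rewrite -hit_shift ?subr_ge0// subrKC.
Qed.

Lemma alive_shift (u : R) : (0 <= u)%R ->
  alive X a b (v + u)%R w <-> alive X a b u (th v w).
Proof.
move=> u0; split => A z /andP[z0 zu].
  by rewrite Xth//; apply: A; rewrite addr_ge0// lerD2l.
have [zv|/ltW vz] := leP z v; first by apply: Av; rewrite z0.
have := A (z - v)%R; rewrite Xth ?subr_ge0// subrKC; apply.
by rewrite vz lerBlDl.
Qed.

Lemma stopped_shift (u : R) : cont_path X w -> cont_path X (th v w) -> (a < b)%R ->
  (0 <= u)%R ->
  stopped X (exit_time X a%:E b%:E) (v + u)%R w =
  stopped X (exit_time X a%:E b%:E) u (th v w).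
Proof.
move=> cw cth ab u0; rewrite !stoppedE// ?addr_ge0//.
rewrite (Xth (lexx _) v0) addr0 (Xth u0 v0).
rewrite !Av ?lexx ?v0//=.
rewrite (asbool_equiv_eq (alive_shift u0)).
by rewrite (asbool_equiv_eq (hit_first_shift (or_introl _) (or_intror _) u0)).
Qed.

Lemma hit_firstT_shift (c c' : R) : c = a \/ c = b -> c' = a \/ c' = b ->
  (exists n : nat, hit_first X c c' n%:R w) <->
  (exists n : nat, hit_first X c c' n%:R (th v w)).
Proof.
move=> hc hc'; split => -[n hn].
  exists n; apply/hit_first_shift => //.
  by apply: hit_first_le hn; rewrite lerDr.
exists (Num.truncn (v + n%:R)).+1.
apply: (@hit_first_le _ _ _ _ _ (v + n%:R)%R); first by rewrite ltW// truncnS_gt.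
exact/hit_first_shift.
Qed.

End shift.

(** * The Markov property *)

(** The generators of natural_sigma: the type g_sigma_algebraType (cylinders X) is
Omega with the sigma-algebra of the paths, on which the Markov property acts. *)
Definition cylinders (R : realType) (Omega : Type) (X : R -> Omega -> \bar R) :
    set (set Omega) :=
  [set A | exists t : R, (0 <= t)%R /\
     exists B : set (\bar R), measurable B /\ A = X t @^-1` B].

Section diffusion_markov.
Context {R : realType} {l r : \bar R} {d : measure_display}
  {Omega : measurableType d} (X : diffusion l r Omega).

Local Notation natT := (g_sigma_algebraType (cylinders (coord X))).
Local Notation filT t := (g_sigma_algebraType (filt X t)).

Lemma coord_cont w : cont_path (coord X) w.
Proof. exact: (@Defs.coord_continuous R l r d Omega X w). Qed.

Lemma measurable_filT (t : R) (A : set Omega) : (0 <= t)%R ->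
  measurable (A : set (filT t)) <-> filt X t A.
Proof.
move=> t0; have [sF _ _] := filt_filtration X.
by rewrite /measurable/= (sigma_algebra_id (sF t t0)).
Qed.

Lemma sub_measurable_filT (t : R) d' (T' : measurableType d') (f : Omega -> T') :
  (0 <= t)%R ->
  sub_measurable (filt X t) f <-> measurable_fun setT (f : filT t -> T').
Proof.
move=> t0; split => mf.
  by move=> _ B mB; rewrite setTI; apply/measurable_filT => //; exact: mf.
by move=> B mB; apply/measurable_filT => //; rewrite -[_ @^-1` _]setTI; exact: mf.
Qed.

Lemma filt_measurable (t : R) (A : set Omega) : (0 <= t)%R -> filt X t A -> measurable A.
Proof. by move=> t0; have [_ + _] := filt_filtration X; exact. Qed.

Lemma filT_measurable_fun (t : R) d' (T' : measurableType d') (f : Omega -> T') :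
  (0 <= t)%R -> measurable_fun setT (f : filT t -> T') -> measurable_fun setT f.
Proof.
move=> t0 /(sub_measurable_filT f t0) mf _ B mB; rewrite setTI.
by apply: filt_measurable (mf _ mB).
Qed.

Lemma measurable_coord_filT (t q : R) : (0 <= q <= t)%R ->
  measurable_fun setT (coord X q : filT t -> \bar R).
Proof.
move=> /andP[q0 qt]; apply/sub_measurable_filT; first exact: le_trans q0 qt.
have [_ _ Fut] := filt_filtration X.
move=> B mB; apply: (Fut q); first by rewrite q0.
exact: coord_adapted.
Qed.

Lemma measurable_coord_natT (t : R) : (0 <= t)%R ->
  measurable_fun setT (coord X t : natT -> \bar R).
Proof.
move=> t0 _ B mB; rewrite setTI; apply: sub_sigma_algebra.
by exists t; split => //; exists B.
Qed.

Lemma measurable_coord (t : R) : (0 <= t)%R ->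
  measurable_fun setT (coord X t).
Proof.
by move=> t0; apply: (filT_measurable_fun t0); apply: measurable_coord_filT; rewrite t0 lexx.
Qed.

Lemma measurable_theta (u : R) : (0 <= u)%R ->
  measurable_fun setT (theta X u : Omega -> natT).
Proof.
move=> u0; apply: (@measurability _ _ _ natT _ _ _ erefl).
move=> _ [_ [t [t0 [B [mB ->]]]] <-].
rewrite (_ : _ `&` _ = setT `&` coord X (u + t)%R @^-1` B).
  by apply: measurable_coord => //; rewrite addr_ge0.
by apply/seteqP; split => w [_]; rewrite /= coord_theta.
Qed.

Lemma measurable_id_natT : measurable_fun setT (id : Omega -> natT).
Proof.
apply: (@measurability _ _ _ natT _ _ _ erefl).
move=> _ [_ [t [t0 [B [mB ->]]]] <-].
exact: measurable_coord.
Qed.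

Lemma natT_measurable (B : set Omega) : measurable (B : set natT) -> measurable B.
Proof. by move=> /(measurable_id_natT measurableT); rewrite setTI. Qed.

(** Only constant times enter the proof: there the strong Markov property is the
Markov property with respect to filt X u. *)
Lemma stopped_sigma_cst (u : R) : (0 <= u)%R ->
  stopped_sigma (filt X) (fun=> u%:E) = filt X u.
Proof.
move=> u0; have [sF Fm Fut] := filt_filtration X.
apply/seteqP; split => A.
  move=> [_ /(_ u u0)]; rewrite (_ : [set _ | _] = setT) ?setIT//.
  by apply/seteqP; split => //= w _; rewrite lexx.
move=> FA; split; first exact: Fm FA.
move=> t t0; have [ut|tu] := leP u t.
  rewrite (_ : [set _ | _] = setT) ?setIT; first by apply: (Fut u) => //; rewrite u0.
  by apply/seteqP; split => //= w _; rewrite lee_fin.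
rewrite (_ : [set _ | _] = set0) ?setI0; first by have [] := sF t t0.
by apply/seteqP; split => //= w; rewrite lee_fin leNgt tu.
Qed.

Lemma stopping_time_cst (u : R) : (0 <= u)%R ->
  stopping_time (filt X) (fun=> u%:E).
Proof.
move=> u0; have [sF _ _] := filt_filtration X.
split => [w|t t0]; first by rewrite lee_fin.
have [ut|tu] := leP u t.
  rewrite (_ : [set _ | _] = setT).
    by have /(@sigma_algebra_id _ _ _) <- := sF t t0; exact: (@measurableT _ (filT t)).
  by apply/seteqP; split => //= w _; rewrite lee_fin.
rewrite (_ : [set _ | _] = set0); first by have [] := sF t t0.
by apply/seteqP; split => //= w; rewrite lee_fin leNgt tu.
Qed.

Lemma markov_event x (u : R) (B : set Omega) : state X x -> (0 <= u)%R ->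
  measurable (B : set natT) ->
  measurable_fun setT ((fun w => law X (coord X u w) B) : filT u -> \bar R) /\
  forall A, filt X u A ->
    \int[law X x]_(w in A) law X (coord X u w) B =
    law X x (A `&` theta X u @^-1` B).
Proof.
move=> sx u0 mB.
have [] := strong_markov sx (stopping_time_cst u0) mB.
rewrite stopped_sigma_cst// => mY _ HY.
have fE w : (fine (law X (coord X u w) B))%:E = law X (coord X u w) B.
  by rewrite fineK// fin_num_measure//; exact: natT_measurable.
split.
  under eq_fun do rewrite -fE.
  apply/measurable_EFinP.
  move/(sub_measurable_filT _ u0) : mY.
  by under [X in measurable_fun _ X -> _]eq_fun do rewrite ltry/=.
move=> A FA; have mA := filt_measurable u0 FA.
have mtB : measurable (theta X u @^-1` B).
  by rewrite -[_ @^-1` _]setTI; exact: measurable_theta.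
rewrite [in RHS]setIC -integral_indic//.
transitivity (\int[law X x]_(w in A)
  (\1_[set w | (u%:E < +oo)%E /\ B (theta X (fine u%:E) w)] w)%:E).
  rewrite -HY//; apply: eq_integral => w _; rewrite ltry/=.
  by rewrite fE.
apply: eq_integral => w _; congr (_%:E); congr (\1_ _ w).
by apply/seteqP; split => z /=; [case|rewrite ltry].
Qed.

(** The Markov property extends from events to nonnegative functions of the path by
linearity and monotone approximation with simple functions. *)
Lemma markov_fun x (u : R) (f : Omega -> \bar R) : state X x -> (0 <= u)%R ->
  measurable_fun setT (f : natT -> \bar R) -> (forall w, 0 <= f w) ->
  measurable_fun setT
    ((fun w => \int[law X (coord X u w)]_w' f w') : filT u -> \bar R) /\
  forall A, filt X u A ->
    \int[law X x]_(w in A) \int[law X (coord X u w)]_w' f w' =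
    \int[law X x]_(w in A) f (theta X u w).
Proof.
move=> sx u0 mf f0.
pose h := nnsfun_approx measurableT mf.
pose g n w := (h n w)%:E.
have g0 n w : 0 <= g n w by rewrite lee_fin.
have mg n : measurable_fun setT (g n : natT -> \bar R).
  by apply/measurable_EFinP.
have mg' n : measurable_fun setT (g n : Omega -> \bar R).
  exact: (measurableT_comp (mg n) measurable_id_natT).
have ndg w : {homo g ^~ w : m n / (m <= n)%N >-> m <= n}.
  by move=> m n mn; rewrite lee_fin; exact/lefP/nd_nnsfun_approx.
have gf w : g n w @[n --> \oo] --> f w.
  by apply: (cvg_nnsfun_approx measurableT mf (fun x _ => f0 x)).
have limg w : limn (g ^~ w) = f w by exact: cvg_lim (gf w).
pose hp n (y : R) : set Omega := h n @^-1` [set y].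
pose S n := finmap.enum_fset (fset_set (range (h n))).
have gE n w : g n w = \sum_(y <- S n) (y * \1_(hp n y) w)%:E.
  by rewrite /g fimfunE sumEFin fsbig_finite.
have mhy n y : measurable (hp n y : set natT).
  by rewrite /hp -[_ @^-1` _]setTI; exact: measurable_funP.
have hy0 n y w : 0 <= (y * \1_(hp n y) w)%:E by exact: nnfun_muleindic_ge0.
have mul_indic d' (T' : measurableType d') (mu : {measure set T' -> \bar R})
    (D B : set T') y : measurable D -> measurable B ->
    (forall w, 0 <= (y * \1_B w)%:E) ->
    \int[mu]_(w in D) (y * \1_B w)%:E = y%:E * mu (B `&` D).
  move=> mD mB h0; under eq_integral do rewrite EFinM.
  have [y0|y0] := leP 0%R y.
    by rewrite ge0_integralZl_EFin ?integral_indic//; do ?exact/measurable_EFinP.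
  have -> : B = set0.
    apply/seteqP; split => // w Bw; have := h0 w.
    by rewrite indicE mem_set// mulr1 lee_fin leNgt y0.
  by rewrite set0I measure0 mule0 indic0 integral0_eq// => ? _; rewrite mule0.
have iE d' (T' : measurableType d') (mu : {measure set T' -> \bar R})
    (D : set T') (t : T' -> Omega) n : measurable D ->
    measurable_fun setT (t : T' -> natT) ->
    \int[mu]_(w in D) g n (t w) =
    \sum_(y <- S n) y%:E * mu (t @^-1` hp n y `&` D).
  move=> mD mt; under eq_integral do rewrite gE.
  have mt' y : measurable (t @^-1` hp n y).
    by rewrite -[X in measurable X]setTI; exact: mt.
  rewrite ge0_integral_sum//; last first.
    move=> y; apply/measurable_EFinP; apply: measurable_funM => //.
    exact: (measurable_indic (mt' y)).
  apply: eq_bigr => y _.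
  by rewrite -(mul_indic _ _ mu D)// => w; exact: (hy0 n y (t w)).
pose J n w := \int[law X (coord X u w)]_w' g n w'.
have JE n w : J n w = \sum_(y <- S n) y%:E * law X (coord X u w) (hp n y).
  rewrite /J (iE _ _ _ setT id)//; last exact: measurable_id_natT.
  by apply: eq_bigr => y _; rewrite setIT.
have mJ n : measurable_fun setT (J n : filT u -> \bar R).
  rewrite (_ : J n = fun w => \sum_(y <- S n) y%:E * law X (coord X u w) (hp n y)).
    apply: emeasurable_sum => y; apply: measurable_funeM.
    by have [] := markov_event sx u0 (mhy n y).
  by apply/funext => w; exact: JE.
have J0 n w : 0 <= J n w by exact: integral_ge0.
have ndJ w : {homo J ^~ w : m n / (m <= n)%N >-> m <= n}.
  by move=> m n mn; apply: ge0_le_integral => // z _; exact: ndg.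
have JJ w : J n w @[n --> \oo] --> \int[law X (coord X u w)]_w' f w'.
  under [X in _ --> X]eq_integral do rewrite -limg.
  by apply: cvg_monotone_convergence => // z _ m n; exact: ndg.
have mfin : measurable_fun setT
    ((fun w => \int[law X (coord X u w)]_w' f w') : filT u -> \bar R).
  by apply: (@emeasurable_fun_cvg _ (filT u) R setT J) => [n|w _]; [exact: mJ|exact: JJ].
split => // A FA; have mA := filt_measurable u0 FA.
have mJ' n : measurable_fun setT (J n).
  exact: (filT_measurable_fun u0).
have limJ w : limn (J ^~ w) = \int[law X (coord X u w)]_w' f w' by exact: cvg_lim (JJ w).
have step n : \int[law X x]_(w in A) J n w = \int[law X x]_(w in A) g n (theta X u w).
  rewrite (iE _ _ _ A (theta X u))//; last exact: measurable_theta.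
  under eq_integral do rewrite JE.
  have mL y : measurable_fun setT (fun w => law X (coord X u w) (hp n y)).
    by apply: (filT_measurable_fun u0); have [] := markov_event sx u0 (mhy n y).
  rewrite ge0_integral_sum//; last 2 first.
  - move=> y; apply: measurable_funTS; exact: measurable_funeM.
  - move=> y w _.
    have -> : y%:E * law X (coord X u w) (hp n y) =
        \int[law X (coord X u w)]_w' (y * \1_(hp n y) w')%:E.
      by rewrite mul_indic ?setIT//; exact: natT_measurable.
    exact: integral_ge0.
  apply: eq_bigr => y _.
  have [y0|y0] := leP 0%R y.
    rewrite ge0_integralZl_EFin//; last exact: measurable_funTS.
    by have [_ ->//] := markov_event sx u0 (mhy n y); rewrite setIC.
  have -> : hp n y = set0.
    apply/seteqP; split => // w Bw; have := hy0 n y w.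
    by rewrite indicE mem_set// mulr1 lee_fin leNgt y0.
  rewrite preimage_set0 set0I !measure0 mule0 integral0_eq// => w _.
  by rewrite measure0 mule0.
under eq_integral do rewrite -limJ.
under [RHS]eq_integral do rewrite -limg.
have mgt n : measurable_fun A (fun w => g n (theta X u w)).
  by apply: measurable_funTS; exact: (measurableT_comp (mg n) (measurable_theta u0)).
have -> := @monotone_convergence _ _ _ (law X x) A mA J
  (fun n => measurable_funTS (mJ' n)) (fun n w _ => J0 n w) (fun w _ => ndJ w).
have -> := @monotone_convergence _ _ _ (law X x) A mA _ mgt
  (fun n w _ => g0 n _) (fun w _ => ndg _).
by congr (limn _); apply/funext => n; exact: step.
Qed.

End diffusion_markov.
Arguments coord_cont {R l r d Omega} X w.

(** * Exit probabilities and the natural scale *)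

Lemma ae_le_integral d (T : measurableType d) (R : realType)
    (mu : {measure set T -> \bar R}) (f g : T -> \bar R) :
  mu.-integrable setT f -> mu.-integrable setT g ->
  {ae mu, forall x, f x <= g x} ->
  \int[mu]_x f x <= \int[mu]_x g x.
Proof.
move=> intf intg [N [mN N0 fgN]].
rewrite (negligible_integral mN measurableT intf N0).
rewrite (negligible_integral mN measurableT intg N0).
apply: le_integral.
- exact: measurableD.
- by apply: integrableS intf => //; exact: measurableD.
- by apply: integrableS intg => //; exact: measurableD.
- by move=> x /set_mem[_ nNx]; apply: contrapT => nfg; exact/nNx/fgN.
Qed.

Lemma ae_bounded_integrable d (T : measurableType d) (R : realType)
    (P : probability T R) (f : T -> R) (C : R) :
  measurable_fun setT f -> {ae P, forall x, (`|f x| <= C)%R} ->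
  P.-integrable setT (EFin \o f).
Proof.
move=> mf fC; apply/integrableP; split; first exact/measurable_EFinP.
apply: (@le_lt_trans _ _ (\int[P]_(x in setT) (cst `|C|%:E) x)).
  apply: ae_ge0_le_integral => //.
  - by apply: measurableT_comp => //; exact/measurable_EFinP.
  - by move=> x _; rewrite lee_fin.
  - by apply: filterS fC => x fC _; rewrite lee_fin (le_trans fC)// ler_norm.
rewrite integral_cst// [X in _ * X](_ : _ = 1) ?mule1 ?ltry//.
exact: probability_setT.
Qed.

Definition sconvex (R : realType) (I : set R) (s g : R -> R) :=
  forall a x b, I a -> I b -> (a < x < b)%R ->
    (g x * (s b - s a) <= g a * (s b - s x) + g b * (s x - s a))%R.

Lemma measurable_clip (R : realType) (l r : \bar R) (J : set (\bar R))
    (p : \bar R -> bool) (f : R -> R) :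
  measurable J -> (forall z, p z <-> J z) -> J `<=` `]l, r[%classic ->
  measurable_fun (inner_set l r) f ->
  measurable_fun setT (fun z : \bar R => if p z then f (fine z) else 0%R).
Proof.
move=> mJ pJ Jlr mf; apply: measurable_fun_if => //.
- apply: (@measurable_fun_bool _ _ _ _ true); rewrite setTI.
  by rewrite (_ : _ @^-1` _ = J)//; apply/seteqP; split => z /= /pJ.
- rewrite setTI (_ : _ @^-1` _ = J); last by apply/seteqP; split => z /= /pJ.
  apply: (measurable_comp (measurable_inner l r)) mf _.
    by move=> _ [z /Jlr + <-]; rewrite /= in_itv => /inner_fin[x -> Ix].
  exact: measurable_funTS.
Qed.

Section exit_law.
Context {R : realType} {l r : \bar R} {d : measure_display}
  {Omega : measurableType d} (X : diffusion l r Omega) (s : R -> R).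
Hypothesis hs : is_scale_function X s.
Variables (a b : R).
Hypotheses (la : l < a%:E) (ab : (a < b)%R) (br : b%:E < r).

Local Notation natT := (g_sigma_algebraType (cylinders (coord X))).
Local Notation filT t := (g_sigma_algebraType (filt X t)).
Local Notation Z := (stopped (coord X) (exit_time (coord X) a%:E b%:E)).

Lemma inner_state x : inner_set l r x -> state X x%:E.
Proof. by move=> Ix; apply: state_inner; rewrite /= in_itv. Qed.

Lemma inner_itv y : (a <= y <= b)%R -> inner_set l r y.
Proof.
move=> /andP[ay yb]; apply/andP; split.
  by apply: (lt_le_trans la); rewrite lee_fin.
by apply: le_lt_trans br; rewrite lee_fin.
Qed.

Lemma inner_itv_open y : (a < y < b)%R -> inner_set l r y.
Proof. by move=> /andP[ay yb]; apply: inner_itv; rewrite !ltW. Qed.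

Definition exits_first (c c' : R) : set Omega :=
  [set w | exists n : nat, hit_first (coord X) c c' n%:R w].

Let ab' : a <> b. Proof. by move=> E; move: ab; rewrite E ltxx. Qed.
Let ba' : b <> a. Proof. by move=> E; exact: ab'. Qed.

Lemma measurable_exits_first c c' : c <> c' ->
  measurable (exits_first c c' : set natT).
Proof.
move=> cc'; rewrite (_ : exits_first c c' =
    \bigcup_n hit_first (coord X) c c' n%:R); last first.
  by apply/seteqP; split => w [n]; [exists n|move=> _; exists n].
apply: bigcupT_measurable => n.
apply: (@measurable_hit_first R _ natT (coord X) n%:R (coord_cont X) _ c c' n%:R cc').
  by move=> t /andP[t0 _]; exact: measurable_coord_natT.
by rewrite ler0n lexx.
Qed.

Lemma exit_left_prob x : (a < x < b)%R ->
  law X x%:E (exits_first a b) = ((s b - s x) / (s b - s a))%:E.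
Proof.
move=> axb; rewrite -(scale_exit_left hs la axb br); congr (law X x%:E _).
by apply/seteqP; split => w /=; rewrite hitting_time_lt//; exact: (coord_cont X w).
Qed.

Lemma exit_right_prob x : (a < x < b)%R ->
  law X x%:E (exits_first b a) = ((s x - s a) / (s b - s a))%:E.
Proof.
move=> axb; rewrite -(scale_exit_right hs la axb br); congr (law X x%:E _).
by apply/seteqP; split => w /=; rewrite hitting_time_lt//; exact: (coord_cont X w).
Qed.

Lemma scale_ab : (0 < s b - s a)%R.
Proof.
rewrite subr_gt0; apply: (scale_increasing hs) => //; apply: inner_itv.
  by rewrite lexx ltW.
by rewrite lexx ltW.
Qed.

Lemma measurable_alive_filT (t : R) : (0 <= t)%R ->
  measurable (alive (coord X) a b t : set (filT t)).
Proof.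
move=> t0; apply: (@measurable_alive _ _ (filT t) (coord X) t (coord_cont X)).
  by move=> q qt; exact: measurable_coord_filT.
by rewrite t0 lexx.
Qed.

Lemma measurable_stopped_filT (t : R) : (0 <= t)%R ->
  measurable_fun setT (Z t : filT t -> \bar R).
Proof.
move=> t0; apply: (@measurable_stopped _ _ (filT t) (coord X) t (coord_cont X)).
- by move=> q qt; exact: measurable_coord_filT.
- exact: ab.
- by rewrite t0 lexx.
Qed.

Lemma measurable_stopped_natT (t : R) : (0 <= t)%R ->
  measurable_fun setT (Z t : natT -> \bar R).
Proof.
move=> t0; apply: (@measurable_stopped _ _ natT (coord X) t (coord_cont X)).
- by move=> q /andP[q0 _]; exact: measurable_coord_natT.
- exact: ab.
- by rewrite t0 lexx.
Qed.

Lemma exits_firstE c c' (t : R) w : (c = a /\ c' = b) \/ (c = b /\ c' = a) ->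
  a%:E < coord X 0%R w < b%:E -> (0 <= t)%R -> ~ alive (coord X) a b t w ->
  exits_first c c' w <-> hit_first (coord X) c c' t w.
Proof.
move=> cc' X0 t0 nAt; split; last first.
  move=> h; exists (Num.truncn t).+1; apply: hit_first_le h.
  by rewrite ltW// truncnS_gt.
move=> [n hn]; have := exited_hit_first (coord_cont X w) ab X0 nAt.
have nh : ~ hit_first (coord X) c' c t w.
  move=> h; apply: (@hit_firstC _ _ _ c c' (Num.max n%:R t) w).
    by apply: hit_first_le hn; rewrite le_max lexx.
  by apply: hit_first_le h; rewrite le_max lexx orbT.
by case: cc' nh => -[-> ->] nh []//.
Qed.

Lemma hit_first_alive c c' (t : R) w : c = a \/ c = b ->
  alive (coord X) a b t w -> ~ hit_first (coord X) c c' t w.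
Proof.
move=> cab At [u [/andP[u0 ut] [[v [/andP[v0 vu] Xv]] _]]].
have := At v; rewrite v0 (le_trans vu ut) Xv => /(_ isT).
by case: cab => ->; rewrite ltxx ?andbF.
Qed.

Lemma clip_sub : `[a%:E, b%:E]%classic `<=` `]l, r[%classic.
Proof.
move=> z; rewrite /= !in_itv/= => /andP[az zb].
by rewrite (lt_le_trans la az) (le_lt_trans zb br).
Qed.

Lemma stopped_clip t w : a%:E < coord X 0%R w < b%:E -> (0 <= t)%R ->
  a%:E <= Z t w <= b%:E.
Proof.
move=> X0 t0; rewrite stoppedE//; last exact: (coord_cont X w).
rewrite X0/=; case: asboolP => [At|_].
  by have := At t; rewrite t0 lexx => /(_ isT) /andP[/ltW -> /ltW ->].
by case: ifPn => _; rewrite lexx lee_fin ltW.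
Qed.

Lemma measurable_scale : measurable_fun (inner_set l r) s.
Proof.
apply: subspace_continuous_measurable_fun; first exact: measurable_inner.
exact: Defs.scale_continuous hs.
Qed.

(** The probability of leaving (a, b) through a, with its boundary values 1 at a and
0 at b. *)
Definition left_weight (z : \bar R) : R :=
  if a%:E <= z <= b%:E then ((s b - s (fine z)) / (s b - s a))%R else 0%R.

Lemma measurable_left_weight : measurable_fun setT left_weight.
Proof.
rewrite /left_weight.
apply: (@measurable_clip _ l r `[a%:E, b%:E]%classic _
  (fun y => (s b - s y) / (s b - s a))%R).
- exact: emeasurable_itv.
- by move=> z; rewrite /= in_itv.
- exact: clip_sub.
- apply: measurable_funM => //; apply: measurable_funB => //.
  exact: measurable_scale.
Qed.

Lemma left_weight_bounds z : (0 <= left_weight z <= 1)%R.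
Proof.
have sab := scale_ab.
have smono y y' : (a <= y)%R -> (y <= y')%R -> (y' <= b)%R -> (s y <= s y')%R.
  rewrite [(y <= y')%R]le_eqVlt => ay /predU1P[->//|yy'] yb.
  by apply/ltW/(scale_increasing hs) => //; apply: inner_itv;
    rewrite ?ay ?yb ?(le_trans (ltW yy') yb) ?(le_trans ay (ltW yy')).
rewrite /left_weight; case: ifPn => [/andP[az zb]|_]; last by rewrite lexx ler01.
case: z az zb => //= z; rewrite !lee_fin => az zb.
rewrite ler_pdivrMr// mul1r divr_ge0 ?subr_ge0 ?smono ?lexx//=.
- by rewrite lerD2l lerN2 smono.
- exact: ltW.
Qed.

(** The probability of leaving through a is s-affine in the starting point. By the
Markov property at time v, its value at the stopped process at time v has the
same mean as at time 0; so s of the stopped process is a martingale. *)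
Lemma left_weight_mean (v y : R) : (0 <= v)%R -> (a < y < b)%R ->
  \int[law X y%:E]_w (left_weight (Z v w))%:E = ((s b - s y) / (s b - s a))%:E.
Proof.
move=> v0 ayb; have mq := measurable_left_weight.
have sy : state X y%:E by exact/inner_state/inner_itv_open.
have sab := scale_ab.
pose P := law X y%:E.
pose Al := alive (coord X) a b v.
have FAl : filt X v Al by apply/measurable_filT => //; exact: measurable_alive_filT.
have mAl : measurable Al by exact: filt_measurable FAl.
have mE := measurable_exits_first ab'.
have mE' := natT_measurable mE.
have mQ : measurable_fun setT (fun w => (left_weight (Z v w))%:E).
  apply/measurable_EFinP; apply: measurableT_comp => //.
  by apply: (filT_measurable_fun v0); exact: measurable_stopped_filT.
have Q0 z : (0 <= left_weight z)%R by have /andP[] := left_weight_bounds z.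
rewrite -(exit_left_prob ayb).
transitivity (\int[P]_(w in Al `|` ~` Al) (left_weight (Z v w))%:E).
  by rewrite setUCr.
have mCAl := measurableC mAl.
have disj : [disjoint Al & ~` Al] by apply/disj_setPS => w [].
rewrite (ge0_integral_setU _ mAl mCAl) ?setUCr//; last by move=> w _; rewrite lee_fin.
have start : {ae P, forall w, coord X 0%R w = y%:E} := law_start sy.
have [_ HM] := markov_event sy v0 mE.
(* before the exit the event that a comes first is decided by the shifted path,
   after the exit by the position of the stopped path *)
transitivity (P (exits_first a b `&` Al) + P (exits_first a b `&` ~` Al)).
  congr (_ + _).
    transitivity (P (Al `&` theta X v @^-1` exits_first a b)); last first.
      congr (P _); apply/seteqP; split => w /= [].
        move=> Aw h; split => //.
        apply/(@hit_firstT_shift _ _ (coord X) (theta X) a b v w _ v0 Aw); [|by left|by right|exact: h].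
        by move=> u t u0 t0; rewrite coord_theta.
      move=> h Aw; split => //.
      apply/(@hit_firstT_shift _ _ (coord X) (theta X) a b v w _ v0 Aw); [|by left|by right|exact: h].
      by move=> u t u0 t0; rewrite coord_theta.
    rewrite -HM//; apply: eq_integral => w; rewrite inE => Aw.
    have := Aw v; rewrite v0 lexx => /(_ isT) Xv.
    have X0 : a%:E < coord X 0%R w < b%:E by apply: Aw; rewrite lexx v0.
    rewrite stoppedE//; last exact: (coord_cont X w).
    rewrite X0/=; case: asboolP => // _.
    case: (coord X v w) Xv => [z| |]; rewrite ?[_ < -oo]ltNge ?leNye ?[+oo < _]ltNge ?leey ?andbF//.
    rewrite !lte_fin => zab.
    rewrite exit_left_prob// /left_weight !lee_fin/=.
    by have /andP[/ltW -> /ltW ->] := zab.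
  rewrite -integral_indic//.
  apply: ae_eq_integral.
  - exact: measurableC.
  - exact: measurable_funTS.
  - by apply: measurable_funTS; apply/measurable_EFinP; exact: measurable_indic.
  apply: filterS start => w X0 /= nAw; congr (_%:E).
  have X0ab : a%:E < coord X 0%R w < b%:E by rewrite X0 !lte_fin.
  rewrite stoppedE//; last exact: (coord_cont X w).
  rewrite X0ab/= (asboolF nAw) indicE.
  have := @exits_firstE a b v w (or_introl (conj erefl erefl)) X0ab v0 nAw.
  case: asboolP => h E.
    rewrite mem_set; last exact/E.
    by rewrite /left_weight lexx/= lee_fin (ltW ab) divff// gt_eqF.
  rewrite memNset; last by move/E.
  by rewrite /left_weight lexx/= lee_fin (ltW ab)/= subrr mul0r.
rewrite -measureU.
- by rewrite -setIUr setUCr setIT.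
- exact: measurableI.
- by apply: measurableI => //; exact: measurableC.
- by apply/seteqP; split => // w [[_ +] [_]].
Qed.

End exit_law.

(** * Subharmonic functions are s-convex *)

Section subharmonic_sconvex.
Context {R : realType} {l r : \bar R} {d : measure_display}
  {Omega : measurableType d} (X : diffusion l r Omega) (s : R -> R).
Hypothesis hs : is_scale_function X s.

Lemma on_inner_ge0 (g : R -> R) z : (forall x, inner_set l r x -> (0 <= g x)%R) ->
  (0 <= on_inner l r g z)%R.
Proof.
move=> g0; rewrite /on_inner; case: ifPn => // /inner_fin[x -> Ix].
exact: g0.
Qed.

Lemma measurable_on_inner (g : R -> R) : measurable_fun (inner_set l r) g ->
  measurable_fun setT (on_inner l r g).
Proof.
move=> mg; apply: (@measurable_clip _ l r `]l, r[%classic) mg => //.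
  exact: emeasurable_itv.
Qed.

Lemma stopped0 a b w : stopped (coord X) (exit_time (coord X) a%:E b%:E) 0%R w =
  coord X 0%R w.
Proof.
rewrite /stopped (min_idPl _)//.
by have [[-> _]|[u [u0 -> _ _]]] := exit_timeP a b (coord_cont X w);
  rewrite ?leey// lee_fin.
Qed.

(** The mean of g at the stopped process increases with time. As time grows the
process leaves (a, b) almost surely, through a with the s-affine probability of
the scale function; uniform integrability lets the mean pass to the limit, which
is the s-affine interpolation of g between a and b. *)
Lemma subharmonic_sconvex g : nneg_subharmonic X g -> sconvex (inner_set l r) s g.
Proof.
move=> [[mg Hsub] g0] a x b Ia Ib axb.
have [la _] := andP Ia; have [_ br] := andP Ib.
have [ax xb] := andP axb.
have ab := lt_trans ax xb.
have Ix : inner_set l r x by exact: (inner_itv_open la br).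
have sab := scale_ab hs la ab br.
pose P := law X x%:E.
pose M t w := on_inner l r g (stopped (coord X) (exit_time (coord X) a%:E b%:E) t w).
have [[mM intM HM] ui] : submartingale P (filt X) M /\ uniformly_integrable P M.
  exact: Hsub.
have ab' : a <> b by move=> E; move: ab; rewrite E ltxx.
have ba' : b <> a by move=> E; exact: ab'.
have M0 t w : (0 <= M t w)%R by exact: on_inner_ge0.
have start : {ae P, forall w, coord X 0%R w = x%:E} := law_start (inner_state X Ix).
have onE y : inner_set l r y -> on_inner l r g y%:E = g y.
  by rewrite /on_inner => Iy; rewrite (_ : _ < _ < _ = true).
have mM' t : (0 <= t)%R -> measurable_fun setT (M t).
  by move=> t0; apply: (filT_measurable_fun t0); apply/sub_measurable_filT => //; exact: mM.
have intK (C : R) : \int[P]_w C%:E = C%:E.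
  rewrite integral_cst// [X in _ * X](_ : _ = 1) ?mule1//.
  exact: probability_setT.
have gM n : (g x)%:E <= \int[P]_w (M n%:R w)%:E.
  have [|Y [[mY intY HY] MY]] := HM 0%R n%:R; first by rewrite lexx ler0n.
  have [sF _ _] := filt_filtration X.
  rewrite -HY; last first.
    have /(@sigma_algebra_id _ _ _) <- := sF 0%R (lexx _).
    exact: (@measurableT _ (g_sigma_algebraType (filt X 0%R))).
  rewrite -(intK (g x)); apply: ae_le_integral => //.
    apply: (@ae_bounded_integrable _ _ _ P (cst (g x)) `|g x|%R) => //.
    by apply: aeW.
  apply: filterS2 MY start => w MYw X0.
  by rewrite lee_fin (le_trans _ MYw)// /M stopped0 X0 onE.
pose Ha := exits_first X a b; pose Hb := exits_first X b a.
have mHa : measurable Ha := natT_measurable (measurable_exits_first ab').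
have mHb : measurable Hb := natT_measurable (measurable_exits_first ba').
have PHa : P Ha = ((s b - s x) / (s b - s a))%:E by exact: exit_left_prob.
have PHb : P Hb = ((s x - s a) / (s b - s a))%:E by exact: exit_right_prob.
pose Al n : set Omega := alive (coord X) a b n%:R.
have mAl n : measurable (Al n).
  apply: (@filt_measurable _ _ _ _ _ X n%:R) => //.
  by apply/measurable_filT => //; exact: measurable_alive_filT.
have Al0 : P (Al n) @[n --> \oo] --> 0%E.
  have -> : 0%E = P (\bigcap_n Al n).
    apply/esym/eqP; rewrite eq_le measure_ge0 andbT.
    have PH : P (Ha `|` Hb) = 1.
      transitivity (P Ha + P Hb).
        apply: measureU => //.
        apply/seteqP; split => // w [[n hn] [m hm]].
        apply: (@hit_firstC _ _ (coord X) a b (Num.max n%:R m%:R)%R w).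
          by apply: hit_first_le hn; rewrite le_max lexx.
        by apply: hit_first_le hm; rewrite le_max lexx orbT.
      rewrite PHa PHb -EFinD -mulrDl addrA subrK divff// gt_eqF//.
    have <- : P (~` (Ha `|` Hb)) = 0.
      by rewrite probability_setC// ?PH ?subee//; exact: measurableU.
    apply: le_measure; rewrite ?inE//.
    - exact: bigcapT_measurable.
    - by apply: measurableC; exact: measurableU.
    - move=> w Aw [|] [n].
        by apply: hit_first_alive (Aw n I); left.
      by apply: hit_first_alive (Aw n I); right.
  apply: nonincreasing_cvg_mu => //.
  - by apply: (le_lt_trans (probability_le1 _ _)) => //; exact: ltry.
  - exact: bigcapT_measurable.
  - move=> m n mn; apply/subsetPset => w Aw u /andP[u0 um].
    by apply: Aw; rewrite u0 (le_trans um)// ler_nat.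
(* Uniform integrability is used only to discard the paths still alive: there the
   stopped value is at most K, or belongs to the uniformly small tail. *)
have key (e : R) : (0 < e)%R -> (g x <= g a * ((s b - s x) / (s b - s a))
    + g b * ((s x - s a) / (s b - s a)) + (e + e))%R.
  move=> e0; have [K HK] := ui e e0.
  have [n] : exists n, P (Al n) < (e / (`|K| + 1))%:E.
    have K1 : (0 < e / (`|K| + 1))%R by rewrite divr_gt0// ltr_wpDl.
    have : \forall n \near \oo, P (Al n) < (e / (`|K| + 1))%:E.
      apply: (Al0 [set z | z < (e / (`|K| + 1))%:E]); apply: open_nbhs_nbhs; split.
        exact: open_ereal_lt_ereal.
      by rewrite /= lte_fin.
    by move=> [n _ /(_ n (leqnn n))] Hn; exists n.
  move=> PAl; rewrite -lee_fin; apply: (le_trans (gM n)).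
  pose B := [set w | (K <= `|M n%:R w|)%R].
  have mB : measurable B.
    have -> : B = setT `&` (fun w => `|M n%:R w|)%R @^-1` `[K, +oo[%classic.
      by rewrite setTI; apply/seteqP; split => w; rewrite /= in_itv/= andbT.
    by apply: measurableT_comp => //; exact: mM'.
  have mi (A : set Omega) (c : R) : measurable A ->
      measurable_fun setT (fun w => (c * \1_A w)%:E).
    move=> mA; apply/measurable_EFinP; apply: measurable_funM => //.
  have ii (A : set Omega) (c : R) : measurable A -> (0 <= c)%R ->
      \int[P]_w (c * \1_A w)%:E = c%:E * P A.
    move=> mA c0; under eq_integral do rewrite EFinM.
    rewrite ge0_integralZl_EFin ?integral_indic ?setIT//.
    by apply/measurable_EFinP; exact: measurable_indic.
  have ga0 : (0 <= g a)%R by exact: g0.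
  have gb0 : (0 <= g b)%R by exact: g0.
  have c0 (A : set Omega) (c : R) w : (0 <= c)%R -> 0 <= (c * \1_A w)%:E.
    by move=> ?; rewrite lee_fin mulr_ge0.
  pose MB w := ((M n%:R w) * \1_B w)%:E.
  have mMB : measurable_fun setT MB.
    apply/measurable_EFinP; apply: measurable_funM => //; exact: mM'.
  have MB0 w : 0 <= MB w by rewrite lee_fin mulr_ge0.
  have iMB : \int[P]_w MB w <= e%:E.
    apply: le_trans (HK n%:R (ler0n _ _)).
    rewrite integral_mkcond [leRHS]integral_mkcond.
    rewrite le_eqVlt; apply/orP; left; apply/eqP; apply: eq_integral => w _.
    rewrite /MB /patch in_setT indicE.
    by case: ifPn => wB; rewrite ?mulr0// mulr1 ger0_norm.
  have mi1 := mi Ha (g a) mHa; have mi2 := mi Hb (g b) mHb.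
  have mi3 := mi (Al n) `|K|%R (mAl n).
  apply: (@le_trans _ _ (\int[P]_w ((g a * \1_Ha w)%:E + (g b * \1_Hb w)%:E +
      (`|K| * \1_(Al n) w)%:E + MB w))).
    apply: ae_ge0_le_integral => //.
    - by move=> w _; rewrite lee_fin.
    - by apply/measurable_EFinP; exact: mM'.
    - by move=> w _; rewrite !adde_ge0 ?c0.
    - by do 3![apply: emeasurable_funD => //].
    apply: filterS start => w X0 _.
    have X0ab : a%:E < coord X 0%R w < b%:E by rewrite X0 !lte_fin.
    have i0 (A : set Omega) (c : R) : (0 <= c)%R -> (0 <= c * \1_A w)%R.
      by move=> ?; rewrite mulr_ge0.
    have := i0 Ha _ ga0; have := i0 Hb _ gb0; have := i0 (Al n) _ (normr_ge0 K).
    have := i0 B _ (M0 n%:R w).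
    rewrite /MB -!EFinD lee_fin.
    have [Aw|nAw] := pselect (Al n w).
      have [KM|MK] := leP K `|M n%:R w|%R.
        rewrite [\1_B w]indicE mem_set// mulr1; lra.
      rewrite [\1_(Al n) w]indicE mem_set// mulr1.
      have : (M n%:R w <= `|K|)%R.
        by rewrite (le_trans (ler_norm _))// (le_trans (ltW MK))// ler_norm.
      lra.
    have hE c c' cc' := @exits_firstE _ _ _ _ _ X a b ab c c' n%:R w cc' X0ab (ler0n _ _) nAw.
    have [h|h] := exited_hit_first (coord_cont X w) ab X0ab nAw.
      have -> : M n%:R w = g a.
        rewrite /M stoppedE//; last exact: (coord_cont X w).
        by rewrite X0ab/= (asboolF nAw) (asboolT h) onE.
      have -> : \1_Ha w = 1%R :> R.
        by rewrite indicE mem_set//; apply/(hE a b) => //; left.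
      lra.
    have -> : M n%:R w = g b.
      rewrite /M stoppedE//; last exact: (coord_cont X w).
      by rewrite X0ab/= (asboolF nAw) (asboolF (hit_firstC h)) onE.
    have -> : \1_Hb w = 1%R :> R.
      by rewrite indicE mem_set//; apply/(hE b a) => //; right.
    lra.
  do 3![rewrite ge0_integralD//;
    try by [move=> w _; rewrite ?adde_ge0 ?c0|do ?[apply: emeasurable_funD => //]]].
  rewrite !ii// PHa PHb.
  have -> : (g a * ((s b - s x) / (s b - s a)) + g b * ((s x - s a) / (s b - s a)) +
      (e + e))%:E = (g a)%:E * ((s b - s x) / (s b - s a))%:E +
      (g b)%:E * ((s x - s a) / (s b - s a))%:E + e%:E + e%:E.
    by rewrite -!EFinM addrA !EFinD.
  apply: leeD; last exact: iMB.
  apply: leeD => //.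
  apply: (@le_trans _ _ (`|K|%:E * (e / (`|K| + 1))%:E)).
    by apply: lee_wpmul2l; [rewrite lee_fin|exact: ltW].
  have K1 : (0 < `|K| + 1)%R by rewrite ltr_wpDl.
  rewrite -EFinM lee_fin mulrA ler_pdivrMr// mulrC.
  by rewrite ler_pM2l// lerDl.
have : (g x <= g a * ((s b - s x) / (s b - s a)) + g b * ((s x - s a) / (s b - s a)))%R.
  apply/ler_addgt0Pr => e e0.
  have := key (e / 2)%R; rewrite -splitr; apply.
  by rewrite divr_gt0.
by rewrite !mulrA -mulrDl ler_pdivlMr.
Qed.

End subharmonic_sconvex.

(** * Lipschitz s-convex functions are subharmonic *)

Section sconvex_subharmonic.
Context {R : realType} {l r : \bar R} {d : measure_display}
  {Omega : measurableType d} (X : diffusion l r Omega) (s : R -> R).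
Hypothesis hs : is_scale_function X s.
Variable g : R -> R.
Hypothesis mg : measurable_fun (inner_set l r) g.
Hypothesis g0 : forall x, inner_set l r x -> (0 <= g x)%R.
Hypothesis gbnd : forall a b, inner_set l r a -> inner_set l r b ->
  exists C, forall y, (a <= y <= b)%R -> (g y <= C)%R.
Hypothesis gsup : forall y, inner_set l r y -> exists c, forall z,
  inner_set l r z -> (g y + c * (s z - s y) <= g z)%R.

Section on_interval.
Variables (a b : R).
Hypotheses (la : l < a%:E) (ab : (a < b)%R) (br : b%:E < r).

Local Notation natT := (g_sigma_algebraType (cylinders (coord X))).
Local Notation filT t := (g_sigma_algebraType (filt X t)).
Local Notation Z := (stopped (coord X) (exit_time (coord X) a%:E b%:E)).
Local Notation M t w := (on_inner l r g (Z t w)).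

(** A bounded Borel version of g on [a, b], to which the Markov property applies
under every starting law. *)
Definition clip (z : \bar R) : R :=
  if a%:E <= z <= b%:E then g (fine z) else 0%R.

Let measurable_clip_g : measurable_fun setT clip.
Proof.
apply: (@measurable_clip _ l r `[a%:E, b%:E]%classic) mg => //.
- exact: emeasurable_itv.
- exact: clip_sub.
Qed.

Let clip_on_inner z : a%:E <= z <= b%:E -> on_inner l r g z = clip z.
Proof.
move=> zab; have : `]l, r[%classic z.
  by apply: (clip_sub la br); rewrite /= in_itv.
by rewrite /= in_itv/= /on_inner /clip zab => ->.
Qed.

Let clip_ge0 z : (0 <= clip z)%R.
Proof.
rewrite /clip; case: ifPn => // zab; apply: g0.
case: z zab => [z| |]; rewrite ?leeNy_eq ?leye_eq ?andbF//= !lee_fin.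
exact: (inner_itv la br).
Qed.

Let clip_bounded : exists2 C, (0 <= C)%R & forall z, (clip z <= C)%R.
Proof.
have Ia : inner_set l r a by apply: (inner_itv la br); rewrite lexx ltW.
have Ib : inner_set l r b by apply: (inner_itv la br); rewrite lexx ltW.
have [C HC] := gbnd Ia Ib.
have C0 : (0 <= C)%R by apply: le_trans (HC a _); [exact: g0|rewrite lexx ltW].
exists C => // z; rewrite /clip; case: ifPn => // zab; apply: HC.
by case: z zab => [z| |]; rewrite ?leeNy_eq ?leye_eq ?andbF.
Qed.

Let measurable_clip_stopped (v : R) : (0 <= v)%R ->
  measurable_fun setT (fun w => clip (Z v w)).
Proof.
move=> v0; apply: measurableT_comp => //.
by apply: (filT_measurable_fun v0); exact: measurable_stopped_filT.
Qed.

(** Jensen's inequality: g lies above its supporting s-affine function at y, whose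
mean at the stopped process is its value at y. *)
Lemma clip_mean (v y : R) : (0 <= v)%R -> (a < y < b)%R ->
  (g y)%:E <= \int[law X y%:E]_w (clip (Z v w))%:E.
Proof.
move=> v0 ayb; have Iy := inner_itv_open la br ayb.
have [c Hc] := gsup Iy.
have sab := scale_ab hs la ab br.
pose P := law X y%:E.
pose k := (c * (s b - s a))%R.
pose q := ((s b - s y) / (s b - s a))%R.
have mQ : measurable_fun setT (fun w => left_weight s a b (Z v w)).
  apply: measurableT_comp; first exact: (measurable_left_weight hs la br).
  by apply: (filT_measurable_fun v0); exact: measurable_stopped_filT.
have iQ : P.-integrable setT (fun w => (left_weight s a b (Z v w))%:E).
  apply: (@ae_bounded_integrable _ _ _ P (fun w => left_weight s a b (Z v w)) 1%R) => //.
  apply: aeW => w; have /andP[q0 q1] := left_weight_bounds hs la ab br (Z v w).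
  by rewrite ger0_norm.
have [C C0 HC] := clip_bounded.
have iG : P.-integrable setT (fun w => (clip (Z v w))%:E).
  apply: (@ae_bounded_integrable _ _ _ P (fun w => clip (Z v w)) C) => //.
    exact: measurable_clip_stopped.
  by apply: aeW => w; rewrite ger0_norm.
have icst (e : R) : P.-integrable setT (fun=> e%:E).
  apply: (@ae_bounded_integrable _ _ _ P (cst e) `|e|%R) => //.
  exact: aeW.
have start : {ae P, forall w, coord X 0%R w = y%:E} := law_start (inner_state X Iy).
have ikQ : P.-integrable setT (fun w => k%:E * (left_weight s a b (Z v w))%:E).
  exact: integrableZl.
have -> : (g y)%:E = \int[P]_w ((g y + k * q)%:E -
    k%:E * (left_weight s a b (Z v w))%:E).
  rewrite integralB// integralZl// (left_weight_mean hs la ab br v0 ayb).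
  rewrite integral_cst// [X in _ * X](_ : _ = 1) ?mule1//; last exact: probability_setT.
  by rewrite -EFinM -EFinB addrK.
apply: ae_le_integral => //; first exact: integrableB.
apply: filterS start => w X0.
have Zab : a%:E <= Z v w <= b%:E by apply: stopped_clip => //; rewrite X0 !lte_fin.
rewrite /clip /left_weight Zab.
move: Zab; case: (Z v w) => [z| |]; rewrite ?leeNy_eq ?leye_eq ?andbF// !lee_fin => zab.
rewrite /=.
have := Hc z (inner_itv la br zab).
apply: le_trans; rewrite /k /q -subr_ge0.
have -> : (c * (s b - s a) * ((s b - s y) / (s b - s a)) = c * (s b - s y))%R.
  by field; rewrite gt_eqF.
have -> : (c * (s b - s a) * ((s b - s z) / (s b - s a)) = c * (s b - s z))%R.
  by field; rewrite gt_eqF.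
by rewrite subr_ge0; lra.
Qed.

Let measurable_M (t : R) : (0 <= t)%R -> measurable_fun setT (fun w : filT t => M t w).
Proof.
move=> t0; apply: measurableT_comp; first exact: measurable_on_inner.
exact: measurable_stopped_filT.
Qed.

(** A path started in (a, b) is stopped inside [a, b], and any other path does not
move; so the stopped process is almost surely bounded, which makes uniform
integrability trivial. *)
Lemma stopped_bounded x : inner_set l r x -> exists2 C, (0 <= C)%R &
  forall t w, (0 <= t)%R -> coord X 0%R w = x%:E -> (M t w <= C)%R.
Proof.
move=> Ix; have [C C0 HC] := clip_bounded; exists (C + g x)%R.
  by rewrite addr_ge0// g0.
move=> t w t0 X0; have [xab|nxab] := boolP (a%:E < coord X 0%R w < b%:E).
  rewrite clip_on_inner; last exact: stopped_clip.
  by rewrite ler_wpDr// g0.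
rewrite stoppedE//; last exact: (coord_cont X w).
rewrite nxab X0 /on_inner (_ : _ < _ < _ = true)//=.
by rewrite ler_wpDl.
Qed.

(** The conditional expectation at time u is explicit. If the path has left (a, b)
by then, the process is frozen; otherwise, by the Markov property, it is the mean
of g at the process restarted from X_u and stopped after t - u, and Jensen's
inequality applies at the point X_u. *)
Lemma stopped_submartingale x : inner_set l r x ->
  submartingale (law X x%:E) (filt X) (fun t w => M t w).
Proof.
move=> Ix; have sx := inner_state X Ix.
pose P := law X x%:E.
have start : {ae P, forall w, coord X 0%R w = x%:E} := law_start sx.
have [C C0 MC] := stopped_bounded Ix.
have M0 t w : (0 <= M t w)%R by exact: on_inner_ge0.
split.
- by move=> t t0; apply/sub_measurable_filT => //; exact: measurable_M.
- move=> t t0; apply: (@ae_bounded_integrable _ _ _ P _ C).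
    by apply: (filT_measurable_fun t0); exact: measurable_M.
  by apply: filterS start => w X0; rewrite ger0_norm// MC.
move=> u t /andP[u0 ut].
pose v := (t - u)%R; have v0 : (0 <= v)%R by rewrite subr_ge0.
have tE : t = (u + v)%R by rewrite /v subrKC.
pose N w := (clip (Z v w))%:E.
have mN : measurable_fun setT (N : natT -> \bar R).
  apply/measurable_EFinP; apply: measurableT_comp => //.
  exact: measurable_stopped_natT.
have [mphi Hphi] := markov_fun sx u0 mN (fun w => clip_ge0 _).
set phi := (fun w => \int[law X (coord X u w)]_w' N w') in mphi Hphi.
have [C' C'0 HC'] := clip_bounded.
have mN' : measurable_fun setT N.
  by apply/measurable_EFinP; exact: measurable_clip_stopped.
have phi0 w : 0 <= phi w by apply: integral_ge0 => w' _; rewrite lee_fin.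
have phiC w : phi w <= C'%:E.
  apply: (@le_trans _ _ (\int[law X (coord X u w)]_w' cst C'%:E w')).
    by apply: ge0_le_integral => //; do ?[by move=> w' _; rewrite lee_fin].
  rewrite integral_cst// [X in _ * X](_ : _ = 1) ?mule1//; last exact: probability_setT.
have phiE w : (fine (phi w))%:E = phi w.
  by rewrite fineK// ge0_fin_numE// (le_lt_trans (phiC w))// ltry.
pose Al : set Omega := alive (coord X) a b u.
have mAl : measurable (Al : set (filT u)) by exact: measurable_alive_filT.
have FAl : filt X u Al by exact/measurable_filT.
have mAl' : measurable Al by exact: filt_measurable FAl.
pose Y w := if `[< Al w >] then fine (phi w) else M u w.
have mY : measurable_fun setT (Y : filT u -> R).
  apply: measurable_fun_ifT.
  - apply: (@measurable_fun_bool _ _ _ _ true).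
    rewrite setTI (_ : _ @^-1` _ = Al)//.
    by apply/seteqP; split => w /=; [move/asboolP|move=> ?; apply/asboolP].
  - by apply: measurableT_comp => //.
  - exact: measurable_M.
have Y0 w : (0 <= Y w)%R.
  by rewrite /Y; case: ifPn => // _; rewrite fine_ge0.
exists Y; split; last first.
  apply: aeW => w; rewrite /Y; case: asboolP => // Aw.
  have := Aw u; rewrite u0 lexx => /(_ isT) Xu.
  have X0 : a%:E < coord X 0%R w < b%:E by apply: Aw; rewrite lexx u0.
  rewrite -lee_fin phiE.
  rewrite clip_on_inner ?stopped_clip//.
  rewrite stoppedE//; last exact: (coord_cont X w).
  rewrite X0/= (asboolT Aw) /phi.
  move: Xu; case: (coord X u w) => [z| |]; rewrite ?[_ < -oo]ltNge ?leNye ?[+oo < _]ltNge ?leey ?andbF// !lte_fin => zab.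
  have /andP[/ltW az /ltW zb] := zab; rewrite /clip !lee_fin az zb/=.
  exact: clip_mean.
split.
- exact/sub_measurable_filT.
- apply: (@ae_bounded_integrable _ _ _ P _ (C + C')%R).
    exact: (filT_measurable_fun u0 mY).
  apply: filterS start => w X0; rewrite ger0_norm// /Y; case: ifPn => _.
    by rewrite -lee_fin phiE (le_trans (phiC w))// lee_fin lerDr.
  by rewrite (le_trans (MC _ _ u0 X0))// lerDl.
move=> A FA; have mA := filt_measurable u0 FA.
have t0 : (0 <= t)%R by rewrite (le_trans u0).
have split_int (f : Omega -> R) : measurable_fun setT f -> (forall w, (0 <= f w)%R) ->
    \int[P]_(w in A) (f w)%:E =
    \int[P]_(w in A `&` Al) (f w)%:E + \int[P]_(w in A `&` ~` Al) (f w)%:E.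
  move=> mf f0; rewrite -ge0_integral_setU.
  - by rewrite -setIUr setUCr setIT.
  - exact: measurableI.
  - by apply: measurableI => //; exact: measurableC.
  - by apply: measurable_funTS; exact/measurable_EFinP.
  - by move=> w _; rewrite lee_fin.
  - by apply/disj_setPS => w [[_ ?] []].
have mY' : measurable_fun setT Y := filT_measurable_fun u0 mY.
have mMt := filT_measurable_fun t0 (measurable_M t0).
rewrite (split_int _ mY')// (split_int _ mMt)//.
congr (_ + _).
  have FAAl : filt X u (A `&` Al).
    by apply/measurable_filT => //; apply: measurableI => //; exact/measurable_filT.
  transitivity (\int[P]_(w in A `&` Al) phi w).
    by apply: eq_integral => w /set_mem[_ Aw]; rewrite /Y asboolT.
  rewrite Hphi//; apply: eq_integral => w /set_mem[_ Aw].
  have X0 : a%:E < coord X 0%R w < b%:E by apply: Aw; rewrite lexx u0.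
  rewrite clip_on_inner ?stopped_clip// tE /N; congr ((clip _)%:E).
  apply/esym/stopped_shift => //.
  - by move=> u' t' u'0 t'0; rewrite coord_theta.
  - exact: (coord_cont X w).
  - exact: (coord_cont X (theta X u w)).
apply: eq_integral => w /set_mem[_ nAw]; rewrite /Y asboolF//.
rewrite (@stopped_exited _ _ (coord X) a b u t w)//.
- exact: (coord_cont X w).
- by rewrite u0.
Qed.

Lemma stopped_uniformly_integrable x : inner_set l r x ->
  uniformly_integrable (law X x%:E) (fun t w => M t w).
Proof.
move=> Ix e e0; have [C C0 MC] := stopped_bounded Ix.
exists (C + 1)%R => t t0.
have M0 w : (0 <= M t w)%R by exact: on_inner_ge0.
have start := law_start (inner_state X Ix).
set B := [set w | _].
have mM : measurable_fun setT (fun w => M t w).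
  by apply: (filT_measurable_fun t0); exact: measurable_M.
have mB : measurable B.
  have -> : B = setT `&` (fun w => `|M t w|)%R @^-1` `[(C + 1)%R, +oo[%classic.
    by rewrite setTI; apply/seteqP; split => w; rewrite /= in_itv/= andbT.
  by apply: measurableT_comp => //.
rewrite (_ : \int[_]_(w in B) _ = 0) ?lee_fin ?ltW//.
transitivity (\int[law X x%:E]_(w in B) (cst 0 w)); last by rewrite integral0.
apply: ae_eq_integral => //.
  apply: measurable_funTS; apply/measurable_EFinP; exact: measurableT_comp.
apply: filterS start => w X0 Bw; exfalso; move: Bw; rewrite /B/= ger0_norm//.
by have := MC t w t0 X0; lra.
Qed.

End on_interval.

Theorem sconvex_subharmonic : subharmonic X g.
Proof.
split => // x a b Ix la ab br; split.
- exact: stopped_submartingale.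
- exact: stopped_uniformly_integrable.
Qed.

End sconvex_subharmonic.

(** * Slopes of s-convex functions *)

Local Close Scope ereal_scope.

Definition slope (R : realType) (s g : R -> R) (x y : R) :=
  (g y - g x) / (s y - s x).

Definition slipschitz (R : realType) (I : set R) (C : R) (s g : R -> R) :=
  forall x y, I x -> I y -> x < y -> `|g y - g x| <= C * (s y - s x).

Section sconvex.
Context {R : realType} {l r : \bar R} (s : R -> R).
Local Notation I := (inner_set l r).
Hypothesis sinc : forall x y, I x -> I y -> x < y -> s x < s y.
Hypothesis scont : {within I, continuous s}.

Lemma scale_le x y : I x -> I y -> x <= y -> s x <= s y.
Proof. by move=> Ix Iy; rewrite le_eqVlt => /predU1P[->//|xy]; exact/ltW/sinc. Qed.

Lemma scale_lt_inv x y : I x -> I y -> s x < s y -> x < y.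
Proof. by move=> Ix Iy; apply: contraTT; rewrite -!leNgt; exact: scale_le. Qed.

Lemma scale_ivt x y v : I x -> I y -> x < y -> s x < v < s y ->
  exists z, [/\ I z, x < z < y & s z = v].
Proof.
move=> Ix Iy xy /andP[xv vy].
have [||z zxy sz] := @IVT _ s x y v (ltW xy).
- apply: continuous_subspaceW scont => z; rewrite /= in_itv/=.
  exact: (inner_between Ix Iy).
- by rewrite ge_min (ltW xv)/= le_max (ltW vy) orbT.
have Iz : I z by move: zxy; rewrite in_itv/=; exact: (inner_between Ix Iy).
exists z; split => //; apply/andP; split.
  by apply: scale_lt_inv => //; rewrite sz.
by apply: scale_lt_inv => //; rewrite sz.
Qed.

(** Continuity of s is used below only through intermediate values: these give points
that are close to x in scale. *)
Lemma scale_right x y e : I x -> I y -> x < y -> 0 < e ->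
  exists z, [/\ I z, x < z < y & s z < s x + e].
Proof.
move=> Ix Iy xy e0; have sxy := sinc Ix Iy xy.
have [|z [Iz xzy sz]] := @scale_ivt x y (s x + Num.min e (s y - s x) / 2) Ix Iy xy.
  by case: (leP e (s y - s x)) => h; apply/andP; split; lra.
by exists z; split => //; rewrite sz; case: (leP e (s y - s x)) => h; lra.
Qed.

Lemma scale_left x y e : I x -> I y -> x < y -> 0 < e ->
  exists z, [/\ I z, x < z < y & s y < s z + e].
Proof.
move=> Ix Iy xy e0; have sxy := sinc Ix Iy xy.
have [|z [Iz xzy sz]] := @scale_ivt x y (s y - Num.min e (s y - s x) / 2) Ix Iy xy.
  by case: (leP e (s y - s x)) => h; apply/andP; split; lra.
by exists z; split => //; rewrite sz; case: (leP e (s y - s x)) => h; lra.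
Qed.

Section convex_function.
Variable g : R -> R.
Hypothesis cg : sconvex I s g.

Lemma slope_chords x y z : I x -> I z -> x < y < z ->
  slope s g x y <= slope s g x z /\ slope s g x z <= slope s g y z.
Proof.
move=> Ix Iz /andP[xy yz].
have Iy : I y by apply: (inner_between Ix Iz); rewrite !ltW.
have c := cg Ix Iz (introT andP (conj xy yz)).
have sxy := sinc Ix Iy xy; have syz := sinc Iy Iz yz.
have sxz := lt_trans sxy syz.
rewrite /slope !ler_pdivrMr ?subr_gt0// ![_ / _ * _]mulrAC !ler_pdivlMr ?subr_gt0//.
by split; lra.
Qed.

Lemma slope_le x y z w : I x -> I w -> x < y -> y <= z -> z < w ->
  slope s g x y <= slope s g z w.
Proof.
move=> Ix Iw xy; rewrite le_eqVlt => /predU1P[<- yw|yz zw].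
  by have [+ +] := slope_chords Ix Iw (introT andP (conj xy yw)); exact: le_trans.
have Iy : I y by apply: (inner_between Ix Iw); rewrite !ltW//; lra.
have Iz : I z by apply: (inner_between Ix Iw); rewrite !ltW//; lra.
have [h1 h2] := slope_chords Ix Iz (introT andP (conj xy yz)).
have [h3 h4] := slope_chords Iy Iw (introT andP (conj yz zw)).
exact: le_trans (le_trans h1 h2) (le_trans h3 h4).
Qed.

Lemma slope_leE x y e : I x -> I y -> x < y ->
  (slope s g x y <= e) = (g y - g x <= e * (s y - s x)).
Proof. by move=> Ix Iy xy; rewrite /slope ler_pdivrMr ?subr_gt0 ?sinc. Qed.

Lemma slope_geE x y e : I x -> I y -> x < y ->
  (e <= slope s g x y) = (e * (s y - s x) <= g y - g x).
Proof. by move=> Ix Iy xy; rewrite /slope ler_pdivlMr ?subr_gt0 ?sinc. Qed.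

Lemma right_slope_cvg x : I x -> cvg (slope s g x y @[y --> x^'+]).
Proof.
move=> Ix; have [y Iy xy] := inner_next Ix; have [w Iw wx] := inner_prev Ix.
have Iz z : x < z < y -> I z.
  by move=> /andP[xz zy]; apply: (inner_between Ix Iy); rewrite !ltW.
apply/cvg_ex; eexists; apply: (@nondecreasing_at_right_cvgr _ _ _ (BLeft y)).
- by rewrite bnd_simp.
- move=> a b; rewrite !in_itv/= => /andP[xa ay] /andP[xb yb].
  rewrite le_eqVlt => /predU1P[->//|ab].
  by have [] := @slope_chords x a b Ix (Iz _ (introT andP (conj xb yb))) (introT andP (conj xa ab)).
- exists (slope s g w x) => _ [z + <-]; rewrite /= in_itv/= => /andP[xz zy].
  by apply: slope_le => //; apply: Iz; rewrite xz.
Qed.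

(** A one-sided derivative bound for a convex function is a Lipschitz bound,
because chords lie below the derivative at their right end. *)
Lemma right_sderiv_le C :
  (forall x, I x -> right_sderiv s g x <= C) <->
  (forall x y, I x -> I y -> x < y -> g y - g x <= C * (s y - s x)).
Proof.
split => [dC x y Ix Iy xy|lip x Ix].
  rewrite -slope_leE//; apply: le_trans (dC y Iy).
  apply: limr_ge; first exact: right_slope_cvg.
  have [z Iz yz] := inner_next Iy.
  near=> w; apply: slope_le => //.
  apply: (inner_between Iy Iz); apply/andP; split; first by near: w; exact: nbhs_right_ge.
  by near: w; exact: nbhs_right_le.
apply: limr_le; first exact: right_slope_cvg.
have [z Iz xz] := inner_next Ix.
near=> w.
have xw : x < w by near: w; exact: nbhs_right_gt.
have Iw : I w.
  by apply: (inner_between Ix Iz); rewrite (ltW xw)/=; near: w; exact: nbhs_right_le.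
by rewrite -/(slope s g x w) slope_leE//; exact: lip.
Unshelve. all: by end_near. Qed.

Variable C : R.
Hypothesis lip : slipschitz I C s g.

Let right_slopes x :=
  [set slope s g p.1 p.2 | p in [set p : R * R | [/\ I p.1, I p.2, x < p.1 & p.1 < p.2]]].

(** The right derivative of g with respect to s, as the infimum of the slopes of the
chords that start strictly to the right of x: in this form it is right-continuous,
also at l. The value C, which bounds all the slopes, keeps it nondecreasing beyond
r. *)
Definition rslope x : R := if (x%:E < r)%E then inf (right_slopes x) else C.

Let slope_bound z z' : I z -> I z' -> z < z' -> - C <= slope s g z z' <= C.
Proof.
move=> Iz Iz' zz'; rewrite slope_leE// slope_geE//.
by have := lip Iz Iz' zz'; rewrite ler_norml mulNr.
Qed.

Hypothesis lr : (l < r)%E.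

Let right_slopes_nonempty x : (x%:E < r)%E -> right_slopes x !=set0.
Proof.
move=> xr; have [z0 Iz0] := inner_nonempty lr.
have [z Iz xz] : exists2 z, I z & x < z.
  have [lx|xl] := ltP l x%:E; first by apply: inner_next; rewrite /inner_set/= lx.
  exists z0 => //; rewrite -lte_fin; apply: (le_lt_trans xl).
  by case/andP: Iz0.
have [z' Iz' zz'] := inner_next Iz.
by exists (slope s g z z'); exists (z, z').
Qed.

Let right_slopes_lb x : has_lbound (right_slopes x).
Proof.
by exists (- C) => _ [[z z'] /= [Iz Iz' xz zz'] <-]; have /andP[] := slope_bound Iz Iz' zz'.
Qed.

Lemma rslope_le_slope x z z' : I z -> I z' -> x < z -> z < z' ->
  rslope x <= slope s g z z'.
Proof.
move=> Iz Iz' xz zz'; rewrite /rslope ifT; last first.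
  by apply: (@lt_trans _ _ z%:E); [rewrite lte_fin|case/andP: Iz].
by apply: ge_inf => //; exists (z, z').
Qed.

Lemma slope_le_rslope w x : I w -> I x -> w < x -> slope s g w x <= rslope x.
Proof.
move=> Iw Ix wx; have xr : (x%:E < r)%E by case/andP: Ix.
rewrite /rslope xr; apply: lb_le_inf; first exact: right_slopes_nonempty.
by move=> _ [[z z'] /= [Iz Iz' xz zz'] <-]; apply: slope_le => //; exact: ltW.
Qed.

Lemma rslope_bound x : - C <= rslope x <= C.
Proof.
rewrite /rslope; case: ifPn => xr; last first.
  have [x0 Ix0] := inner_nonempty lr; have [y0 Iy0 xy0] := inner_next Ix0.
  by have /andP[h1 h2] := slope_bound Ix0 Iy0 xy0; rewrite lexx andbT (le_trans h1).
have [_ [[z z'] /= [Iz Iz' xz zz'] _]] := right_slopes_nonempty xr.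
have /andP[h1 h2] := slope_bound Iz Iz' zz'; apply/andP; split.
  apply: lb_le_inf; first exact: right_slopes_nonempty.
  by move=> _ [[y y'] /= [Iy Iy' xy yy'] <-]; have /andP[] := slope_bound Iy Iy' yy'.
by apply: le_trans h2; apply: ge_inf => //; exists (z, z').
Qed.

Lemma rslope_nondecreasing : {homo rslope : x y / x <= y}.
Proof.
move=> x y xy; have [yr|ry] := ltP y%:E r; last first.
  rewrite [rslope y]/rslope ltNge ry/=.
  by have /andP[] := rslope_bound x.
rewrite [rslope y]/rslope yr; apply: lb_le_inf; first exact: right_slopes_nonempty.
move=> _ [[z z'] /= [Iz Iz' yz zz'] <-].
by apply: rslope_le_slope => //; exact: le_lt_trans yz.
Qed.

Lemma rslope_right_continuous : right_continuous rslope.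
Proof.
move=> x; apply/cvgrPdist_le => e e0; have [xr|rx] := ltP x%:E r; last first.
  near=> y; rewrite /rslope !ifF ?subrr ?normr0 ?ltW//; apply/negbTE; rewrite -leNgt//.
  by apply: (le_trans rx); rewrite lee_fin; near: y; exact: nbhs_right_ge.
have [_ [[z z'] /= [Iz Iz' xz zz'] <-] h] :=
  inf_adherent e0 (conj (right_slopes_nonempty xr) (right_slopes_lb x)).
near=> y; have xy : x <= y by near: y; exact: nbhs_right_ge.
have yz : y < z by near: y; exact: nbhs_right_lt.
have := rslope_le_slope Iz Iz' yz zz'.
rewrite ler0_norm ?subr_le0 ?rslope_nondecreasing// opprB lerBlDl.
move=> /le_trans; apply; apply: ltW.
by rewrite {1}/rslope xr.
Unshelve. all: by end_near. Qed.

(** The defining chords start to the right of x; they approach the chord from x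
because g and s are continuous. *)
Lemma rslope_le_chord x y : I x -> I y -> x < y -> rslope x <= slope s g x y.
Proof.
move=> Ix Iy xy; rewrite slope_geE//.
have C0 : 0 <= C by have /andP[h1 h2] := rslope_bound x; lra.
apply/ler_addgt0Pr => e e0.
have e1 : 0 < e / (2 * C + 1) by rewrite divr_gt0//; lra.
have [z [Iz /andP[xz zy] sz]] := scale_right Ix Iy xy e1.
have := rslope_le_slope Iz Iy xz zy; rewrite slope_geE// => h1.
have := lip Ix Iz xz; rewrite ler_norml => /andP[h2 h3].
have /andP[h4 h5] := rslope_bound x.
have sxz := sinc Ix Iz xz.
have : (2 * C + 1) * (s z - s x) <= e.
  by rewrite mulrC -ler_pdivlMr; lra.
nra.
Qed.

Lemma rslope_support x z : I x -> I z -> g x + rslope x * (s z - s x) <= g z.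
Proof.
move=> Ix Iz; have [xz|zx|->] := ltgtP x z; last by rewrite subrr mulr0 addr0.
  by have := rslope_le_chord Ix Iz xz; rewrite slope_geE//; lra.
by have := slope_le_rslope Iz Ix zx; rewrite slope_leE//; lra.
Qed.

End convex_function.

End sconvex.

(** * Limits at the left end *)

Section ends.
Context {R : realType} {l r : \bar R}.
Local Notation I := (inner_set l r).
Hypothesis lr : (l < r)%E.

(** Finite and infinite left ends have different neighbourhoods in the extended
reals, but the same trace on (l, r). *)
Lemma near_left_endP (P : \bar R -> Prop) :
  (\forall z \near at_end l r l, P z) <->
  exists2 c, I c & forall x, I x -> x < c -> P x%:E.
Proof.
have [c0 Ic0] := inner_nonempty lr.
split; last first.
  move=> [c Ic HP]; rewrite /at_end near_withinE.
  have : \forall z \near nbhs l, (z < c%:E)%E.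
    apply: open_nbhs_nbhs; split; first exact: open_ereal_lt_ereal.
    by case/andP: Ic.
  apply: filterS => z zc; rewrite /= in_itv/= => /inner_fin[x zx Ix].
  by rewrite zx; apply: HP => //; rewrite -lte_fin -zx.
rewrite /at_end near_withinE => H.
suff [c Ic Hc] : exists2 c, I c & forall x, I x -> x < c ->
    `]l, r[%classic x%:E -> P x%:E.
  by exists c => // x Ix xc; apply: Hc => //; rewrite /= in_itv.
move: H; case: l Ic0 => [m||] Ic0.
- move=> /nbhs_EFin [e/= e0 eP].
  have mc0 : m < c0 by move: Ic0 => /andP[]; rewrite lte_fin.
  exists (Num.min c0 (m + e)).
    have [_ cr] := andP Ic0; rewrite /inner_set/= lte_fin lt_min mc0 ltrDl e0/=.
    by apply: le_lt_trans cr; rewrite lee_fin ge_min lexx.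
  move=> x /andP[]; rewrite lte_fin => mx _; rewrite lt_min => /andP[_ xe].
  by apply: eP; rewrite /= distrC ger0_norm; lra.
- by move: Ic0 => /andP[]; rewrite ltNge leey.
- move=> [M [_ MP]]; exists (Num.min c0 M).
    have [_ cr] := andP Ic0; rewrite /inner_set/= ltNyr/=.
    by apply: le_lt_trans cr; rewrite lee_fin ge_min lexx.
  by move=> x _; rewrite lt_min => /andP[_ xM]; apply: MP; rewrite lte_fin.
Qed.

#[export] Instance at_left_end_proper : ProperFilter (at_end l r l).
Proof.
apply: Build_ProperFilter_ex => P /near_left_endP [c Ic HP].
by have [y Iy yc] := inner_prev Ic; exists y%:E; exact: HP.
Qed.

Lemma cvg_left_endP (f : R -> R) (a : R) :
  f (fine z) @[z --> at_end l r l] --> a <->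
  forall e, 0 < e -> exists2 c, I c & forall x, I x -> x < c -> `|a - f x| < e.
Proof.
by split => [/cvgrPdist_lt H e /H /near_left_endP|H];
  [exact|apply/cvgrPdist_lt => e /H h; exact/near_left_endP].
Qed.

Lemma cvg_left_end (f : R -> R) : nondecreasing_on I f ->
  (f (fine z))%:E @[z --> at_end l r l] --> ereal_inf [set (f x)%:E | x in I].
Proof.
move=> ndf; set m := ereal_inf _.
have mf x : I x -> (m <= (f x)%:E)%E by move=> Ix; apply: ereal_inf_lbound; exists x.
have [c0 Ic0] := inner_nonempty lr.
have lt_near (y : \bar R) : (m < y)%E -> exists2 c, I c & forall x, I x -> x < c -> ((f x)%:E < y)%E.
  move=> /ereal_inf_ltP[_ [c Ic <-] fy]; exists c => // x Ix xc.
  by apply: le_lt_trans fy; rewrite lee_fin ndf// ltW.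
have : (m < +oo)%E by apply: (le_lt_trans (mf _ Ic0)); rewrite ltry.
case: m mf lt_near => [m| |] mf lt_near _.
- apply/cvg_EFin.
    by apply/near_left_endP; exists c0.
  apply/cvg_left_endP => e e0.
  have [|c Ic Hc] := lt_near (m + e)%:E; first by rewrite lte_fin ltrDl.
  exists c => // x Ix xc; have := Hc x Ix xc; have := mf x Ix; rewrite lte_fin lee_fin => h1 h2.
  by rewrite distrC ger0_norm; lra.
- by move: (mf _ Ic0).
- apply/cvgeNyPle => A.
  have [c Ic Hc] := lt_near A%:E (ltNyr A).
  by apply/near_left_endP; exists c => // x Ix xc; apply/ltW/Hc.
Qed.

Lemma extend_left_nondecreasing (f : R -> R) : nondecreasing_on I f ->
  extend l r f l = ereal_inf [set (f x)%:E | x in I].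
Proof.
by move=> ndf; rewrite /extend eqxx/=; apply: cvg_lim => //; exact: cvg_left_end.
Qed.

End ends.

(** * Extremal s-convex functions *)

(** The class K0plus with its probabilistic conditions replaced by analytic ones:
convexity and a Lipschitz bound with respect to s. *)
Definition Kplus (R : realType) (l r : \bar R) (s : R -> R) : set (R -> R) :=
  [set g | [/\ sconvex (inner_set l r) s g,
    forall x, inner_set l r x -> 0 <= g x,
    nondecreasing_on (inner_set l r) g,
    forall x y, inner_set l r x -> inner_set l r y -> x < y ->
      g y - g x <= s y - s x &
    forall e, 0 < e -> exists2 c, inner_set l r c &
      forall x, inner_set l r x -> x < c -> g x < e]].

(** The possible kinks of a call function, in scale: tau is a value of s, or
its finite limit at l. *)
Definition kink (R : realType) (l r : \bar R) (s : R -> R) (tau : R) :=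
  (forall e, 0 < e -> exists2 a, inner_set l r a & tau <= s a < tau + e) /\
  (exists2 x, inner_set l r x & tau < s x).

Section extremal_elements.
Context {R : realType} {l r : \bar R} (s : R -> R).
Local Notation I := (inner_set l r).
Hypothesis lr : (l < r)%E.
Hypothesis sinc : forall x y, I x -> I y -> x < y -> s x < s y.
Hypothesis scont : {within I, continuous s}.

Lemma Kplus_lipschitz g : Kplus l r s g -> slipschitz I 1 s g.
Proof.
move=> [_ _ nd lip _] x y Ix Iy xy; rewrite ger0_norm ?mul1r; first exact: lip.
by rewrite subr_ge0 nd// ltW.
Qed.

(** If f is linear through x, x' and points a such that s a decreases to tau while
f a tends to 0, then f is proportional to s - tau at x and x'. *)
Lemma ray_limit (f : R -> R) tau x x' :
  (forall e, 0 < e -> exists a, [/\ tau <= s a < tau + e, 0 <= f a < e &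
    f x * (s x' - s a) = f a * (s x' - s x) + f x' * (s x - s a)]) ->
  f x * (s x' - tau) = f x' * (s x - tau).
Proof.
move=> H; apply/eqP; rewrite -subr_eq0; apply/negPn/negP => D0.
set D := (X in X != 0) in D0.
pose K := `|f x| + `|f x'| + `|s x' - s x|.
have K0 : 0 <= K by rewrite !addr_ge0.
have e0 : 0 < `|D| / (K + 1) by rewrite divr_gt0 ?normr_gt0//; lra.
have [a [/andP[a1 a2] /andP[f1 f2] E]] := H _ e0.
set e := `|D| / (K + 1) in e0 a2 f2.
have DE : D = f x * (s a - tau) + f a * (s x' - s x) - f x' * (s a - tau).
  by rewrite /D; nra.
have De : `|D| <= K * e.
  have sa : `|s a - tau| <= e by rewrite ger0_norm; lra.
  have fa : `|f a| <= e by rewrite ger0_norm; lra.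
  rewrite DE; apply: (le_trans (ler_normB _ _)).
  rewrite /K !mulrDl addrAC lerD//; last first.
    by rewrite normrM ler_wpM2l.
  apply: (le_trans (ler_normD _ _)); rewrite lerD// normrM ?ler_wpM2l//.
  by rewrite mulrC ler_wpM2l.
have : `|D| = (K + 1) * e by rewrite /e mulrC divfK//; lra.
lra.
Qed.

Section ramp.
Variables (k tau : R) (g : R -> R).
Hypotheses (k01 : 0 < k <= 1) (hk : kink l r s tau).
Hypothesis gE : forall x, I x -> g x = k * Num.max (s x - tau) 0.

Lemma ramp_Kplus : Kplus l r s g.
Proof.
have [k0 k1] := andP k01; have [adh _] := hk.
have le x y : I x -> I y -> x <= y -> s x <= s y by exact: scale_le.
split.
- move=> a x b Ia Ib /andP[ax xb].
  have Ix : I x by apply: (inner_between Ia Ib); rewrite !ltW.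
  have sax := sinc Ia Ix ax; have sxb := sinc Ix Ib xb.
  rewrite !gE// -!mulrA -mulrDr ler_pM2l//.
  by case: (leP (s x - tau) 0) => h1; case: (leP (s a - tau) 0) => h2;
    case: (leP (s b - tau) 0) => h3; nra.
- by move=> x Ix; rewrite gE// mulr_ge0 ?(ltW k0)// le_max lexx orbT.
- move=> x y Ix Iy xy; rewrite !gE// ler_pM2l//.
  have := le x y Ix Iy xy.
  by case: (leP (s x - tau) 0) => h1; case: (leP (s y - tau) 0) => h2; lra.
- move=> x y Ix Iy xy; rewrite !gE//; have := sinc Ix Iy xy.
  by case: (leP (s x - tau) 0) => h1; case: (leP (s y - tau) 0) => h2; nra.
- move=> e e0; have [a Ia /andP[a1 a2]] := adh e e0; exists a => // x Ix xa.
  have := sinc Ix Ia xa; rewrite gE//.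
  by case: (leP (s x - tau) 0) => h1; nra.
Qed.

(** To the left of the kink two nonnegative summands of g vanish. To its right g is
linear, so that the convexity inequalities of both summands must be equalities:
each summand is linear and starts from 0 at the kink, hence is a multiple of g. *)
Lemma ramp_extremal : extremal I (Kplus l r s) g.
Proof.
have [k0 k1] := andP k01; have [adh [x0 Ix0 x0t]] := hk.
have gpos x : I x -> tau < s x -> g x = k * (s x - tau).
  by move=> Ix xt; rewrite gE// max_l//; lra.
have gneg x : I x -> s x <= tau -> g x = 0.
  by move=> Ix xt; rewrite gE// max_r ?mulr0//; lra.
split; first exact: ramp_Kplus.
  exists x0; split => //; rewrite gpos//; apply/eqP; rewrite mulf_neq0//; lra.
have main g1 g2 : Kplus l r s g1 -> Kplus l r s g2 ->
    (forall x, I x -> g x = g1 x + g2 x) ->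
    exists k1, forall x, I x -> g1 x = k1 * g x.
  move=> [c1 p1 _ _ _] [c2 p2 _ _ _] g12.
  have prop x x' : I x -> I x' -> x < x' -> tau < s x ->
      g1 x * (s x' - tau) = g1 x' * (s x - tau).
    move=> Ix Ix' xx' xt; apply: ray_limit => e e0.
    have m0 : 0 < Num.min e (s x - tau) by rewrite lt_min e0/=; lra.
    have [a Ia /andP[a1]] := adh _ m0.
    rewrite -ltrBlDl lt_min => /andP[a2 a3].
    have ax : a < x by apply: (scale_lt_inv sinc) => //; lra.
    exists a; split; first by apply/andP; split; lra.
      rewrite p1//=; apply: (@le_lt_trans _ _ (g a)).
        by rewrite g12// lerDl p2.
      move: a1; rewrite le_eqVlt => /predU1P[ta|ta].
        by rewrite gneg// -ta.
      by rewrite gpos//; nra.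
    have d1 := c1 a x x' Ia Ix' (introT andP (conj ax xx')).
    have d2 := c2 a x x' Ia Ix' (introT andP (conj ax xx')).
    have : g x * (s x' - s a) = g a * (s x' - s x) + g x' * (s x - s a).
      have sxx' := sinc Ix Ix' xx'.
      rewrite (gpos x)// (gpos x')//; last lra.
      move: a1; rewrite le_eqVlt => /predU1P[ta|ta].
        by rewrite gneg// -ta// mul0r add0r; ring.
      by rewrite gpos//; ring.
    rewrite !g12//; lra.
  exists (g1 x0 / g x0) => x Ix; rewrite (gpos x0)//.
  have [xt|tx] := leP (s x) tau.
    rewrite gneg// mulr0; have := g12 x Ix; rewrite gneg//.
    by have := p1 x Ix; have := p2 x Ix; lra.
  rewrite gpos//.
  have E : g1 x0 * (s x - tau) = g1 x * (s x0 - tau).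
    by have [h|h|->] := ltgtP x0 x; [exact: prop|symmetry; exact: prop|].
  have h0 : s x0 - tau != 0 by lra.
  have h1 : k != 0 by lra.
  have -> : g1 x0 / (k * (s x0 - tau)) * (k * (s x - tau)) =
      g1 x0 * (s x - tau) / (s x0 - tau) by field; rewrite h0 h1.
  by rewrite E mulfK.
move=> g1 g2 K1 K2 g12.
have [q1 H1] := main g1 g2 K1 K2 g12.
have [|q2 H2] := main g2 g1 K2 K1; first by move=> x Ix; rewrite addrC g12.
by exists q1, q2.
Qed.

End ramp.

Section cut.
Variables (g : R -> R) (y : R).
Hypotheses (Kg : Kplus l r s g) (Iy : I y).
Local Notation c := (rslope s g (l:=l) (r:=r) 1 y).

(** A function of the class splits at y into the function that continues it along its
tangent to the right of y, and its excess over that tangent; both are again in the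
class, which tests extremality at y. *)
Definition excess x := if x <= y then 0 else g x - g y - c * (s x - s y).
Definition linearized x := g x - excess x.

Let cg : sconvex I s g. Proof. by case: Kg. Qed.
Let g0 x : I x -> 0 <= g x. Proof. by move: x; case: Kg. Qed.
Let gnd : nondecreasing_on I g. Proof. by case: Kg. Qed.
Let glip x x' : I x -> I x' -> x < x' -> g x' - g x <= s x' - s x.
Proof. by move: x x'; case: Kg. Qed.
Let gvan e : 0 < e -> exists2 c, I c & forall x, I x -> x < c -> g x < e.
Proof. by move: e; case: Kg. Qed.
Let lipg := Kplus_lipschitz Kg.

Let right_chord x x' : I x -> I x' -> y <= x -> x < x' -> c * (s x' - s x) <= g x' - g x.
Proof.
move=> Ix Ix' yx xx'; have sxx' := sinc Ix Ix' xx'.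
have := rslope_le_chord sinc scont lipg lr Ix Ix' xx'.
rewrite (slope_geE sinc)//; apply: le_trans; rewrite ler_pM2r ?subr_gt0//.
exact: (rslope_nondecreasing sinc lipg lr).
Qed.

Let left_chord w x : I w -> I x -> w < x -> x <= y -> g x - g w <= c * (s x - s w).
Proof.
move=> Iw Ix wx xy; have swx := sinc Iw Ix wx.
have := slope_le_rslope sinc cg 1 lr Iw Ix wx.
rewrite (slope_leE sinc)// => /le_trans; apply; rewrite ler_pM2r ?subr_gt0//.
exact: (rslope_nondecreasing sinc lipg lr).
Qed.

Let c01 : 0 <= c <= 1.
Proof.
have [w Iw wy] := inner_prev Iy; have swy := sinc Iw Iy wy.
have /andP[_ ->] := rslope_bound sinc lipg lr y; rewrite andbT.
have := left_chord Iw Iy wy (lexx y).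
have := gnd Iw Iy (ltW wy); nra.
Qed.

Let excess0 x : x <= y -> excess x = 0. Proof. by rewrite /excess => ->. Qed.
Let excessE x : y < x -> excess x = g x - g y - c * (s x - s y).
Proof. by move=> yx; rewrite /excess leNgt yx. Qed.

Lemma excess_Kplus : Kplus l r s excess.
Proof.
have [c0 c1] := andP c01.
have pos x : I x -> 0 <= excess x.
  move=> Ix; rewrite /excess; case: (leP x y) => // yx.
  by have := right_chord Iy Ix (lexx y) yx; lra.
split => //.
- move=> a x b Ia Ib /andP[ax xb].
  have Ix : I x by apply: (inner_between Ia Ib); rewrite !ltW.
  have sax := sinc Ia Ix ax; have sxb := sinc Ix Ib xb.
  have [xy|yx] := leP x y.
    rewrite (excess0 xy) mul0r addr_ge0// mulr_ge0 ?pos//; lra.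
  have yb := lt_trans yx xb.
  rewrite (excessE yx) (excessE yb).
  case: (leP a y) => ay; last first.
    by rewrite excessE//; have := cg Ia Ib (introT andP (conj ax xb)); nra.
  have syx := sinc Iy Ix yx.
  have say : s a <= s y := scale_le sinc Ia Iy ay.
  have := cg Iy Ib (introT andP (conj yx xb)).
  have := right_chord Iy Ib (lexx y) yb.
  set u := g b - g y => h1 h2.
  have h3 : (g x - g y - c * (s x - s y)) * (s b - s y) <=
      (u - c * (s b - s y)) * (s x - s y) by rewrite /u; nra.
  have h4 : g x - g y - c * (s x - s y) <= u - c * (s b - s y).
    have sby : 0 < s b - s y by lra.
    rewrite -(ler_pM2r sby); apply: (le_trans h3); apply: ler_wpM2l; lra.
  rewrite excess0// mul0r add0r -/u; nra.
- move=> x x' Ix Ix'; rewrite le_eqVlt => /predU1P[->//|xx'].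
  have [x'y|yx'] := leP x' y; first by rewrite !excess0 ?(ltW (lt_le_trans xx' x'y))//.
  have [xy|yx] := leP x y; first by rewrite (excess0 xy) pos.
  rewrite (excessE yx) (excessE yx').
  by have := right_chord Ix Ix' (ltW yx) xx'; lra.
- move=> x x' Ix Ix' xx'; have sxx' := sinc Ix Ix' xx'.
  have [x'y|yx'] := leP x' y; first by rewrite !excess0 ?(ltW (lt_le_trans xx' x'y))//; lra.
  have syx' := sinc Iy Ix' yx'.
  have [xy|yx] := leP x y.
    have sxy := scale_le sinc Ix Iy xy.
    rewrite (excess0 xy) (excessE yx').
    by have := glip Iy Ix' yx'; nra.
  rewrite (excessE yx) (excessE yx').
  by have := glip Ix Ix' xx'; nra.
- by move=> e e0; exists y => // x Ix xy; rewrite /excess (ltW xy).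
Qed.

Lemma linearized_Kplus : Kplus l r s linearized.
Proof.
have [c0 c1] := andP c01.
have lowE x : x <= y -> linearized x = g x by move=> xy; rewrite /linearized /excess xy subr0.
have highE x : y < x -> linearized x = g y + c * (s x - s y).
  by move=> yx; rewrite /linearized /excess leNgt yx/=; ring.
split.
- move=> a x b Ia Ib /andP[ax xb].
  have Ix : I x by apply: (inner_between Ia Ib); rewrite !ltW.
  have sax := sinc Ia Ix ax; have sxb := sinc Ix Ib xb.
  have [yx|xy] := ltP y x.
    rewrite (highE x)// (highE b) ?(lt_trans yx)//.
    have [ya|ay] := ltP y a; first by rewrite highE//; lra.
    rewrite (lowE a)//.
    have h : g y - g a <= c * (s y - s a).
      move: ay; rewrite le_eqVlt => /predU1P[->|ay]; first by rewrite !subrr mulr0.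
      exact: left_chord.
    have sb : 0 < s b - s x by lra.
    have : (g y - g a) * (s b - s x) <= c * (s y - s a) * (s b - s x) by rewrite ler_pM2r.
    lra.
  rewrite (lowE x)// (lowE a); last by rewrite (le_trans (ltW ax)).
  have [yb|by_] := ltP y b; last by rewrite lowE//; exact: (cg Ia Ib (introT andP (conj ax xb))).
  rewrite highE//; have syb := sinc Iy Ib yb.
  have h1 : (g x - g a) * (s b - s y) <= c * (s x - s a) * (s b - s y).
    by rewrite ler_pM2r ?subr_gt0//; exact: left_chord.
  move: xy; rewrite le_eqVlt => /predU1P[E|xy].
    by move: h1; rewrite E; lra.
  by have := cg Ia Iy (introT andP (conj ax xy)); lra.
- move=> x Ix; have [xy|yx] := leP x y; first by rewrite lowE ?g0.
  rewrite highE// addr_ge0 ?g0// mulr_ge0//.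
  by have := sinc Iy Ix yx; lra.
- move=> x x' Ix Ix'; rewrite le_eqVlt => /predU1P[->//|xx']; have sxx' := sinc Ix Ix' xx'.
  have [x'y|yx'] := leP x' y; first by rewrite !lowE ?gnd ?(ltW xx')// (le_trans (ltW xx')).
  have syx' := sinc Iy Ix' yx'.
  have [xy|yx] := leP x y.
    by rewrite (lowE x)// (highE x')//; have := gnd Ix Iy xy; nra.
  by rewrite !highE//; nra.
- move=> x x' Ix Ix' xx'; have sxx' := sinc Ix Ix' xx'.
  have [x'y|yx'] := leP x' y.
    by rewrite !lowE ?glip// (le_trans (ltW xx')).
  have syx' := sinc Iy Ix' yx'.
  have [xy|yx] := leP x y.
    rewrite (lowE x)// (highE x')//.
    have : g y - g x <= s y - s x.
      by move: xy; rewrite le_eqVlt => /predU1P[->|xy]; [rewrite !subrr|exact: glip].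
    nra.
  by rewrite !highE//; nra.
- move=> e e0; have [z Iz Hz] := gvan e0.
  have [zy|yz] := leP z y; [exists z|exists y] => // x Ix xz.
    by rewrite lowE ?Hz// ltW// (lt_le_trans xz).
  by rewrite lowE ?ltW// Hz// (lt_trans xz).
Qed.

End cut.

(** At each y an extremal element is proportional to its excess, hence vanishes on the
left of y, or has no excess, hence is linear in s on the right of y. The kink is
the point where these alternatives switch. If the function vanishes nowhere, it is
linear everywhere; as it tends to 0 at l with positive slope, s is bounded below
and the kink is at l. *)
Lemma extremal_ramp g : extremal I (Kplus l r s) g ->
  exists k tau, [/\ 0 < k <= 1,
    (exists2 y, I y & tau = s y) \/ tau%:E = ereal_inf [set (s x)%:E | x in I] &
    forall x, I x -> g x = k * Num.max (s x - tau) 0].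
Proof.
move=> [Kg [x0 [Ix0 /eqP gx0]] ext].
have [cg g0 gnd glip gvan] := Kg.
have dich y : I y -> (forall x, I x -> x <= y -> g x = 0) \/
    exists c, forall x, I x -> y <= x -> g x = g y + c * (s x - s y).
  move=> Iy.
  have [|k1 [k2 [H1 H2]]] := ext _ _ (linearized_Kplus Kg Iy) (excess_Kplus Kg Iy).
    by move=> x Ix; rewrite /linearized subrK.
  have [k20|k20] := eqVneq k2 0.
    right; exists (rslope s g (l:=l) (r:=r) 1 y) => x Ix; rewrite le_eqVlt => /predU1P[->|yx].
      by rewrite subrr mulr0 addr0.
    by have := H2 x Ix; rewrite k20 mul0r /excess leNgt yx/=; lra.
  left => x Ix xy; have := H2 x Ix; rewrite /excess xy => /esym/eqP.
  by rewrite mulf_eq0 (negbTE k20)/= => /eqP.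
have gx0_gt0 : 0 < g x0 by rewrite lt_neqAle eq_sym gx0 g0.
(* it suffices to exhibit a level tau at which g comes down to 0 linearly *)
have suff_tau tau : tau < s x0 ->
    (forall x, I x -> s x <= tau -> g x = 0) ->
    (forall e x, 0 < e -> I x -> tau < s x -> exists a, [/\ I a, a < x, tau <= s a < tau + e,
       g a < e & exists c, forall x', I x' -> a <= x' -> g x' = g a + c * (s x' - s a)]) ->
    exists2 k, 0 < k <= 1 & forall x, I x -> g x = k * Num.max (s x - tau) 0.
  move=> tx0 low adh.
  have prop x x' : I x -> I x' -> x < x' -> tau < s x ->
      g x * (s x' - tau) = g x' * (s x - tau).
    move=> Ix Ix' xx' tx; apply: ray_limit => e e0.
    have [a [Ia ax ta ga [c Hc]]] := adh e x e0 Ix tx.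
    exists a; split => //; first by rewrite g0.
    rewrite (Hc x)// ?(Hc x')// ?ltW// ?(lt_trans ax)//.
    by ring.
  exists (g x0 / (s x0 - tau)).
    rewrite divr_gt0 ?subr_gt0//= ler_pdivrMr ?subr_gt0// mul1r.
    apply/ler_addgt0Pr => e e0; have e20 : 0 < e / 2 by lra.
    have [a [Ia ax ta ga _]] := adh (e / 2) x0 e20 Ix0 tx0.
    by have := glip a x0 Ia Ix0 ax; lra.
  move=> x Ix; have [xt|tx] := leP (s x) tau.
    by rewrite low// max_r ?mulr0//; lra.
  rewrite max_l; last lra.
  have E : g x0 * (s x - tau) = g x * (s x0 - tau).
    by have [h|h|->] := ltgtP x0 x; [exact: prop|symmetry; exact: prop|].
  by rewrite mulrAC E mulfK//; lra.
have [[z0 [Iz0 gz0]]|nz] := pselect (exists z, I z /\ g z = 0).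
- pose Zs := [set z | I z /\ g z = 0].
  have Zx0 z : Zs z -> z < x0.
    move=> [Iz gz]; rewrite ltNge; apply/negP => x0z.
    by have := gnd x0 z Ix0 Iz x0z; lra.
  have sZ : has_sup Zs by split; [exists z0|exists x0 => z /Zx0/ltW].
  pose y := sup Zs.
  have zy z : Zs z -> z <= y by move=> Zz; apply: ub_le_sup => //; exact: sZ.2.
  have yx0 : y <= x0 by apply: ge_sup; [exists z0|move=> z /Zx0/ltW].
  have Iy : I y by apply: (inner_between Iz0 Ix0); rewrite yx0 zy.
  have gy : g y = 0.
    apply/le_anti; rewrite g0// andbT; apply/ler_addgt0Pr => e e0; rewrite add0r.
    have := zy z0 (conj Iz0 gz0); rewrite le_eqVlt => /predU1P[<-|z0y]; first by rewrite gz0 ltW.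
    have [m [Im /andP[z0m my] sm]] := scale_left sinc scont Iz0 Iy z0y e0.
    have [z [Iz gz] mz] := @sup_adherent _ Zs (y - m) (ltac:(by rewrite subr_gt0)) sZ.
    have := zy z (conj Iz gz); rewrite le_eqVlt => /predU1P[<-|zy']; first by rewrite gz ltW.
    have := glip z y Iz Iy zy'; have smz : s m < s z by apply: sinc => //; move: mz; rewrite /y; lra.
    lra.
  have yx0' : y < x0.
    by rewrite lt_neqAle yx0 andbT; apply/eqP => E; move: gx0_gt0; rewrite -E gy ltxx.
  have gt y' : I y' -> y < y' -> g y' <> 0.
    by move=> Iy' yy' gy'; have := zy y' (conj Iy' gy'); rewrite leNgt yy'.
  have [] := suff_tau (s y).
  + exact: sinc.
  + move=> x Ix xy; apply/le_anti; rewrite g0// andbT -gy gnd// leNgt.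
    by apply/negP => /(sinc Iy Ix); lra.
  + move=> e x e0 Ix syx.
    have yx : y < x by exact: (scale_lt_inv sinc).
    have [a [Ia /andP[ya ax] sa]] := scale_right sinc scont Iy Ix yx e0.
    have sya := sinc Iy Ia ya.
    exists a; split => //; first by rewrite (ltW sya).
      by have := glip y a Iy Ia ya; lra.
    by have [/(_ a Ia (lexx a))/(gt a Ia ya)//|] := dich a Ia.
  + by move=> k k01 H; exists k, (s y); split => //; left; exists y.
- have lin y : I y -> exists c, forall x, I x -> y <= x -> g x = g y + c * (s x - s y).
    move=> Iy; have [/(_ y Iy (lexx y)) gy|//] := dich y Iy.
    by exfalso; apply: nz; exists y.
  have gpos x : I x -> 0 < g x.
    by move=> Ix; rewrite lt_neqAle g0// andbT; apply/eqP => E; apply: nz; exists x.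
  (* s is bounded below, since the slope of g is positive near l *)
  have [w Iw Hw] := gvan _ gx0_gt0.
  have [w0 Iw0 w0w] := inner_prev Iw.
  have w0x0 : w0 < x0.
    by rewrite ltNge; apply/negP => h; have := gnd x0 w0 Ix0 Iw0 h; have := Hw w0 Iw0 w0w; lra.
  have sw0 := sinc Iw0 Ix0 w0x0.
  have gw0 := Hw w0 Iw0 w0w.
  pose p := (g x0 - g w0) / (s x0 - s w0).
  have p0 : 0 < p by rewrite divr_gt0//; lra.
  have sb x : I x -> s w0 - g w0 / p <= s x.
    move=> Ix; have [xw|] := ltP x w0; last first.
      move=> /(scale_le sinc Iw0 Ix); apply: le_trans.
      by rewrite gerBl divr_ge0// ?ltW// gpos.
    have [c Hc] := lin x Ix.
    have h1 := Hc w0 Iw0 (ltW xw).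
    have h2 := Hc x0 Ix0 (ltW (lt_trans xw w0x0)).
    have pc : p = c.
      by rewrite /p h1 h2; field; lra.
    rewrite lerBlDr -lerBlDl ler_pdivlMr//; have := gpos x Ix; rewrite h1 pc; lra.
  pose A := [set s x | x in I].
  have hA : has_inf A by split; [exists (s x0), x0|exists (s w0 - g w0 / p) => _ [x Ix <-]; exact: sb].
  have tau_le x : I x -> inf A <= s x.
    by move=> Ix; apply: ge_inf; [exact: hA.2|exists x].
  have tau_lt x : I x -> inf A < s x.
    move=> Ix; have [x' Ix' x'x] := inner_prev Ix.
    by apply: (le_lt_trans (tau_le x' Ix')); exact: sinc.
  have [] := suff_tau (inf A).
  + exact: tau_lt.
  + by move=> x Ix; rewrite leNgt tau_lt.
  + move=> e x e0 Ix _.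
    have [_ [b Ib <-] sbe] := inf_adherent e0 hA.
    have [z Iz Hz] := gvan e e0.
    pose m := Num.min (Num.min b z) x.
    have Im : I m by rewrite /m /Num.min; repeat (case: ifP => _).
    have [a Ia am] := inner_prev Im.
    move: am; rewrite !lt_min => /andP[/andP[ab az] ax].
    exists a; split => //.
    * by rewrite tau_le//= (lt_trans (sinc Ia Ib ab)).
    * exact: Hz.
    * exact: lin.
  + move=> k k01 H; exists k, (inf A); split => //; right.
    rewrite -ereal_inf_EFin; [|exact: hA.2|exact: hA.1].
    by rewrite image_comp.
Qed.

End extremal_elements.

(** * The integral representation *)

Local Open Scope ereal_scope.

Section call.
Context {R : realType} {l r : \bar R} (s : R -> R).
Local Notation I := (inner_set l r).

Lemma extend_inner (y : R) : I y -> extend l r s y%:E = (s y)%:E.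
Proof. by move=> /andP[ly yr]; rewrite /extend (gt_eqF ly) (lt_eqF yr). Qed.

Lemma callE (x y : R) : I y -> call l r s x y%:E = (Num.max (s x - s y) 0)%:E.
Proof. by move=> Iy; rewrite /call extend_inner// -EFinB EFin_max. Qed.

Lemma measurable_call (x : R) : {within I, continuous s} ->
  measurable_fun `[l, r]%classic (call l r s x).
Proof.
move=> scont.
have itv_fin (y : \bar R) : `]l, r[%classic y -> exists2 z, y = z%:E & I z.
  by rewrite /= in_itv; exact: inner_fin.
have mD : measurable_fun `]l, r[%classic (call l r s x).
  have mf : measurable_fun `]l, r[%classic
      (fun y : \bar R => (Num.max (s x - s (fine y)) 0)%:E).
    apply/measurable_EFinP; apply: measurable_maxr => //; apply: measurable_funB => //.
    apply: (measurable_comp (measurable_inner l r)).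
    - by move=> _ [_ /itv_fin[z -> Iz] <-].
    - by apply: subspace_continuous_measurable_fun => //; exact: measurable_inner.
    - exact: measurable_funTS.
  by apply: eq_measurable_fun mf => _ /set_mem/itv_fin[z -> Iz]; rewrite callE.
have mi (i : interval (\bar R)) : measurable [set` i] by exact: emeasurable_itv.
rewrite (_ : `[l, r]%classic = `]l, r[%classic `|` (`[l, r]%classic `&` [set l; r])).
  apply/measurable_funU => //; first by apply: measurableI => //; exact: measurableU.
  split => //; rewrite setIUr; apply/measurable_funU; [exact: measurableI..|split];
    by apply: measurable_funS (@measurable_fun_set1 _ _ _ _ _ _) => // y [].
apply/seteqP; split => y; rewrite /= !in_itv/=.
  move=> /andP[ly yr]; have [E|yl] := eqVneq y l; first by right; rewrite ly yr; split => //; left.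
  have [E|yr'] := eqVneq y r; first by right; rewrite ly yr; split => //; right.
  by left; rewrite !lt_neqAle ly yr yr' eq_sym yl.
by move=> [/andP[ly yr]|[/andP[-> ->]]]; rewrite ?ltW.
Qed.

End call.

Section representation.
Context {R : realType} {l r : \bar R} (s g : R -> R) (C : R).
Local Notation I := (inner_set l r).
Hypothesis lr : l < r.
Hypothesis sinc : forall x y, I x -> I y -> (x < y)%R -> (s x < s y)%R.
Hypothesis scont : {within I, continuous s}.
Hypothesis cg : sconvex I s g.
Hypothesis g0 : forall x, I x -> (0 <= g x)%R.
Hypothesis gnd : nondecreasing_on I g.
Hypothesis lip : slipschitz I C s g.

Local Notation F := (@rslope R l r s g C).

Definition rslope_cumulative : cumulative R R :=
  HB.pack F (isCumulative.Build R _ R F (rslope_nondecreasing sinc lip lr)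
    (rslope_right_continuous sinc lip lr)).

(** The Stieltjes measure of dg/ds: the second derivative of g in scale. *)
Definition second_derivative : {measure set (measurableTypeR R) -> \bar R} :=
  lebesgue_stieltjes_measure rslope_cumulative.
Local Notation mu := second_derivative.

Lemma second_derivative_itv a b : (a <= b)%R -> mu `]a, b]%classic = (F b - F a)%:E.
Proof.
move=> ab; rewrite /mu/= /lebesgue_stieltjes_measure /measure_extension.
rewrite measurable_mu_extE/=; last exact: is_ocitv.
by rewrite wlength_itv_bnd.
Qed.

Let F_nd x y : (x <= y)%R -> (F x <= F y)%R.
Proof. exact: (rslope_nondecreasing sinc lip lr). Qed.

Lemma second_derivative_finite : mu setT < +oo.
Proof.
pose I_ n : set R := `](- n%:R)%R, n%:R%R]%classic.
have mI n : measurable (I_ n : set (measurableTypeR R)) by exact: measurable_itv.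
have UI : \bigcup_n I_ n = setT by rewrite -(bigcup_itvT false false).
have cv : mu (I_ n) @[n --> \oo] --> mu (\bigcup_n I_ n).
  apply: nondecreasing_cvg_mu => //; first exact: bigcup_measurable.
  by move=> m n mn; apply/subsetPset/subset_itv; rewrite leBSide/= ?lerN2 ler_nat.
rewrite -UI; apply: (@le_lt_trans _ _ (C + C)%:E); last exact: ltry.
apply: cvge_to_le cv _; apply: nearW => n.
rewrite /I_ second_derivative_itv; last by rewrite (@le_trans _ _ 0%R)// oppr_le0.
have /andP[h1 h2] := rslope_bound sinc lip lr n%:R%R.
have /andP[h3 h4] := rslope_bound sinc lip lr (- n%:R)%R.
by rewrite lee_fin; lra.
Qed.

Let le_s x y : I x -> I y -> (x <= y)%R -> (s x <= s y)%R.
Proof. exact: scale_le. Qed.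

Let mI : measurable (I : set (measurableTypeR R)).
Proof. exact: measurable_inner. Qed.

Let ms : measurable_fun I (s : measurableTypeR R -> R).
Proof. by apply: subspace_continuous_measurable_fun => //; exact: measurable_inner. Qed.

Let itv_sub x x' : I x -> I x' -> `]x, x']%classic `<=` I.
Proof.
move=> Ix Ix' y; rewrite /= in_itv/= => /andP[xy yx'].
by apply: (inner_between Ix Ix'); rewrite (ltW xy).
Qed.

Let mitv (x x' : R) : measurable (`]x, x']%classic : set (measurableTypeR R)).
Proof. exact: measurable_itv. Qed.

Let msub x D : D `<=` I -> measurable (D : set (measurableTypeR R)) ->
  measurable_fun D (fun y : measurableTypeR R => (s x - s y)%:E).
Proof.
move=> DI mD; apply/measurable_EFinP; apply: measurable_funB => //.
exact: measurable_funS ms.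
Qed.

Let h x x' := \int[mu]_(y in `]x, x']) (s x' - s y)%:E.

Let h_bounds x x' : I x -> I x' -> (x <= x')%R ->
  0 <= h x x' <= ((s x' - s x) * (F x' - F x))%:E.
Proof.
move=> Ix Ix' xx'; have sub := itv_sub Ix Ix'.
have pos y : `]x, x']%classic y -> (s y <= s x')%R /\ (s x <= s y)%R.
  move=> xy; have Iy := sub _ xy; move: xy; rewrite /= in_itv/= => /andP[xy yx'].
  by split; apply: le_s => //; exact: ltW.
apply/andP; split.
  by apply: integral_ge0 => y /pos[h1 h2]; rewrite lee_fin subr_ge0.
rewrite EFinM -second_derivative_itv// -integral_cst//.
apply: ge0_le_integral => //.
- by move=> y /pos[h1 h2]; rewrite lee_fin subr_ge0.
- exact: msub.
- by move=> y /pos[h1 h2]; rewrite lee_fin lerD2l lerN2.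
Qed.

Definition gap x x' := fine (h x x').

Let hE x x' : I x -> I x' -> (x <= x')%R -> h x x' = (gap x x')%:E.
Proof.
move=> Ix Ix' xx'; rewrite fineK// ge0_fin_numE; have /andP[h1 h2] := h_bounds Ix Ix' xx'.
  by apply: (le_lt_trans h2); rewrite ltry.
by [].
Qed.

Let gap_bounds x x' : I x -> I x' -> (x <= x')%R ->
  (0 <= gap x x' <= (s x' - s x) * (F x' - F x))%R.
Proof. by move=> Ix Ix' xx'; rewrite -!lee_fin -hE//; exact: h_bounds. Qed.

(** Splitting the remainder integral at x: on the left part the integrand grows by
the constant s x' - s x, and the measure of that part is the increment of F. *)
Let gapD x0 x x' : I x0 -> I x' -> (x0 <= x <= x')%R ->
  gap x0 x' = (gap x0 x + (s x' - s x) * (F x - F x0) + gap x x')%R.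
Proof.
move=> Ix0 Ix' /andP[x0x xx'].
have Ix : I x by apply: (inner_between Ix0 Ix'); rewrite x0x.
have x0x' := le_trans x0x xx'.
apply: EFin_inj; rewrite !EFinD -!hE// EFinM -second_derivative_itv//.
rewrite {1}/h (_ : `]x0, x']%classic = `]x0, x] `|` `]x, x']); last first.
  by apply: itv_bndbnd_setU; rewrite bnd_simp.
have pos x1 x2 y : I x1 -> I x2 -> `]x1, x2]%classic y -> (s y <= s x2)%R.
  move=> I1 I2 xy; have Iy := itv_sub I1 I2 xy.
  by move: xy; rewrite /= in_itv/= => /andP[_ ?]; exact: le_s.
rewrite ge0_integral_setU//; last 3 first.
- apply: msub; last exact: measurableU.
  by move=> y [] ; [exact: itv_sub|exact: itv_sub].
- move=> y [] xy; rewrite lee_fin subr_ge0; last exact: pos xy.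
  by apply: le_trans (le_s Ix Ix' xx'); exact: pos xy.
- apply/disj_setPS => y [] /=; rewrite !in_itv/= => /andP[_ yx] /andP[xy _].
  by have := lt_le_trans xy yx; rewrite ltxx.
congr (_ + _).
under eq_integral => y _.
  rewrite (_ : (s x' - s y)%:E = (s x - s y)%:E + (s x' - s x)%:E); last first.
    by rewrite -EFinD; congr (_%:E); ring.
  over.
rewrite ge0_integralD//.
- by rewrite integral_cst.
- by move=> y xy; rewrite lee_fin subr_ge0; exact: pos xy.
- by apply: msub => //; exact: itv_sub.
- by move=> y _; rewrite lee_fin subr_ge0 le_s.
Qed.

(** The error in the second-order Taylor formula between x and x'. It is additive over
intervals. The increment of g and the right-hand side of the formula both lie between
F x and F x' times the increment of s; the error is thus bounded by a product of two
increments, and vanishes after repeated subdivision. *)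
Let defect x x' := (g x' - g x - F x * (s x' - s x) - gap x x')%R.

Let defectD x0 x x' : I x0 -> I x' -> (x0 <= x <= x')%R ->
  defect x0 x' = (defect x0 x + defect x x')%R.
Proof. by move=> Ix0 Ix' xx; rewrite /defect (gapD Ix0 Ix' xx); ring. Qed.

Let defect_bound x x' : I x -> I x' -> (x < x')%R ->
  (`|defect x x'| <= (s x' - s x) * (F x' - F x))%R.
Proof.
move=> Ix Ix' xx'.
have := rslope_le_chord sinc scont lip lr Ix Ix' xx'.
have := slope_le_rslope sinc cg C lr Ix Ix' xx'.
rewrite (slope_leE sinc)// (slope_geE sinc)// => h1 h2.
have /andP[h3 h4] := gap_bounds Ix Ix' (ltW xx').
by rewrite /defect ler_norml; apply/andP; split; lra.
Qed.

(** Bisection at the midpoint in scale halves the increment of s and splits that of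
F, so that the bound is halved. *)
Let defect_bisect n x x' : I x -> I x' -> (x < x')%R ->
  (`|defect x x'| <= (s x' - s x) * (F x' - F x) / 2 ^+ n)%R.
Proof.
elim: n x x' => [|n IH] x x' Ix Ix' xx'; first by rewrite expr0 divr1 defect_bound.
have sxx' := sinc Ix Ix' xx'.
have [m [Im /andP[xm mx'] sm]] : exists m, [/\ I m, (x < m < x')%R & s m = ((s x + s x') / 2)%R].
  by apply: (scale_ivt sinc scont) => //; apply/andP; split; lra.
rewrite (@defectD x m x')// ?(ltW xm) ?(ltW mx')//.
apply: (le_trans (ler_normD _ _)).
have := IH x m Ix Im xm; have := IH m x' Im Ix' mx'.
rewrite sm exprS => h1 h2; apply: (le_trans (lerD h2 h1)).
have p0 : (0 < 2 ^+ n :> R)%R by rewrite exprn_gt0.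
set p := (2 ^+ n)%R in p0 *.
rewrite le_eqVlt; apply/orP; left; apply/eqP; field.
by rewrite gt_eqF.
Qed.

Let defect0 x x' : I x -> I x' -> (x < x')%R -> defect x x' = 0%R.
Proof.
move=> Ix Ix' xx'; apply/eqP; rewrite -normr_eq0; apply/eqP/le_anti.
rewrite normr_ge0 andbT; set K := ((s x' - s x) * (F x' - F x))%R.
have K0 : (0 <= K)%R.
  by rewrite mulr_ge0// subr_ge0 ?F_nd ?ltW// sinc.
apply/ler_addgt0Pr => e e0; rewrite add0r.
have cv : ((fun n => K / 2 ^+ n) @ \oo --> (0 : R))%R.
  rewrite -[X in _ --> X](mulr0 K); apply: cvgMr.
  under eq_fun do rewrite -exprVn.
  by apply: cvg_expr; rewrite ger0_norm; lra.
move/cvgrPdist_lt : cv => /(_ e e0)[n _ /(_ n (leqnn n))].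
rewrite sub0r normrN => Hn; apply: (le_trans (defect_bisect n Ix Ix' xx')).
by apply: ltW; apply: le_lt_trans Hn; rewrite ler_norm.
Qed.

Lemma taylor_scale x x' : I x -> I x' -> (x < x')%R ->
  \int[mu]_(y in `]x, x']) (s x' - s y)%:E =
  (g x' - g x - F x * (s x' - s x))%:E.
Proof.
move=> Ix Ix' xx'; rewrite -/(h x x') hE ?(ltW xx')//.
by have := defect0 Ix Ix' xx'; rewrite /defect => /subr0_eq ->.
Qed.

(** The derivative of g with respect to s at the left end. *)
Definition left_slope : R := inf [set F x | x in I].
Local Notation kappa := left_slope.

Let call_ge0 x y : 0 <= (Num.max (s x - s y) 0)%:E :> \bar R.
Proof. by rewrite lee_fin le_max lexx orbT. Qed.

Let mcall x D : D `<=` I -> measurable (D : set (measurableTypeR R)) ->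
  measurable_fun D (fun y : measurableTypeR R => (Num.max (s x - s y) 0)%:E).
Proof.
move=> DI mD; apply/measurable_EFinP; apply: measurable_maxr => //.
by apply/measurable_EFinP; exact: msub.
Qed.

Let mtail (x : R) : measurable ([set y | I y /\ (x < y)%R] : set (measurableTypeR R)).
Proof.
rewrite (_ : [set _ | _] = I `&` `]x, +oo[%classic).
  by apply: measurableI => //; exact: measurable_itv.
by apply/seteqP; split => y; rewrite /= in_itv/= andbT.
Qed.

Let integral_tail x1 x : I x1 -> I x -> (x1 < x)%R ->
  \int[mu]_(y in [set y | I y /\ (x1 < y)%R]) (Num.max (s x - s y) 0)%:E =
  (g x - g x1 - F x1 * (s x - s x1))%:E.
Proof.
move=> Ix1 Ix x1x; rewrite -(taylor_scale Ix1 Ix x1x).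
have -> : [set y | I y /\ (x1 < y)%R] = `]x1, x]%classic `|` [set y | I y /\ (x < y)%R].
  apply/seteqP; split => y /=; rewrite in_itv/=.
    move=> [Iy x1y]; have [yx|xy] := leP y x; [by left; rewrite x1y|by right].
  move=> [/andP[x1y yx]|[Iy xy]]; last by split => //; exact: lt_trans xy.
  by split => //; apply: (inner_between Ix1 Ix); rewrite (ltW x1y).
rewrite ge0_integral_setU//; last 2 first.
- apply: mcall; last by apply: measurableU => //; exact: mitv.
  by move=> y [/(itv_sub Ix1 Ix)//|[]].
- apply/disj_setPS => y [] /=; rewrite in_itv/= => /andP[_ yx] [_ xy].
  by have := lt_le_trans xy yx; rewrite ltxx.
rewrite [X in _ + X]integral0_eq ?adde0; last first.
  move=> y [Iy xy]; congr (_%:E); apply: max_r.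
  by rewrite subr_le0 le_s// ltW.
apply: eq_integral => y /set_mem xy; congr (_%:E); apply: max_l.
rewrite subr_ge0; apply: le_s => //; first exact: itv_sub xy.
by move: xy; rewrite /= in_itv/= => /andP[].
Qed.

Let kappa_le x : I x -> (kappa <= F x)%R.
Proof.
move=> Ix; apply: ge_inf; last by exists x.
by exists (- C)%R => _ [y Iy <-]; have /andP[] := rslope_bound sinc lip lr y.
Qed.

Let kappa_ge0 : (0 <= kappa)%R.
Proof.
have [x0 Ix0] := inner_nonempty lr.
apply: lb_le_inf; first by exists (F x0), x0.
move=> _ [y Iy <-]; have [w Iw wy] := inner_prev Iy.
apply: le_trans (slope_le_rslope sinc cg C lr Iw Iy wy).
by rewrite (slope_geE sinc)// mul0r subr_ge0; apply: gnd => //; exact: ltW.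
Qed.

Let kappa_chord x x' : I x -> I x' -> (x < x')%R ->
  (kappa * (s x' - s x) <= g x' - g x)%R.
Proof.
move=> Ix Ix' xx'; have := rslope_le_chord sinc scont lip lr Ix Ix' xx'.
rewrite (slope_geE sinc)//; apply: le_trans.
by rewrite ler_pM2r ?kappa_le// subr_gt0 sinc.
Qed.

Let inner_seq : exists u : nat -> R, [/\ forall n, I (u n),
  forall n m, (n <= m)%N -> (u m <= u n)%R &
  forall x, I x -> exists n, (u n < x)%R].
Proof.
have [c Ic] := inner_nonempty lr; have [lc cr] := andP Ic.
suff [u [u1 u2 u3]] : exists u : nat -> R, [/\ forall n, l < (u n)%:E /\ (u n <= c)%R,
    forall n m, (n <= m)%N -> (u m <= u n)%R &
    forall x : R, l < x%:E -> exists n, (u n < x)%R].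
  exists u; split => // [n|x /andP[lx _]]; last exact: u3.
  have [h1 h2] := u1 n; apply/andP; split => //.
  by apply: le_lt_trans cr; rewrite lee_fin.
move: lc; case: (l) => [a||] lc.
- rewrite lte_fin in lc.
  exists (fun n => a + (c - a) / n.+1%:R)%R; split.
  + move=> n; rewrite lte_fin ltrDl divr_gt0 ?subr_gt0//; split => //.
    by rewrite -lerBrDl ler_pdivrMr// ler_peMr ?subr_ge0 ?(ltW lc)// ler1n.
  + move=> n m nm; rewrite lerD2l ler_wpM2l ?subr_ge0 ?(ltW lc)//.
    by rewrite lef_pV2 ?posrE// ler_nat.
  + move=> x; rewrite lte_fin => ax.
    exists (Num.truncn ((c - a) / (x - a))).
    rewrite -ltrBrDl ltr_pdivrMr// mulrC -ltr_pdivrMr ?subr_gt0//.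
    exact: truncnS_gt.
- by move: lc; rewrite ltNge leey.
- exists (fun n => c - n%:R)%R; split.
  + by move=> n; rewrite ltNyr gerBl.
  + by move=> n m nm; rewrite lerD2l lerN2 ler_nat.
  + move=> x _; exists (Num.truncn (c - x)).+1.
    by have := truncnS_gt (c - x)%R; lra.
Qed.

Let total x := \int[mu]_(y in I) (Num.max (s x - s y) 0)%:E.

(** With total_le below, this replaces a limit in Taylor's formula as its base point
tends to l: the product of F - kappa with the increment of s there need not be
shown to vanish separately, even if s is unbounded. *)
Let total_ge x1 x : I x1 -> I x -> (x1 < x)%R ->
  (g x - g x1 - kappa * (s x - s x1))%:E <= total x.
Proof.
move=> Ix1 Ix x1x.
have sx : (0 < s x - s x1)%R by rewrite subr_gt0 sinc.
(* the tail integral from any x2 < x1 has the same bound with F x2 for kappa *)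
have tail x2 : I x2 -> (x2 < x1)%R -> (g x - g x1 - F x2 * (s x - s x1))%:E <= total x.
  move=> Ix2 x21; apply: (@le_trans _ _ (g x - g x2 - F x2 * (s x - s x2))%:E).
    have := rslope_le_chord sinc scont lip lr Ix2 Ix1 x21.
    by rewrite (slope_geE sinc)// lee_fin; lra.
  rewrite -integral_tail ?(lt_trans x21)//.
  by apply: ge0_subset_integral => //; [exact: mcall|move=> y []].
apply/lee_addgt0Pr => e e0.
have k1 : (0 < e / (s x - s x1))%R by rewrite divr_gt0.
have hA : has_inf [set F x | x in I].
  split; first by exists (F x), x.
  by exists (- C)%R => _ [y Iy <-]; have /andP[] := rslope_bound sinc lip lr y.
have [_ [x3 Ix3 <-] Fx3] := inf_adherent k1 hA.
have [x2 [Ix2 x21 x23]] : exists x2, [/\ I x2, (x2 < x1)%R & (x2 < x3)%R].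
  have Im : I (Num.min x1 x3) by rewrite /Num.min; case: ifP.
  by have [x2 Ix2] := inner_prev Im; rewrite lt_min => /andP[? ?]; exists x2.
apply: le_trans (leeD2r e%:E (tail x2 Ix2 x21)); rewrite -EFinD lee_fin.
have : (F x2 < kappa + e / (s x - s x1))%R by apply: le_lt_trans Fx3; apply: F_nd; exact: ltW.
rewrite -(ltr_pM2r sx) mulrDl divfK ?gt_eqF//; lra.
Qed.

Let total_le B x : I x ->
  (forall x1, I x1 -> (x1 < x)%R -> (g x - g x1 - F x1 * (s x - s x1))%:E <= B) ->
  total x <= B.
Proof.
move=> Ix HB; have [u [u1 u2 u3]] := inner_seq.
pose D n : set (measurableTypeR R) := [set y | I y /\ (u n < y)%R].
have cv := @ge0_nondecreasing_set_cvg_integral _ (measurableTypeR R) R D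
  (fun y => (Num.max (s x - s y) 0)%:E) mu.
have UD : \bigcup_n D n = I.
  apply/seteqP; split => y; first by move=> [n _ []].
  by move=> Iy; have [n un] := u3 y Iy; exists n.
rewrite /total -UD; apply: cvge_to_le (cv _ _ _ _) _.
- move=> n m nm; apply/subsetPset => y [Iy uy]; split => //.
  exact: le_lt_trans (u2 n m nm) uy.
- by move=> n; exact: mtail.
- by move=> n; apply: mcall; [move=> y []|exact: mtail].
- by [].
have [n0 un0] := u3 x Ix.
exists n0 => // n /= n0n; have unx := le_lt_trans (u2 _ _ n0n) un0.
by rewrite integral_tail//; exact: HB.
Qed.

Let extend_g : extend l r g l = (inf [set g x | x in I])%:E.
Proof.
have [x0 Ix0] := inner_nonempty lr.
rewrite (extend_left_nondecreasing lr gnd) -ereal_inf_EFin ?image_comp//.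
- by exists 0%R => _ [x Ix <-]; exact: g0.
- by exists (g x0), x0.
Qed.

Let extend_s : extend l r s l = ereal_inf [set (s x)%:E | x in I].
Proof. by rewrite (extend_left_nondecreasing lr). Qed.

(** A nondecreasing convex function that is bounded below on a half-line unbounded
to the left has slope 0 at infinity. *)
Let left_slope_eq0 : extend l r s l = -oo -> kappa = 0%R.
Proof.
rewrite extend_s => sl; apply/le_anti; rewrite kappa_ge0 andbT leNgt; apply/negP => k0.
have [x0 Ix0] := inner_nonempty lr.
have : ereal_inf [set (s x)%:E | x in I] < (s x0 - g x0 / kappa)%:E by rewrite sl ltNyr.
move=> /ereal_inf_ltP[_ [x Ix <-]]; rewrite lte_fin => sx.
have gk : (0 <= g x0 / kappa)%R by rewrite divr_ge0// ?g0// ltW.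
have xx0 : (x < x0)%R by apply: (scale_lt_inv sinc) => //; lra.
have h1 := kappa_chord Ix Ix0 xx0; have h2 := g0 Ix.
have : (g x0 / kappa < s x0 - s x)%R by lra.
by rewrite ltr_pdivrMr// mulrC; lra.
Qed.

Let total_eq x : I x -> (g x)%:E =
  extend l r g l + kappa%:E * ((s x)%:E - extend l r s l) + total x.
Proof.
move=> Ix.
have [x0 Ix0 x0x] := inner_prev Ix.
pose gam := inf [set g x | x in I].
have hg : has_inf [set g x | x in I].
  by split; [exists (g x), x|exists 0%R => _ [y Iy <-]; exact: g0].
have gam_le y : I y -> (gam <= g y)%R by move=> Iy; apply: ge_inf; [exact: hg.2|exists y].
(* m is s l if this is finite; otherwise kappa = 0 and any value will do *)
have [m [Em m_le]] : exists m : R,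
    kappa%:E * ((s x)%:E - extend l r s l) = (kappa * (s x - m))%:E /\
    (forall e, (0 < e)%R -> exists2 c, I c &
      forall y, I y -> (y <= c)%R -> (kappa * (m - s y) <= 0)%R /\ (kappa * (s y - m) <= e)%R).
  have k0 := kappa_ge0.
  have slx : extend l r s l < +oo.
    rewrite extend_s; apply: (@le_lt_trans _ _ (s x)%:E); last exact: ltry.
    by apply: ereal_inf_lbound; exists x.
  case E : (extend l r s l) slx => [m||]// _.
    exists m; split; first by rewrite -EFinM.
    have m_le y : I y -> (m <= s y)%R.
      by move=> Iy; rewrite -lee_fin -E extend_s; apply: ereal_inf_lbound; exists y.
    move=> e e0.
    have e1 : (0 < e / (kappa + 1))%R by rewrite divr_gt0//; lra.
    have : ereal_inf [set (s x)%:E | x in I] < (m + e / (kappa + 1))%:E.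
      by rewrite -extend_s E lte_fin; lra.
    move=> /ereal_inf_ltP[_ [c Ic <-]]; rewrite lte_fin => sc.
    exists c => // y Iy yc; have := m_le y Iy; have := le_s Iy Ic yc => h1 h2.
    split; first by nra.
    have : ((s y - m) * (kappa + 1) <= e)%R by rewrite -ler_pdivlMr; lra.
    nra.
  exists 0%R; rewrite (left_slope_eq0 E) mul0e mul0r; split => // e e0.
  by exists x => // y _ _; rewrite !mul0r lexx ltW.
rewrite extend_g Em -/gam.
have upper : total x <= (g x - gam - kappa * (s x - m))%:E.
  apply: total_le => // x1 Ix1 x1x; rewrite lee_fin; apply/ler_addgt0Pr => e e0.
  have [c Ic Hc] := m_le e e0.
  have [z [Iz zc zx1]] : exists z, [/\ I z, (z <= c)%R & (z < x1)%R].
    have Im : I (Num.min c x1) by rewrite /Num.min; case: ifP.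
    by have [z Iz] := inner_prev Im; rewrite lt_min => /andP[/ltW ? ?]; exists z.
  have [h1 h2] := Hc z Iz zc.
  have h3 := kappa_chord Iz Ix1 zx1; have h4 := gam_le z Iz.
  have h5 := kappa_le Ix1; have sx : (0 < s x - s x1)%R by rewrite subr_gt0 sinc.
  have h6 : (kappa * (s x - s x1) <= F x1 * (s x - s x1))%R by rewrite ler_pM2r.
  lra.
have lower : (g x - gam - kappa * (s x - m))%:E <= total x.
  apply/lee_addgt0Pr => e e0.
  have e20 : (0 < e / 2)%R by rewrite divr_gt0.
  have [_ [z Iz <-] gz] := inf_adherent e20 hg.
  have [c Ic Hc] := m_le _ e20.
  have Im : I (Num.min (Num.min c x) z) by rewrite /Num.min; repeat (case: ifP => _).
  have [x1 Ix1] := inner_prev Im; rewrite !lt_min => /andP[/andP[x1c x1x] x1z].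
  apply: le_trans (leeD2r e%:E (total_ge Ix1 Ix x1x)); rewrite -EFinD lee_fin.
  have [h1 h2] := Hc x1 Ix1 (ltW x1c).
  have h3 := gnd Ix1 Iz (ltW x1z).
  rewrite -/gam in gz; lra.
have -> : total x = (g x - gam - kappa * (s x - m))%:E by apply/le_anti; rewrite upper lower.
by rewrite -!EFinD; congr (_%:E); ring.
Qed.

(** The measure is the second derivative of g carried by (l, r), seen as a measure on
the extended reals; the formula is Taylor's formula based at l. *)
Theorem nondecreasing_representation :
  exists (kap : R) (nu : {finite_measure set (\bar R) -> \bar R}),
    [/\ nu (~` `[l, r]%classic) = 0,
        nu [set l; r] = 0,
        (extend l r s l = -oo -> kap = 0%R) &
        forall x : R, I x ->
          (g x)%:E = extend l r g l + kap%:E * ((s x)%:E - extend l r s l)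
            + \int[nu]_(y in `[l, r]%classic) call l r s x y].
Proof.
pose D : set (\bar R) := `]l, r[%classic.
have mD : measurable D by exact: emeasurable_itv.
have mE : measurable_fun setT (EFin : measurableTypeR R -> \bar R) by exact: EFin_measurable.
pose pmu_ : {measure set (\bar R) -> \bar R} :=
  pushforward mu (EFin : measurableTypeR R -> \bar R).
pose pmu := pmu_ mE.
have preD : (EFin : measurableTypeR R -> \bar R) @^-1` D = I.
  by apply/seteqP; split => y; rewrite /D/= in_itv.
have finD : pmu D < +oo.
  have -> : pmu D = mu I by rewrite -preD.
  by apply: le_lt_trans second_derivative_finite; apply: le_measure; rewrite ?inE.
pose nu : {finite_measure set (\bar R) -> \bar R} := mfrestr mD finD.
have nuD A : measurable A -> A `<=` D -> nu A = pmu A.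
  by move=> mA AD; rewrite /nu/= /mfrestr /mrestr setIidl.
have nu0 A : A `&` D = set0 -> nu A = 0.
  by move=> AD; rewrite /nu/= /mfrestr /mrestr AD measure0.
have ends0 : nu [set l; r] = 0.
  apply: nu0; apply/seteqP; split => // y [[->|->]]; rewrite /D/= in_itv/= ltxx ?andbF//.
have DE : `[l, r]%classic `\` [set l; r] = D.
  apply/seteqP; split => y; rewrite /D/= !in_itv/=.
    by move=> [/andP[ly yr] /not_orP[/eqP yl /eqP yr']]; rewrite !lt_neqAle ly yr eq_sym yl yr'.
  move=> /andP[ly yr]; rewrite !ltW//; split => // -[E|E].
    by move: ly; rewrite E ltxx.
  by move: yr; rewrite E ltxx.
have call0 x y : 0 <= call l r s x y by rewrite /call le_max lexx orbT.
exists kappa, nu; split => //.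
- apply: nu0; apply/seteqP; split => // y [ny]; rewrite /D/= in_itv/= => /andP[ly yr].
  by apply: ny; rewrite /= in_itv/= !ltW.
- move=> x Ix; rewrite [LHS](total_eq Ix); congr (_ + _).
  have mends : measurable ([set l; r] : set (\bar R)) by exact: measurableU.
  have mcl := @measurable_call R l r s x scont.
  rewrite (ge0_negligible_integral mends _ mcl _ ends0)//; last exact: emeasurable_itv.
  rewrite DE (eq_measure_integral pmu)//.
  rewrite (ge0_integral_pushforward mE)//; last first.
    by apply: measurable_funS mcl; [exact: emeasurable_itv|rewrite -DE; exact: subDsetl].
  by rewrite preD; apply: eq_integral => y /set_mem Iy; rewrite /= callE.
Qed.

End representation.

(** * Call functions and reflection *)

Section extremal_calls.
Context {R : realType} {l r : \bar R} (s : R -> R).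
Local Notation I := (inner_set l r).
Hypothesis lr : l < r.
Hypothesis sinc : forall x y, I x -> I y -> (x < y)%R -> (s x < s y)%R.
Hypothesis scont : {within I, continuous s}.

Let extend_s : extend l r s l = ereal_inf [set (s x)%:E | x in I].
Proof. by rewrite (extend_left_nondecreasing lr)// => x y Ix Iy; exact: (scale_le sinc). Qed.

Let extend_lt_pinfty : extend l r s l < +oo.
Proof.
rewrite extend_s; have [x Ix] := inner_nonempty lr.
by apply: (@le_lt_trans _ _ (s x)%:E); [apply: ereal_inf_lbound; exists x|exact: ltry].
Qed.

Lemma kink_inner y : I y -> kink l r s (s y).
Proof.
move=> Iy; split; last by have [x Ix yx] := inner_next Iy; exists x => //; exact: sinc.
by move=> e e0; exists y => //; rewrite lexx ltrDl.
Qed.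

Lemma kink_end tau : extend l r s l = tau%:E -> kink l r s tau.
Proof.
move=> E.
have tau_le x : I x -> (tau <= s x)%R.
  by move=> Ix; rewrite -lee_fin -E extend_s; apply: ereal_inf_lbound; exists x.
split.
  move=> e e0; have : ereal_inf [set (s x)%:E | x in I] < (tau + e)%:E.
    by rewrite -extend_s E lte_fin ltrDl.
  by move=> /ereal_inf_ltP[_ [a Ia <-]]; rewrite lte_fin => ae; exists a => //; rewrite tau_le.
have [x Ix] := inner_nonempty lr; have [x' Ix' x'x] := inner_prev Ix.
by exists x => //; apply: (le_lt_trans (tau_le _ Ix')); exact: sinc.
Qed.

Lemma call_end (tau x : R) : extend l r s l = tau%:E ->
  call l r s x l = (Num.max (s x - tau) 0)%:E.
Proof. by move=> E; rewrite /call E -EFinB EFin_max. Qed.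

Lemma extremal_Kplus_infinite : extend l r s l = -oo ->
  extremal I (Kplus l r s) = calls l r s `]l, r[%classic.
Proof.
move=> E; apply/seteqP; split => g.
  move=> /(extremal_ramp lr sinc scont)[k [tau [k01 [[y Iy ->]|]]]]; last first.
    by rewrite -extend_s E.
  move=> gE; exists k, y%:E; split => //.
  by move=> x Ix; rewrite callE// -EFinM gE.
move=> [k [y [k01 + gE]]]; rewrite /= in_itv => /inner_fin[z yz Iz].
apply: (ramp_extremal sinc k01 (kink_inner Iz)) => x Ix.
by apply: EFin_inj; rewrite gE// yz callE.
Qed.

Lemma extremal_Kplus_finite : -oo < extend l r s l ->
  extremal I (Kplus l r s) = calls l r s `[l, r[%classic.
Proof.
move=> E; have {E}[tau E] : exists tau, extend l r s l = tau%:E.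
  by move: E extend_lt_pinfty; case: extend => [tau _ _||]; first by exists tau.
apply/seteqP; split => g.
  move=> /(extremal_ramp lr sinc scont)[k [tau' [k01 [[y Iy ->]|]]]].
    move=> gE; exists k, y%:E; split => //.
      by have /andP[ly yr] := Iy; rewrite /= in_itv/= yr ltW.
    by move=> x Ix; rewrite callE// -EFinM gE.
  rewrite -extend_s E => -[->] gE; exists k, l; split => //.
    by rewrite /= in_itv/= lexx.
  by move=> x Ix; rewrite (call_end _ E) -EFinM gE.
move=> [k [y [k01 ylr gE]]]; have [yl|yl] := eqVneq y l.
  apply: (ramp_extremal sinc k01 (kink_end E)) => x Ix.
  by apply: EFin_inj; rewrite gE// yl (call_end _ E).
have /inner_fin[z yz Iz] : l < y < r.
  by move: ylr; rewrite /= in_itv/= => /andP[ly ->]; rewrite lt_neqAle eq_sym yl ly.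
apply: (ramp_extremal sinc k01 (kink_inner Iz)) => x Ix.
by apply: EFin_inj; rewrite gE// yz callE.
Qed.

End extremal_calls.

Section reflection.
Context {R : realType}.
Implicit Types (l r : \bar R) (s g f : R -> R).

(** The reflection x -> -x exchanges the two ends. The scale function also changes
sign, to remain increasing. *)
Definition mirror f : R -> R := fun x => f (- x)%R.
Definition mirror_scale s : R -> R := fun x => (- s (- x))%R.

Lemma mirrorK f : mirror (mirror f) = f.
Proof. by apply/funext => x; rewrite /mirror opprK. Qed.

Lemma mirror_scaleK s : mirror_scale (mirror_scale s) = s.
Proof. by apply/funext => x; rewrite /mirror_scale !opprK. Qed.

Lemma inner_mirror l r x : inner_set (- r) (- l) x <-> inner_set l r (- x)%R.
Proof. by rewrite /inner_set/= EFinN lteNl lteNr andbC. Qed.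

Lemma inner_mirrorN l r x : inner_set (- r) (- l) (- x)%R <-> inner_set l r x.
Proof. by rewrite inner_mirror opprK. Qed.

Lemma mirror_scale_increasing l r s :
  (forall x y, inner_set l r x -> inner_set l r y -> (x < y)%R -> (s x < s y)%R) ->
  forall x y, inner_set (- r) (- l) x -> inner_set (- r) (- l) y -> (x < y)%R ->
    (mirror_scale s x < mirror_scale s y)%R.
Proof.
move=> sinc x y /inner_mirror Ix /inner_mirror Iy xy.
by rewrite ltrN2; apply: sinc => //; rewrite ltrN2.
Qed.

Lemma mirror_scale_continuous l r s : {within inner_set l r, continuous s} ->
  {within inner_set (- r) (- l), continuous (mirror_scale s)}.
Proof.
move=> scont; rewrite continuous_open_subspace; last exact: open_inner.
move=> x /set_mem /inner_mirror Ix.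
apply: (@continuousN _ R^o); apply: continuous_comp; first exact: opp_continuous.
move: scont; rewrite continuous_open_subspace; last exact: open_inner.
by move=> /(_ (- x)%R); apply; exact/mem_set.
Qed.

Lemma sconvex_mirror l r s g : sconvex (inner_set l r) s g ->
  sconvex (inner_set (- r) (- l)) (mirror_scale s) (mirror g).
Proof.
move=> cg a x b /inner_mirror Ia /inner_mirror Ib /andP[ax xb].
have := cg (- b)%R (- x)%R (- a)%R Ib Ia; rewrite !ltrN2 ax xb => /(_ isT).
by rewrite /mirror /mirror_scale; lra.
Qed.

Lemma nonincreasing_mirror l r g : nonincreasing_on (inner_set l r) g <->
  nondecreasing_on (inner_set (- r) (- l)) (mirror g).
Proof.
split => ng x y.
  by move=> /inner_mirror Ix /inner_mirror Iy xy; apply: ng => //; rewrite lerN2.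
move=> Ix Iy xy; have := ng (- y)%R (- x)%R.
by rewrite /mirror !opprK lerN2; apply => //; exact/inner_mirrorN.
Qed.

Lemma slipschitz_mirror l r C s g : slipschitz (inner_set l r) C s g ->
  slipschitz (inner_set (- r) (- l)) C (mirror_scale s) (mirror g).
Proof.
move=> lip x y /inner_mirror Ix /inner_mirror Iy xy.
have := lip (- y)%R (- x)%R Iy Ix; rewrite ltrN2 => /(_ xy).
by rewrite distrC /mirror /mirror_scale opprK [(- _ + _)%R]addrC.
Qed.

Lemma at_right_end_mirror l r : at_end l r r = -%E @ at_end (- r) (- l) (- r).
Proof.
apply/seteqP; split => P; rewrite /at_end /= nbhs_filterE.
  rewrite /within/= => H.
  have : \forall z \near nbhs (- r), `]l, r[%classic (- z) -> P (- z).
    have := @oppe_continuous R (- r) (fun z => `]l, r[%classic z -> P z).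
    by rewrite oppeK; apply.
  apply: filterS => z HP; rewrite /= in_itv/= => zr; apply: HP.
  by rewrite /= in_itv/= lteNl lteNr andbC.
rewrite /within/= => H.
have : \forall z \near nbhs r, `]- r, - l[%classic (- z) -> P (- - z).
  exact: (@oppe_continuous R r (fun z => `]- r, - l[%classic z -> P (- z))).
apply: filterS => z; rewrite oppeK => HP; rewrite /= in_itv/= => zr; apply: HP.
by rewrite /= in_itv/= lteN2 lteN2 andbC.
Qed.

Lemma cvg_right_end_mirror l r g (a : R) :
  (g (fine z) @[z --> at_end l r r] --> a)%R <->
  (mirror g (fine z) @[z --> at_end (- r) (- l) (- r)] --> a)%R.
Proof.
rewrite at_right_end_mirror.
have -> : (fun z : \bar R => mirror g (fine z)) = (fun z => g (fine z)) \o -%E.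
  by apply/funext => z; rewrite /= fineN.
by [].
Qed.

Lemma extend_right_mirror l r g : extend l r g r = extend (- r) (- l) (mirror g) (- r).
Proof.
rewrite /extend !eqxx !orbT/= at_right_end_mirror.
congr (lim _).
have -> : (fun z : \bar R => (mirror g (fine z))%:E) = (fun z => (g (fine z))%:E) \o -%E.
  by apply/funext => z; rewrite /= fineN.
by [].
Qed.

Let extend_mirror_right l r s : l < r ->
  (forall x y, inner_set l r x -> inner_set l r y -> (x < y)%R -> (s x < s y)%R) ->
  extend (- r) (- l) (mirror_scale s) (- r) = - extend l r s r.
Proof.
move=> lr sinc; have lr' : - r < - l by rewrite lteN2.
rewrite extend_right_mirror.
have nd : nondecreasing_on (inner_set (- r) (- l)) (mirror_scale s).
  by move=> x y Ix Iy; exact: (scale_le (mirror_scale_increasing sinc) Ix Iy).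
have cv := cvg_left_end lr' nd.
have pf := at_left_end_proper lr'.
rewrite /extend eqxx/= (cvg_lim _ cv)//.
have -> : (fun z : \bar R => (mirror s (fine z))%:E) =
    (fun z => - (mirror_scale s (fine z))%:E).
  by apply/funext => z; rewrite /mirror_scale /mirror EFinN oppeK.
by rewrite (cvg_lim _ (cvgeN cv))// oppeK.
Qed.

Lemma extend_mirror_scale l r s y : l < r ->
  (forall x y, inner_set l r x -> inner_set l r y -> (x < y)%R -> (s x < s y)%R) ->
  extend (- r) (- l) (mirror_scale s) (- y) = - extend l r s y.
Proof.
move=> lr sinc.
have [->|yr] := eqVneq y r; first exact: extend_mirror_right.
have [->|yl] := eqVneq y l.
  have := @extend_mirror_right (- r) (- l) (mirror_scale s).
  rewrite lteN2 => /(_ lr (mirror_scale_increasing sinc)).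
  by rewrite !oppeK mirror_scaleK => ->; rewrite oppeK.
rewrite /extend !eqe_opp (negbTE yr) (negbTE yl)/= fineN.
by rewrite /mirror_scale opprK EFinN.
Qed.

Lemma put_mirror l r s (x : R) y : l < r ->
  (forall x y, inner_set l r x -> inner_set l r y -> (x < y)%R -> (s x < s y)%R) ->
  put l r s x y = call (- r) (- l) (mirror_scale s) (- x)%R (- y).
Proof.
move=> lr sinc; rewrite /put /call extend_mirror_scale//.
by rewrite /mirror_scale opprK EFinN oppeK addeC.
Qed.

Lemma left_sderiv_mirror l r s g x :
  (forall x y, inner_set l r x -> inner_set l r y -> (x < y)%R -> (s x < s y)%R) ->
  sconvex (inner_set l r) s g -> inner_set l r x ->
  left_sderiv s g x = (- right_sderiv (mirror_scale s) (mirror g) (- x))%R.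
Proof.
move=> sinc cg Ix.
have cv := right_slope_cvg (mirror_scale_increasing sinc) (sconvex_mirror cg)
  ((inner_mirrorN l r x).2 Ix).
rewrite /left_sderiv /right_sderiv.
have -> : (fun y => (g y - g x) / (s y - s x))%R @ x^'- =
    (fun z => - slope (mirror_scale s) (mirror g) (- x) z)%R @ (- x)%R^'+.
  have -> : x^'- = -%R @ (- x)%R^'+ by rewrite -at_leftN opprK.
  have -> : (fun z => - slope (mirror_scale s) (mirror g) (- x) z)%R =
      (fun y => (g y - g x) / (s y - s x))%R \o -%R.
    apply/funext => z; rewrite /slope /mirror /mirror_scale /= !opprK.
    by rewrite [(- s (- z) + s x)%R]addrC -[(s x - _)%R]opprB invrN mulrN opprK.
  by [].
by apply: cvg_lim => //; apply: cvgN.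
Qed.

End reflection.

(** * The classes of the theorem *)

Section classes.
Context {R : realType} {l r : \bar R} {d : measure_display}
  {Omega : measurableType d} (X : diffusion l r Omega) (s : R -> R).
Local Notation I := (inner_set l r).
Hypothesis lr : l < r.
Hypothesis hs : is_scale_function X s.

Let sinc : forall x y, I x -> I y -> (x < y)%R -> (s x < s y)%R.
Proof. exact: scale_increasing hs. Qed.

Let scont : {within I, continuous s}.
Proof. exact: Defs.scale_continuous hs. Qed.

Let lr' : - r < - l. Proof. by rewrite lteN2. Qed.
Let sinc' := mirror_scale_increasing sinc.
Let scont' := mirror_scale_continuous scont.

Lemma slipschitz_continuous C g : slipschitz I C s g -> {within I, continuous g}.
Proof.
move=> lip; apply/subspace_continuousP => x Ix; apply/cvgrPdist_lt => e e0.
move: scont => /subspace_continuousP/(_ x Ix)/cvgrPdist_lt.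
have K0 : (0 < `|C| + 1)%R by rewrite ltr_wpDl.
move=> /(_ (e / (`|C| + 1)))%R; rewrite divr_gt0// => /(_ isT).
rewrite !near_withinE; apply: filterS => y H Iy.
have le (u v : R) : I u -> I v -> (u < v)%R -> (`|g u - g v| <= `|C| * `|s u - s v|)%R.
  move=> Iu Iv uv; rewrite distrC; apply: (le_trans (lip u v Iu Iv uv)).
  rewrite distrC [X in (_ <= _ * X)%R]gtr0_norm ?subr_gt0 ?sinc//.
  by rewrite ler_pM2r ?subr_gt0 ?sinc// ler_norm.
have : (`|g x - g y| <= `|C| * `|s x - s y|)%R.
  have [xy|yx|->] := ltgtP x y; first exact: le.
    by rewrite distrC [X in (_ <= _ * X)%R]distrC; exact: le.
  by rewrite !subrr normr0 mulr0.
move=> /le_lt_trans; apply.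
have := H Iy; rewrite ltr_pdivlMr// => h.
by have := normr_ge0 (s x - s y)%R; lra.
Qed.

Lemma slipschitz_subharmonic C g : sconvex I s g -> slipschitz I C s g ->
  (forall x, I x -> (0 <= g x)%R) -> nneg_subharmonic X g.
Proof.
move=> cg lip g0; split => //; apply: (sconvex_subharmonic hs) => //.
- apply: subspace_continuous_measurable_fun; first exact: measurable_inner.
  exact: slipschitz_continuous lip.
- move=> a b Ia Ib; exists (g a + `|C| * `|s b - s a|)%R => y ayb.
  have Iy := inner_between Ia Ib ayb; have [ay yb] := andP ayb.
  move: ay; rewrite le_eqVlt => /predU1P[->|ay]; first by rewrite lerDl mulr_ge0.
  rewrite -lerBlDl; apply: le_trans (ler_norm _) _; apply: (le_trans (lip a y Ia Iy ay)).
  have say := sinc Ia Iy ay; have syb := scale_le sinc Iy Ib yb.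
  rewrite [X in (_ <= _ * X)%R]ger0_norm; last lra.
  apply: (@le_trans _ _ (`|C| * (s y - s a))%R).
    by rewrite ler_pM2r ?subr_gt0// ler_norm.
  by rewrite ler_wpM2l//; lra.
- move=> y Iy; exists (rslope s g (l:=l) (r:=r) C y) => z Iz.
  exact: (rslope_support sinc scont cg lip lr).
Qed.

Lemma K0plusE : K0plus X s = Kplus l r s.
Proof.
apply/seteqP; split => g.
  move=> [Sg vg ng dg]; have cg := subharmonic_sconvex hs Sg.
  have g0 := Sg.2.
  split => //.
  - by move=> x y Ix Iy xy; have := (right_sderiv_le sinc cg 1%R).1 dg x y Ix Iy xy; rewrite mul1r.
  - move=> e e0; have [c Ic Hc] := (cvg_left_endP lr g 0).1 vg e e0.
    exists c => // x Ix xc; have := Hc x Ix xc; rewrite sub0r normrN.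
    by rewrite ger0_norm ?g0.
move=> Kg; have [cg g0 ng lg vg] := Kg; split => //.
- exact: (slipschitz_subharmonic cg (Kplus_lipschitz Kg)).
- apply/(cvg_left_endP lr) => e e0; have [c Ic Hc] := vg e e0; exists c => // x Ix xc.
  by rewrite sub0r normrN ger0_norm ?g0// Hc.
- by apply/(right_sderiv_le sinc cg) => x y Ix Iy xy; rewrite mul1r lg.
Qed.

Lemma left_sderiv_ge C g : sconvex I s g ->
  (forall x, I x -> (- C <= left_sderiv s g x)%R) <->
  (forall x, inner_set (- r) (- l) x ->
    (right_sderiv (mirror_scale s) (mirror g) x <= C)%R).
Proof.
move=> cg; split => H x Ix.
  have := H (- x)%R; rewrite (left_sderiv_mirror sinc cg) ?opprK ?lerN2.
    by apply; exact/inner_mirror.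
  exact/inner_mirror.
rewrite (left_sderiv_mirror sinc cg)// lerN2; apply: H; exact/inner_mirrorN.
Qed.

Lemma sconvex_mirrorE g : sconvex (inner_set (- r) (- l)) (mirror_scale s) (mirror g) ->
  sconvex I s g.
Proof. by move=> /sconvex_mirror; rewrite !oppeK mirrorK mirror_scaleK. Qed.

Lemma K0minusE g : K0minus X s g <-> Kplus (- r) (- l) (mirror_scale s) (mirror g).
Proof.
split.
  move=> [Sg vg ng dg]; have cg := subharmonic_sconvex hs Sg.
  have g0 := Sg.2.
  have g0' x : inner_set (- r) (- l) x -> (0 <= mirror g x)%R.
    by move=> /inner_mirror Ix; exact: g0.
  split => //.
  - exact: sconvex_mirror.
  - exact/nonincreasing_mirror.
  - move=> x y Ix Iy xy.
    have h := (left_sderiv_ge 1%R cg).1 dg.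
    by have := (right_sderiv_le sinc' (sconvex_mirror cg) 1%R).1 h x y Ix Iy xy; rewrite mul1r.
  - move=> e e0; move/cvg_right_end_mirror : vg => /(cvg_left_endP lr')/(_ e e0)[c Ic Hc].
    exists c => // x Ix xc; have := Hc x Ix xc; rewrite sub0r normrN.
    by rewrite ger0_norm ?g0'.
move=> Kg; have [cg' g0' ng lg vg] := Kg; have cg := sconvex_mirrorE cg'.
have g0 x : I x -> (0 <= g x)%R.
  by move=> /inner_mirrorN Ix; have := g0' _ Ix; rewrite /mirror opprK.
split => //.
- apply: (slipschitz_subharmonic (C := 1%R) cg) => //.
  have := slipschitz_mirror (Kplus_lipschitz Kg).
  by rewrite !oppeK mirrorK mirror_scaleK.
- apply/cvg_right_end_mirror/(cvg_left_endP lr') => e e0.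
  have [c Ic Hc] := vg e e0; exists c => // x Ix xc.
  by rewrite sub0r normrN ger0_norm ?g0'// Hc.
- exact/nonincreasing_mirror.
- apply/(left_sderiv_ge 1%R cg)/(right_sderiv_le sinc' cg') => x y Ix Iy xy.
  by rewrite mul1r lg.
Qed.

Lemma extremal_K0minus g : extremal I (K0minus X s) g <->
  extremal (inner_set (- r) (- l)) (Kplus (- r) (- l) (mirror_scale s)) (mirror g).
Proof.
split => -[Kg [x [Ix gx]] ext]; split; first exact/K0minusE.
- by exists (- x)%R; rewrite /mirror opprK; split => //; exact/inner_mirrorN.
- move=> g1 g2 K1 K2 g12.
  have [||x' Ix'|k1 [k2 [H1 H2]]] := ext (mirror g1) (mirror g2).
  + by apply/K0minusE; rewrite mirrorK.
  + by apply/K0minusE; rewrite mirrorK.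
  + by have := g12 _ ((inner_mirrorN l r x').2 Ix'); rewrite /mirror opprK.
  + exists k1, k2; split => y /inner_mirror Iy.
      by have := H1 _ Iy; rewrite /mirror opprK.
    by have := H2 _ Iy; rewrite /mirror opprK.
- exact/K0minusE.
- by exists (- x)%R; split => //; exact/inner_mirror.
- move=> g1 g2 K1 K2 g12.
  have [||x' Ix'|k1 [k2 [H1 H2]]] := ext (mirror g1) (mirror g2).
  + exact/K0minusE.
  + exact/K0minusE.
  + by rewrite /mirror -g12 //; exact/inner_mirror.
  + exists k1, k2; split => y Iy; have Iy' := (inner_mirrorN l r y).2 Iy.
      by have := H1 _ Iy'; rewrite /mirror opprK.
    by have := H2 _ Iy'; rewrite /mirror opprK.
Qed.

Lemma puts_mirror (D D' : set (\bar R)) g : (forall y, D y <-> D' (- y)) ->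
  puts l r s D g <-> calls (- r) (- l) (mirror_scale s) D' (mirror g).
Proof.
move=> DD'; split => -[k [y [k01 Dy gE]]]; exists k, (- y); split => //.
- exact/DD'.
- by move=> x /inner_mirror Ix; rewrite gE// (put_mirror _ _ lr sinc) opprK.
- by apply/DD'; rewrite oppeK.
- move=> x Ix; rewrite (put_mirror _ _ lr sinc) oppeK -gE ?inner_mirrorN//.
  by rewrite /mirror opprK.
Qed.

Lemma measurable_put (x : R) : measurable_fun `[l, r]%classic (put l r s x).
Proof.
have -> : put l r s x = call (- r) (- l) (mirror_scale s) (- x)%R \o -%E.
  by apply/funext => y; rewrite (put_mirror _ _ lr sinc).
apply: (measurable_comp (_ : measurable `[- r, - l]%classic)).
- exact: emeasurable_itv.
- by move=> _ [y + <-]; rewrite /= !in_itv/= !leeN2 andbC.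
- exact: measurable_call.
- by apply: measurable_funTS; exact: oppe_measurable.
Qed.

Lemma nonincreasing_representation C g : sconvex I s g -> slipschitz I C s g ->
  (forall x, I x -> (0 <= g x)%R) -> nonincreasing_on I g ->
  exists (kappa : R) (mu : {finite_measure set (\bar R) -> \bar R}),
    [/\ mu (~` `[l, r]%classic) = 0,
        mu [set l; r] = 0,
        (extend l r s r = +oo -> kappa = 0%R) &
        forall x : R, I x ->
          (g x)%:E = extend l r g r
            + kappa%:E * (extend l r s r - (s x)%:E)
            + \int[mu]_(y in `[l, r]%classic) put l r s x y].
Proof.
move=> cg lip g0 ng.
have g0' x : inner_set (- r) (- l) x -> (0 <= mirror g x)%R.
  by move=> /inner_mirror Ix; exact: g0.
have [kappa [nu [nu1 nu2 nu3 nu4]]] := nondecreasing_representation lr' sinc' scont'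
  (sconvex_mirror cg) g0' ((nonincreasing_mirror l r g).1 ng) (slipschitz_mirror lip).
have mN : measurable_fun setT (-%E : \bar R -> \bar R) by exact: oppe_measurable.
pose pnu_ : {measure set (\bar R) -> \bar R} := pushforward nu (-%E : \bar R -> \bar R).
pose pnu := pnu_ mN.
have fin : pnu setT < +oo.
  have -> : pnu setT = nu setT by [].
  by rewrite ltey_eq fin_num_measure.
pose mu : {finite_measure set (\bar R) -> \bar R} := mfrestr (@measurableT _ (\bar R)) fin.
have muE A : mu A = nu (-%E @^-1` A).
  by rewrite /mu/= /mfrestr /mrestr setIT.
have ext_s y := @extend_mirror_scale _ l r s y lr sinc.
exists kappa, mu; split.
- rewrite muE -nu1; congr (nu _).
  by apply/seteqP; split => y /=; rewrite !in_itv/= leeNl leeNr andbC.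
- rewrite muE -nu2; congr (nu _); apply/seteqP; split => y /=.
    by move=> [<-|<-]; rewrite oppeK; [right|left].
  by move=> [->|->]; rewrite oppeK; [right|left].
- by move=> E; apply: nu3; rewrite ext_s E.
- move=> x Ix; have := nu4 _ ((inner_mirrorN l r x).2 Ix).
  rewrite /(mirror g _) opprK => ->; rewrite -extend_right_mirror ext_s oppeK.
  congr (_ + _ * _ + _).
    by rewrite /mirror_scale opprK EFinN addeC.
  rewrite (eq_measure_integral pnu (fun A _ _ => muE A)).
  rewrite (ge0_integral_pushforward mN)//.
  + have -> : -%E @^-1` `[l, r] = `[- r, - l]%classic.
      by apply/seteqP; split => y /=; rewrite !in_itv/= leeNl leeNr andbC.
    by apply: eq_integral => y _; rewrite /= (put_mirror _ _ lr sinc) oppeK.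
  + exact: emeasurable_itv.
  + exact: measurable_put.
  + by move=> y _; rewrite /put le_max lexx orbT.
Qed.

End classes.

Theorem theorem3p1 (R : realType) (l r : \bar R) (lr : l < r)
    (d : measure_display) (Omega : measurableType d)
    (X : diffusion l r Omega) (s : R -> R) (hs : is_scale_function X s) :
  [/\ (extend l r s l = -oo ->
        extremal (inner_set l r) (K0plus X s) = calls l r s `]l, r[%classic),
      (-oo < extend l r s l ->
        extremal (inner_set l r) (K0plus X s) = calls l r s `[l, r[%classic) &
      forall g : R -> R, nneg_subharmonic X g ->
        nonconstant_on (inner_set l r) g ->
        nondecreasing_on (inner_set l r) g ->
        bounded_fun_on (inner_set l r) (right_sderiv s g) ->
        exists (kappa : R) (mu : {finite_measure set (\bar R) -> \bar R}),
          [/\ mu (~` `[l, r]%classic) = 0,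
              mu [set l; r] = 0,
              (extend l r s l = -oo -> kappa = 0%R) &
              forall x : R, inner_set l r x ->
                (g x)%:E = extend l r g l
                  + kappa%:E * ((s x)%:E - extend l r s l)
                  + \int[mu]_(y in `[l, r]%classic) call l r s x y]]
  /\
  [/\ (extend l r s r = +oo ->
        extremal (inner_set l r) (K0minus X s) = puts l r s `]l, r[%classic),
      (extend l r s r < +oo ->
        extremal (inner_set l r) (K0minus X s) = puts l r s `]l, r]%classic) &
      forall g : R -> R, nneg_subharmonic X g ->
        nonconstant_on (inner_set l r) g ->
        nonincreasing_on (inner_set l r) g ->
        bounded_fun_on (inner_set l r) (left_sderiv s g) ->
        exists (kappa : R) (mu : {finite_measure set (\bar R) -> \bar R}),
          [/\ mu (~` `[l, r]%classic) = 0,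
              mu [set l; r] = 0,
              (extend l r s r = +oo -> kappa = 0%R) &
              forall x : R, inner_set l r x ->
                (g x)%:E = extend l r g r
                  + kappa%:E * (extend l r s r - (s x)%:E)
                  + \int[mu]_(y in `[l, r]%classic) put l r s x y]].
Proof.
have sinc := scale_increasing hs; have scont := Defs.scale_continuous hs.
have lr' : - r < - l by rewrite lteN2.
have sinc' := mirror_scale_increasing sinc.
have scont' := mirror_scale_continuous scont.
have lipschitz C g : nondecreasing_on (inner_set l r) g ->
    (forall x y, inner_set l r x -> inner_set l r y -> (x < y)%R ->
      (g y - g x <= C * (s y - s x))%R) -> slipschitz (inner_set l r) C s g.
  move=> ng H x y Ix Iy xy; rewrite ger0_norm; first exact: H.
  by rewrite subr_ge0 ng// ltW.
split; split.
- by move=> E; rewrite (K0plusE lr hs); exact: extremal_Kplus_infinite.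
- by move=> E; rewrite (K0plusE lr hs); exact: extremal_Kplus_finite.
- move=> g Sg _ ng [C HC]; have cg := subharmonic_sconvex hs Sg.
  apply: (nondecreasing_representation lr sinc scont cg Sg.2 ng (C := C)).
  apply: lipschitz => //; apply/(right_sderiv_le sinc cg) => x Ix.
  exact: le_trans (ler_norm _) (HC x Ix).
- move=> E; apply/seteqP; split => g.
    move=> /(extremal_K0minus lr hs); rewrite extremal_Kplus_infinite//; last first.
      by rewrite (extend_mirror_scale _ lr sinc) E.
    by move/(puts_mirror lr hs); apply => y; rewrite /= !in_itv/= !lteN2 andbC.
  move=> Pg; apply/(extremal_K0minus lr hs); rewrite extremal_Kplus_infinite//; last first.
    by rewrite (extend_mirror_scale _ lr sinc) E.
  have DD (y : \bar R) : `]l, r[%classic y <-> `]- r, - l[%classic (- y).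
    by rewrite /= !in_itv/= !lteN2 andbC.
  exact: (puts_mirror lr hs g DD).1 Pg.
- move=> E; apply/seteqP; split => g.
    move=> /(extremal_K0minus lr hs); rewrite extremal_Kplus_finite//; last first.
      by rewrite (extend_mirror_scale _ lr sinc) lteNr.
    by move/(puts_mirror lr hs); apply => y; rewrite /= !in_itv/= lteN2 leeN2 andbC.
  move=> Pg; apply/(extremal_K0minus lr hs); rewrite extremal_Kplus_finite//; last first.
    by rewrite (extend_mirror_scale _ lr sinc) lteNr.
  have DD (y : \bar R) : `]l, r]%classic y <-> `[- r, - l[%classic (- y).
    by rewrite /= !in_itv/= lteN2 leeN2 andbC.
  exact: (puts_mirror lr hs g DD).1 Pg.
- move=> g Sg _ ng [C HC]; have cg := subharmonic_sconvex hs Sg.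
  apply: (nonincreasing_representation lr hs cg (C := C) _ Sg.2 ng).
  have dC : forall x, inner_set l r x -> (- C <= left_sderiv s g x)%R.
    by move=> x /HC; rewrite ler_norml => /andP[].
  have H := (right_sderiv_le sinc' (sconvex_mirror cg) C).1
    ((left_sderiv_ge hs C cg).1 dC).
  have ng' := (nonincreasing_mirror l r g).1 ng.
  have lip' : slipschitz (inner_set (- r) (- l)) C (mirror_scale s) (mirror g).
    move=> x y Ix Iy xy; rewrite ger0_norm; first exact: H.
    by rewrite subr_ge0 ng'// ltW.
  by have := slipschitz_mirror lip'; rewrite !oppeK mirrorK mirror_scaleK.
Qed.
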